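(* Let $h$ be a positive definite form in $\mathcal{H}$ with associated operator $\mathbf{H}$, let $\mathsf{R}(P)$ be a test subspace for $h$ with $\dim\mathsf{R}(P)=m$, and let $q\in\mathbb{N}$. Assume that $\lambda_{q-1}<\lambda_q=\lambda_{q+m-1}<\lambda_{q+m}$ and that $$\frac{\eta_m}{1-\eta_m}<\gamma_s(\lambda_q).$$ Then, for every unitary invariant norm $|||\cdot|||$, $$|||\,\mathbf{I}-\lambda_q\Xi^{-1}\,|||\le \frac{\eta_m}{\mathfrak{g}_q}\,|||\,\mathrm{diag}(\eta_1,\dots,\eta_m)\,|||.$$ In particular, for the Hilbert--Schmidt norm and the eigenvalues $\mu_1\le\dots\le\mu_m$ of $\Xi$, $$\Big[\sum_{i=1}^m\frac{(\lambda_q-\mu_i)^2}{\mu_i^2}\Big]^{1/2}\le\frac{\eta_m}{\mathfrak{g}_q}\big[\eta_1^2+\dots+\eta_m^2\big]^{1/2}.$$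
   Context: $\mathcal{H}$ is an infinite dimensional (real or complex) Hilbert space with scalar product $(\cdot,\cdot)$ and norm $\|\cdot\|$. A positive definite form $h$ is a closed symmetric sesquilinear form with dense domain $\mathcal{Q}(h)\subset\mathcal{H}$ and strictly positive lower bound; write $h[u]=h(u,u)$. It defines (by the representation theorem for forms) a self-adjoint positive definite operator $\mathbf{H}$ with $\mathcal{D}(\mathbf{H}^{1/2})=\mathcal{Q}(h)$ and $h(u,v)=(\mathbf{H}^{1/2}u,\mathbf{H}^{1/2}v)$. The discrete eigenvalues of $\mathbf{H}$ below the infimum $\lambda_{ess}(\mathbf{H})$ of the essential spectrum are listed increasingly with multiplicity, $\lambda_1\le\lambda_2\le\dots<\lambda_{ess}(\mathbf{H})$; all $\lambda_i$, $i\geq 1$, that occur are assumed to exist, and $\lambda_0:=0$. A test subspace is the range $\mathsf{R}(P)$ of an orthogonal projection $P$ with $\dim\mathsf{R}(P)=m\in\mathbb{N}$ and $\mathsf{R}(P)\subset\mathcal{Q}(h)$; $P_\perp=\mathbf{I}-P$. The Rayleigh quotient is $\Xi=(\mathbf{H}^{1/2}P|_{\mathsf{R}(P)})^*\,\mathbf{H}^{1/2}P|_{\mathsf{R}(P)}$, an operator on $\mathsf{R}(P)$ with eigenvalues (Ritz values) $\mu_1\le\dots\le\mu_m$. $\mathbf{W}$ is the self-adjoint operator in $\mathsf{R}(P)^\perp$ defined by the form $h(P_\perp\cdot,P_\perp\cdot)$, and $\mathbf{H}_P$ is the self-adjoint operator in $\mathcal{H}$ defined by the form $h_P(u,v)=h(Pu,Pv)+h(P_\perp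 u,P_\perp v)$, $u,v\in\mathcal{Q}(h)$; thus $\mathbf{H}_P=\Xi\oplus\mathbf{W}$ with respect to $\mathcal{H}=\mathsf{R}(P)\oplus\mathsf{R}(P)^\perp$. For $i=1,\dots,m$, $$\eta_i:=\Big[\max_{\substack{\mathcal{S}\subset\mathsf{R}(P)\\ \dim\mathcal{S}=m-i+1}}\ \min_{\psi\in\mathcal{S},\,\|\psi\|=1}\frac{(\psi,\mathbf{H}^{-1}\psi)-(\psi,\mathbf{H}_P^{-1}\psi)}{(\psi,\mathbf{H}^{-1}\psi)}\Big]^{1/2},$$ so $0\le\eta_1\le\dots\le\eta_m<1$. Further $$\gamma_s(\lambda_q):=\min\Big\{\frac{\lambda_{q+m}-\mu_m}{\lambda_{q+m}+\mu_m},\ \frac{\mu_1-\lambda_{q-1}}{\mu_1+\lambda_{q-1}}\Big\},\qquad \mathfrak{g}_q:=\min\Big\{\frac{|\lambda_q-\mu|}{\mu}:\mu\in\Sigma(\mathbf{W})\Big\},$$ where $\Sigma(\mathbf{W})$ is the spectrum of $\mathbf{W}$. A unitary invariant norm $|||\cdot|||$ is a norm on an ideal $\mathcal{S}\subset\mathcal{L}(\mathcal{H})$ (the $|||\cdot|||$-closure of the finite rank operators, complete under $|||\cdot|||$) such that $|||ABC|||\le\|A\|\,|||B|||\,\|C\|$ for $B\in\mathcal{S}$, $A,C\in\mathcal{L}(\mathcal{H})$; $|||A|||=\|A\|$ for $A$ of rank one; $|||UAV|||=|||A|||$ for $A\in\mathcal{S}$ and $U,V$ unitary. Such a norm depends only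 on the singular values, and is therefore also applied to operators on $\mathsf{R}(P)$ and to $m\times m$ matrices. The Hilbert--Schmidt norm is $|||X|||_{HS}=\sqrt{\mathrm{tr}(X^*X)}$. $\mathrm{diag}(\alpha_1,\dots,\alpha_m)$ is the diagonal matrix with the given entries. *)

(* Defs.v *)
From HB Require Import structures.
From mathcomp Require Import all_boot all_order all_algebra.
From mathcomp Require Import complex.
From mathcomp Require Import all_classical all_reals all_analysis.

Set Implicit Arguments.
Unset Strict Implicit.
Unset Printing Implicit Defensive.

Import Order.TTheory GRing.Theory Num.Theory.
Import numFieldNormedType.Exports.

Local Open Scope classical_set_scope.
Local Open Scope ring_scope.

Inductive scalars := RealScalars | ComplexScalars.

Section Scalars.
Variable R : realType.

Definition scalar (s : scalars) : numFieldType :=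
  match s with
  | RealScalars => (R : numFieldType)
  | ComplexScalars => (R[i] : numFieldType)
  end.

Definition scalar_conj (s : scalars) : {rmorphism scalar s -> scalar s} :=
  match s return {rmorphism scalar s -> scalar s} with
  | RealScalars => (@idfun R : {rmorphism R -> R})
  | ComplexScalars => (@conjc R : {rmorphism R[i] -> R[i]})
  end.

Definition of_real (s : scalars) : {rmorphism R -> scalar s} :=
  match s return {rmorphism R -> scalar s} with
  | RealScalars => (@idfun R : {rmorphism R -> R})
  | ComplexScalars => (real_complex R : {rmorphism R -> R[i]})
  end.

Definition real_part (s : scalars) : scalar s -> R :=
  match s return scalar s -> R with
  | RealScalars => fun x => x
  | ComplexScalars => fun x => complex.Re x
  end.

End Scalars.

(* The scalar product is linear in its first argument, as in {dot _ for _}. *)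
Record hilbert (R : realType) (s : scalars) := Hilbert {
  hilbert_space :> completeNormedModType (scalar R s);
  ip : {dot hilbert_space for scalar_conj R s};
  ip_norm : forall u : hilbert_space, ip u u = `|u| ^+ 2
}.

Section HilbertSpace.
Variables (R : realType) (s : scalars) (H : hilbert R s).
Local Notation K := (scalar R s).
Local Notation "a %:K" := (of_real R s a) (at level 2, format "a %:K").

(* The norm of H takes its values in K; this is the same number in R. *)
Definition rnorm (u : H) : R := real_part (`|u| : K).

Definition rip (u v : H) : R := real_part (ip H u v).

Definition has_dim (V : set H) (n : nat) : Prop :=
  exists e : 'I_n -> H,
    (forall c : 'I_n -> K, \sum_(i < n) c i *: e i = 0 -> forall i, c i = 0) /\
    V = range (fun c : 'I_n -> K => \sum_(i < n) c i *: e i).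

Definition infinite_dim : Prop := forall n : nat, ~ has_dim [set: H] n.

Definition orthonormal_family (n : nat) (e : 'I_n -> H) : Prop :=
  forall i j, ip H (e i) (e j) = (i == j)%:R.

Definition dense_in (X D : set H) : Prop := D `<=` X /\ X `<=` closure D.

(* A possibly unbounded operator is represented by its graph. *)
Definition operator : Type := set (H * H).

Definition op_dom (A : operator) : set H := [set u | exists f, A (u, f)].

Definition op_inv (A : operator) : operator := [set p | A (p.2, p.1)].

Definition op_comp (B A : operator) : operator :=
  [set p | exists2 f, A (p.1, f) & B (f, p.2)].

Definition op_restrict (A : operator) (X : set H) : operator :=
  [set p | X p.1 /\ A p].

(* The value of a single-valued A at u; it is 0 outside the domain of A. *)
Definition op_apply (A : operator) (u : H) : H := xget 0 [set f | A (u, f)].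

(* The adjoint of an operator defined on a dense subspace of X, with values in
   Y, where X and Y are closed subspaces of H. *)
Definition op_adjoint (X Y : set H) (A : operator) : operator :=
  [set p | Y p.1 /\ X p.2 /\
           forall u f, A (u, f) -> ip H f p.1 = ip H u p.2].

Definition self_adjoint (X : set H) (A : operator) : Prop :=
  dense_in X (op_dom A) /\ op_adjoint X X A = A.

Definition positive_sqrt (S A : operator) : Prop :=
  [/\ self_adjoint setT S,
      forall u f, S (u, f) -> 0 <= ip H f u &
      op_comp S S = A].

(* A is regarded as an operator in the closed subspace X. *)
Definition resolvent_set (X : set H) (A : operator) : set K :=
  [set z | (forall f, X f -> exists! u, A (u, f + z *: u)) /\
           exists C : R, forall u f, X f -> A (u, f + z *: u) ->
             rnorm u <= C * rnorm f].

Definition spectrum (X : set H) (A : operator) : set K :=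
  ~` resolvent_set X A.

(* All the spectra below are those of self-adjoint operators, hence real. *)
Definition real_spectrum (X : set H) (A : operator) : set R :=
  [set t | spectrum X A t%:K].

Definition eigenspace (A : operator) (t : R) : set H :=
  [set u | A (u, t%:K *: u)].

Definition discrete_spectrum (A : operator) : set R :=
  [set t | [/\ real_spectrum setT A t,
               exists2 eps : R, 0 < eps &
                 forall r, real_spectrum setT A r -> `|r - t| < eps -> r = t &
               exists2 n : nat, (0 < n)%N & has_dim (eigenspace A t) n]].

Definition essential_spectrum (A : operator) : set R :=
  real_spectrum setT A `\` discrete_spectrum A.

(* This is +oo if the essential spectrum is empty. *)
Definition lambda_ess (A : operator) : \bar R :=
  ereal_inf [set t%:E | t in essential_spectrum A].

Definition occurrences (lam : nat -> R) (n : nat) (t : R) : nat :=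
  count (fun i => lam i == t) (index_iota 1 n.+1).

Definition nondecreasing_upto (lam : nat -> R) (n : nat) : Prop :=
  forall i j : nat, (1 <= i)%N -> (i <= j)%N -> (j <= n)%N -> lam i <= lam j.

(* lam 1 <= ... <= lam n are the n lowest eigenvalues of A, repeated according
   to multiplicity, and all of them lie below the essential spectrum; the last
   one may have further occurrences beyond n. *)
Definition lowest_eigenvalues (A : operator) (lam : nat -> R) (n : nat) : Prop :=
  [/\ lam 0%N = 0,
      nondecreasing_upto lam n,
      forall i : nat, (1 <= i <= n)%N -> ((lam i)%:E < lambda_ess A)%E,
      forall t : R, t < lam n ->
        has_dim (eigenspace A t) (occurrences lam n t) &
      exists2 d : nat, (occurrences lam n (lam n) <= d)%N &
        has_dim (eigenspace A (lam n)) d].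

(* mu 1 <= ... <= mu m are all the eigenvalues of A, with multiplicity. *)
Definition all_eigenvalues (A : operator) (mu : nat -> R) (m : nat) : Prop :=
  nondecreasing_upto mu m /\
  forall t : R, has_dim (eigenspace A t) (occurrences mu m t).

(* Only the values of h on form_dom h x form_dom h are meaningful. *)
Record posdef_form := PosdefForm {
  form_dom : set H;
  form_val :> H -> H -> K;
  form_dom0 : form_dom 0;
  form_domP : forall (a : K) u v,
    form_dom u -> form_dom v -> form_dom (a *: u + v);
  form_linear : forall (a : K) u v w,
    form_dom u -> form_dom v -> form_dom w ->
    form_val (a *: u + v) w = a * form_val u w + form_val v w;
  form_symmetric : forall u v, form_dom u -> form_dom v ->
    form_val u v = scalar_conj R s (form_val v u);
  form_dense : dense form_dom;
  form_posdef : exists2 c : R, 0 < c &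
    forall u, form_dom u -> c%:K * `|u| ^+ 2 <= form_val u u;
  form_closed : forall (u_ : nat -> H) (u : H),
    (forall n, form_dom (u_ n)) ->
    u_ @ \oo --> u ->
    (forall eps : R, 0 < eps -> exists N : nat, forall n p,
      (N <= n)%N -> (N <= p)%N ->
      form_val (u_ n - u_ p) (u_ n - u_ p) < eps%:K) ->
    form_dom u /\
    (forall eps : R, 0 < eps -> exists N : nat, forall n,
      (N <= n)%N -> form_val (u_ n - u) (u_ n - u) < eps%:K)
}.

(* The operator given by the representation theorem for a form a with domain Q
   in the closed subspace X: u is in its domain and is mapped to f iff u is in
   Q and a(u, v) = (f, v) for all v in Q. *)
Definition form_operator (X Q : set H) (a : H -> H -> K) : operator :=
  [set p | Q p.1 /\ X p.2 /\ forall v, Q v -> a p.1 v = ip H p.2 v].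

Definition orthogonal_projection (P : {linear H -> H}) : Prop :=
  (forall u, P (P u) = P u) /\ (forall u v, ip H (P u) v = ip H u (P v)).

Definition test_projection (h : posdef_form) (P : {linear H -> H}) (m : nat) :=
  [/\ orthogonal_projection P, has_dim (range P) m & range P `<=` form_dom h].

Section TestSubspace.
Variables (h : posdef_form) (P : {linear H -> H}).

Definition Pperp (u : H) : H := u - P u.

Definition op_H : operator := form_operator setT (form_dom h) h.

Definition op_HP : operator :=
  form_operator setT (form_dom h)
    (fun u v => h (P u) (P v) + h (Pperp u) (Pperp v)).

Definition op_W : operator :=
  form_operator (range Pperp) (form_dom h `&` range Pperp)
    (fun u v => h (Pperp u) (Pperp v)).

(* S stands for H^(1/2). *)
Definition rayleigh_quotient (S : operator) : operator :=
  let T := op_restrict S (range P) in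
  op_comp (op_adjoint (range P) setT T) T.

Definition eta_ratio (psi : H) : R :=
  (rip psi (op_apply (op_inv op_H) psi) - rip psi (op_apply (op_inv op_HP) psi))
  / rip psi (op_apply (op_inv op_H) psi).

(* Here m is the dimension of the test subspace and 1 <= i <= m. The maximum
   over subspaces and the minimum over unit vectors are attained; sup and inf
   are their total counterparts. *)
Definition eta (m i : nat) : R :=
  Num.sqrt (sup [set x | exists S : set H,
    [/\ S `<=` range P, has_dim S (m - i).+1 &
        x = inf [set eta_ratio psi | psi in [set u | S u /\ rnorm u = 1]]]]).

(* The infimum over the (closed) spectrum of W is attained. *)
Definition relative_gap (lamq : R) : R :=
  inf [set `|lamq - t| / t | t in real_spectrum (range Pperp) op_W].

End TestSubspace.

Definition gamma_s (lam mu : nat -> R) (q m : nat) : R :=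
  Num.min ((lam (q + m)%N - mu m) / (lam (q + m)%N + mu m))
          ((mu 1%N - lam q.-1) / (mu 1%N + lam q.-1)).

Definition bounded_op (A : H -> H) : Prop := linear A /\ continuous A.

Definition opnorm (A : H -> H) : R :=
  sup [set rnorm (A u) | u in [set u | rnorm u <= 1]].

Definition finite_rank (A : H -> H) : Prop :=
  bounded_op A /\ exists n : nat, has_dim (range A) n.

Definition unitary_op (U : H -> H) : Prop :=
  [/\ linear U, forall u v, ip H (U u) (U v) = ip H u v & range U = setT].

(* Only the values of the norm on ui_ideal are meaningful. *)
Record unitary_invariant_norm := UnitaryInvariantNorm {
  ui_ideal : set (H -> H);
  ui_norm :> (H -> H) -> R;
  ui_ideal_bounded : forall A, ui_ideal A -> bounded_op A;
  ui_ideal_linear : forall (a : K) A B,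
    ui_ideal A -> ui_ideal B -> ui_ideal (a *: A + B);
  ui_ideal_comp : forall A B C,
    bounded_op A -> ui_ideal B -> bounded_op C -> ui_ideal (A \o B \o C);
  ui_norm_eq0 : forall A, ui_ideal A -> ui_norm A = 0 -> A = 0;
  ui_normZ : forall (a : K) A,
    ui_ideal A -> ui_norm (a *: A) = real_part (`|a| : K) * ui_norm A;
  ui_normD : forall A B,
    ui_ideal A -> ui_ideal B -> ui_norm (A + B) <= ui_norm A + ui_norm B;
  ui_finite_rank : forall A, finite_rank A -> ui_ideal A;
  ui_closure : forall A, ui_ideal A -> forall eps : R, 0 < eps ->
    exists2 F, finite_rank F & ui_norm (A - F) < eps;
  ui_complete : forall A_ : nat -> H -> H,
    (forall n, ui_ideal (A_ n)) ->
    (forall eps : R, 0 < eps -> exists N : nat, forall n p,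
      (N <= n)%N -> (N <= p)%N -> ui_norm (A_ n - A_ p) < eps) ->
    exists2 A, ui_ideal A &
      forall eps : R, 0 < eps -> exists N : nat, forall n,
        (N <= n)%N -> ui_norm (A_ n - A) < eps;
  ui_norm_comp : forall A B C,
    bounded_op A -> ui_ideal B -> bounded_op C ->
    ui_norm (A \o B \o C) <= opnorm A * ui_norm B * opnorm C;
  ui_norm_rank1 : forall A,
    bounded_op A -> has_dim (range A) 1 -> ui_norm A = opnorm A;
  ui_norm_unitary : forall U A V,
    unitary_op U -> ui_ideal A -> unitary_op V ->
    ui_norm (U \o A \o V) = ui_norm A
}.

(* A matrix acts on the span of an orthonormal family e, and as 0 on the
   orthogonal complement. Its singular values, hence its unitary invariant
   norms, do not depend on e. *)
Definition mx_op (n : nat) (e : 'I_n -> H) (M : 'M[K]_n) (u : H) : H :=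
  \sum_(i < n) (\sum_(j < n) M i j * ip H u (e j)) *: e i.

Definition diag_seq (n : nat) (alpha : nat -> R) : 'M[K]_n :=
  diag_mx (\row_(j < n) (alpha j.+1)%:K).

(* I - l * Xi^-1 on range P, extended by 0 to the orthogonal complement. *)
Definition residual (P : {linear H -> H}) (Xi : operator) (l : R) (u : H) : H :=
  P u - l%:K *: op_apply (op_inv Xi) (P u).

End HilbertSpace.

(* Main.v *)
From HB Require Import structures.
From mathcomp Require Import all_boot all_order all_algebra.
From mathcomp Require Import ring lra zify complex.
From mathcomp Require Import all_classical all_reals all_analysis.
Require Import Defs.

Set Implicit Arguments.
Unset Strict Implicit.
Unset Printing Implicit Defensive.

Import Order.TTheory GRing.Theory Num.Theory.
Import numFieldNormedType.Exports.

Local Open Scope classical_set_scope.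
Local Open Scope ring_scope.

(** Write eta for eta_m and L for lambda_q, and let the form domain carry the
inner product h, for which it is a Hilbert space. In it the test subspace R(P)
and the form domain of W, which consists of the vectors of the form domain
killed by P, are complementary but in general not h-orthogonal. The
h-orthogonal projection Z of R(P) into the form domain of W measures the angle
between them, and everything is expressed through Z.

The numbers eta_i. Diagonalising h(Za, Zb) against h(a, b) on R(P) gives an
h-orthonormal basis f_i of R(P) and numbers x_i in [0, 1) with h(Z f_i, Z f_j)
= x_i delta_ij. For psi in R(P) both inverses are explicit: (psi, H_P^-1 psi)
is the sum of |(psi, f_i)|^2 and (psi, H^-1 psi) is the sum of |(psi, f_i)|^2 /
(1 - x_i) (op_HP_inv, op_H_inv). The quotient in the definition of eta_i is
therefore a weighted average of the x_i, whence x_i <= eta_i^2, and eta^2 is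
the largest x_i (eta_bounds, eta_last). In particular h[Za] <= eta^2 h[a].

Separation. By Cauchy-Schwarz h and h_P differ by at most eta h_P
(form_two_sided), so min-max arguments compare the spectra of H and of the
direct sum of Xi and W. The hypothesis with gamma_s means mu_m < (1 - 2 eta)
lambda_{q+m} and lambda_{q-1} < (1 - 2 eta) mu_1, and this keeps L out of the
spectrum of W (cluster_gap). The inverse of 1 - L W^-1 then has norm at most 1
/ g for the inner product h, where g is the relative gap (relative_gap_spec).

The residual. As L is not an eigenvalue of W, the projection P is injective on
the m eigenvectors of H that belong to L, so every a in R(P) is Pu with Hu =
Lu. For x = u - a the eigenvalue equation says (1 - L W^-1) x = - Za, and r =
(1 - L Xi^-1) a satisfies h(r, v) = - h(x, Zv) for v in R(P). In other words 1
- L Xi^-1 is the h-adjoint of Z, times the inverse of 1 - L W^-1, times Z; this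
is quadratic in Z and gives h[r] <= (eta / g)^2 h[Za] (cluster_residual).

The norms. The square root of Xi maps R(P) with the inner product h
isometrically to R(P) with the inner product of the Hilbert space, and commutes
with 1 - L Xi^-1. Reading the last bound in the basis f_i, the residual is X
diag(eta_1, ..., eta_m) Y with |X| <= eta / g and |Y| <= 1 (ui_norm_bound); the
sum of the h[(1 - L Xi^-1) f_i] is its squared Hilbert-Schmidt norm
(hs_norm_bound).

No spectral theorem is used. Three facts on a bounded symmetric operator T of a
Hilbert space replace it: if T - r is bounded below whenever |r| < c, then |Tx|
>= c |x|; if T is bounded below, it is onto; if the top of the spectrum of T is
isolated, it is an eigenvalue. They are applied to the operator G with h(Gf, v)
= (f, v), the inverse of the operator of the form on a closed subspace of the
form domain, and they depend on real parts only, so the real and the complex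
case are treated together. *)

(** * Symmetric operators on real inner product spaces *)

Lemma quad_ge0_discr (R : realType) (A B C : R) :
  (forall t, 0 <= A * t ^+ 2 + 2 * B * t + C) -> B ^+ 2 <= A * C.
Proof.
move=> Q.
have C0 : 0 <= C by have := Q 0; rewrite expr2 !mulr0 !add0r.
have A0 : 0 <= A.
  rewrite leNgt; apply/negP => A0.
  have CA : 0 <= - (C + 1) / A.
    by rewrite mulNr -mulrN -invrN; apply: divr_ge0; lra.
  have Bs := sqrtr_ge0 (- (C + 1) / A).
  have := Q (Num.sqrt (- (C + 1) / A)).
  have := Q (- Num.sqrt (- (C + 1) / A)).
  rewrite sqrrN sqr_sqrtr //.
  have -> : A * (- (C + 1) / A) = - (C + 1) by field; lra.
  lra.
have [A1|A1] := eqVneq A 0.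
  move: Q; rewrite A1 mul0r => Q.
  have [->|B0] := eqVneq B 0; first by rewrite expr0n.
  have := Q (- (C + 1) / (2 * B)).
  rewrite mul0r add0r.
  have -> : 2 * B * (- (C + 1) / (2 * B)) = - (C + 1) by field.
  lra.
have := Q (- B / A).
have -> : A * (- B / A) ^+ 2 + 2 * B * (- B / A) + C = (A * C - B ^+ 2) / A.
  by field.
rewrite pmulr_lge0 ?invr_gt0 ?lt_def ?A1 //; lra.
Qed.

Lemma le0_of_forall_eps (R : realFieldType) (x a : R) :
  0 <= a -> (forall e, 0 < e -> x <= a * e) -> x <= 0.
Proof.
move=> a0 Hx; rewrite leNgt; apply/negP => x0.
have := Hx (x / (2 * (a + 1))).
have e0 : 0 < x / (2 * (a + 1)) by apply: divr_gt0 => //; lra.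
move=> /(_ e0).
have -> : a * (x / (2 * (a + 1))) = x * (a / (2 * (a + 1))) by field; lra.
suff : x * (a / (2 * (a + 1))) < x * 1 by lra.
by rewrite ltr_pM2l // ltr_pdivrMr; lra.
Qed.

Lemma ex_positive_null_sequence (R : archiRealFieldType) : exists2 r : nat -> R,
  forall n, 0 < r n &
  forall eps, 0 < eps -> exists N : nat, forall n, (N <= n)%N -> r n < eps.
Proof.
exists (fun n => n.+1%:R^-1) => [n|eps e0]; first by rewrite invr_gt0.
have [N NP] : exists N : nat, eps^-1 < N%:R.
  by exists (Num.truncn eps^-1).+1; apply: truncnS_gt.
exists N => n Nn; rewrite invf_plt ?posrE ?ltr0Sn //.
by apply: lt_le_trans NP _; rewrite ler_nat (leq_trans Nn).
Qed.

Section RealPreHilbert.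
Variables (R : realType) (E : lmodType R) (b : E -> E -> R).

Definition symm_bilinear :=
  (forall a u v w, b (a *: u + v) w = a * b u w + b v w) /\
  (forall u v, b u v = b v u).

Definition form_cauchy (u : nat -> E) := forall eps, 0 < eps ->
  exists N, forall n p, (N <= n)%N -> (N <= p)%N ->
    b (u n - u p) (u n - u p) < eps.

Definition form_cvg (u : nat -> E) (l : E) := forall eps, 0 < eps ->
  exists N, forall n, (N <= n)%N -> b (u n - l) (u n - l) < eps.

Definition form_complete := forall u, form_cauchy u -> exists l, form_cvg u l.

Definition form_sym (T : E -> E) := forall u v, b (T u) v = b u (T v).

Definition bounded_below (T : E -> E) :=
  exists2 d, 0 < d & forall x, d * b x x <= b (T x) (T x).

Hypothesis bB : symm_bilinear.

Let bC u v : b u v = b v u. Proof. by case: bB. Qed.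
Let bPl a u v w : b (a *: u + v) w = a * b u w + b v w.
Proof. by case: bB. Qed.

Lemma formDl u v w : b (u + v) w = b u w + b v w.
Proof. by rewrite -{1}[u]scale1r bPl mul1r. Qed.
Lemma form0l w : b 0 w = 0.
Proof. by apply: (@addrI _ (b 0 w)); rewrite -formDl !addr0. Qed.
Lemma formZl a u w : b (a *: u) w = a * b u w.
Proof. by rewrite -[_ *: _]addr0 bPl form0l addr0. Qed.
Lemma formNl u w : b (- u) w = - b u w.
Proof. by rewrite -scaleN1r formZl mulN1r. Qed.
Lemma formBl u v w : b (u - v) w = b u w - b v w.
Proof. by rewrite formDl formNl. Qed.
Lemma formDr u v w : b w (u + v) = b w u + b w v.
Proof. by rewrite bC formDl !(bC _ w). Qed.
Lemma formZr a u w : b w (a *: u) = a * b w u.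
Proof. by rewrite bC formZl (bC _ w). Qed.
Lemma formNr u w : b w (- u) = - b w u.
Proof. by rewrite bC formNl (bC _ w). Qed.
Lemma formBr u v w : b w (u - v) = b w u - b w v.
Proof. by rewrite formDr formNr. Qed.
Lemma form0r w : b w 0 = 0. Proof. by rewrite bC form0l. Qed.

Definition formE :=
  (formDl, formBl, formNl, formZl, form0l, formDr, formBr, formNr, formZr,
   form0r).

Hypothesis b_ge0 : forall u, 0 <= b u u.

Lemma form_cauchy_schwarz u v : b u v ^+ 2 <= b u u * b v v.
Proof.
rewrite [_ * b v v]mulrC; apply: quad_ge0_discr => t.
suff -> : b v v * t ^+ 2 + 2 * b u v * t + b u u = b (t *: v + u) (t *: v + u).
  exact: b_ge0.
rewrite !formE (bC v u); ring.
Qed.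

Lemma form_sqD u v : b (u + v) (u + v) <= 2 * b u u + 2 * b v v.
Proof.
have := b_ge0 (u - v); rewrite !formE (bC v u); lra.
Qed.

Lemma form_sqB u v : b (u - v) (u - v) <= 2 * b u u + 2 * b v v.
Proof. by have := form_sqD u (- v); rewrite !(formNl, formNr) opprK. Qed.

End RealPreHilbert.

Section RieszDensity.
Variables (R : realType) (E : lmodType R) (b : E -> E -> R).
Hypothesis bB : symm_bilinear b.
Hypothesis b_ge0 : forall u, 0 <= b u u.
Hypothesis b_complete : form_complete b.

Let bC u v : b u v = b v u. Proof. by case: bB. Qed.

(** Minimising sequences of b d d - 2 l d over D are Cauchy by the
parallelogram law, and their limit is the Riesz vector of l on D. That it can be
approximated from D is part of the conclusion because the density arguments
below rest on it. *)
Lemma riesz_in_closure (D : set E) (l : E -> R) (C : R) :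
  D 0 -> (forall a u v, D u -> D v -> D (a *: u + v)) ->
  (forall a u v, l (a *: u + v) = a * l u + l v) ->
  (forall d, l d ^+ 2 <= C * b d d) ->
  exists2 p, (forall d, D d -> b p d = l d) &
    forall eps, 0 < eps -> exists2 d, D d & b (p - d) (p - d) < eps.
Proof.
move=> D0 Dlin llin lC.
have lD u v : l (u + v) = l u + l v by rewrite -{1}[u]scale1r llin mul1r.
have l0 : l 0 = 0 by apply: (@addrI _ (l 0)); rewrite -lD !addr0.
have lZ a u : l (a *: u) = a * l u by rewrite -[_ *: _]addr0 llin l0 addr0.
pose J d := b d d - 2 * l d.
have JC d : - `|C| <= J d.
  have bd := b_ge0 d.
  have h1 : l d ^+ 2 <= `|C| * b d d.
    by apply: le_trans (lC d) _; apply: ler_wpM2r => //; exact: ler_norm.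
  have h2 : (2 * l d) ^+ 2 <= (`|C| + b d d) ^+ 2.
    have := sqr_ge0 (`|C| - b d d); rewrite sqrrB sqrrD; lra.
  have C0 := normr_ge0 C.
  have : `|2 * l d| <= `|(`|C| + b d d)| by rewrite -ler_sqr ?nnegrE // !real_normK ?num_real.
  rewrite [X in _ <= X]ger0_norm; last by lra.
  have := ler_norm (2 * l d); rewrite /J; lra.
pose I := inf [set J d | d in D]%classic.
have IJ d : D d -> I <= J d.
  move=> Dd; apply: ge_inf; last by exists d.
  by exists (- `|C|) => _ [e _ <-].
have [r_ r0 small] := ex_positive_null_sequence R.
have ex_d (n : nat) : exists d, D d /\ J d < I + r_ n.
  have hI : has_inf [set J d | d in D]%classic.
    by split; [exists (J 0), 0|exists (- `|C|) => _ [e _ <-]].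
  by have [_ [d Dd <-] Jd] := inf_adherent (r0 n) hI; exists d.
have [d_ d_P] := choice ex_d.
(* Two almost minimal vectors are close: their midpoint lies in D, where J
   is at least I. *)
have JB u v : b (u - v) (u - v) =
    2 * J u + 2 * J v - 4 * J (2^-1 *: (u + v)).
  by rewrite /J lZ lD !(formE bB) (bC v u); field.
have Dmid u v : D u -> D v -> D (2^-1 *: (u + v)).
  move=> Du Dv; rewrite -[_ *: _]addr0; apply: (Dlin) => //.
  by rewrite -[u]scale1r; apply: Dlin.
have dB n p : b (d_ n - d_ p) (d_ n - d_ p) < 2 * r_ n + 2 * r_ p.
  have [Dn Jn] := d_P n; have [Dp Jp] := d_P p.
  have := IJ _ (Dmid _ _ Dn Dp); rewrite JB.
  lra.
have [p pP] : exists p, form_cvg b d_ p.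
  apply: b_complete => eps e0.
  have [|N NP] := small (eps / 4); first by lra.
  exists N => n p Nn Np; apply: lt_trans (dB n p) _.
  have := NP _ Nn; have := NP _ Np; lra.
have bBC u v : b (u - v) (u - v) = b (v - u) (v - u).
  by rewrite -opprB (formNl bB) (formNr bB) opprK.
exists p; last first.
  move=> eps e0; have [N NP] := pP _ e0; exists (d_ N); first by case: (d_P N).
  by rewrite bBC; exact: NP.
move=> d Dd; apply/eqP; rewrite -subr_eq0 -sqrf_eq0 eq_le sqr_ge0 andbT.
apply: (@le0_of_forall_eps _ _ (4 * b d d)); first by rewrite mulr_ge0.
move=> eps e0.
have [N1 N1P] := pP _ e0; have [N2 N2P] := small _ e0.
pose n := maxn N1 N2.
have := N1P n (leq_maxl _ _); have := N2P n (leq_maxr _ _) => h2 h1.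
have [Dn Jn] := d_P n.
(* The first variation of J at an almost minimal vector is of the order of
   the square root of its excess over the infimum. *)
have h3 : (b (d_ n) d - l d) ^+ 2 <= b d d * r_ n.
  apply: quad_ge0_discr => t.
  have Dt : D (t *: d + d_ n) by apply: Dlin.
  have := IJ _ Dt; rewrite /J lD lZ !(formE bB) (bC d (d_ n)).
  move: Jn; rewrite /J; set x := b (d_ n) (d_ n); set y := b (d_ n) d.
  set z := b d d; set i := r_ n => Jn Jt.
  suff : I <= (z * t ^+ 2 + 2 * (y - l d) * t) + (x - 2 * l (d_ n)) by lra.
  apply: le_trans Jt _; rewrite le_eqVlt; apply/orP; left; apply/eqP; ring.
have h4 := form_cauchy_schwarz bB b_ge0 (d_ n - p) d.
have h5 : b (d_ n - p) (d_ n - p) * b d d <= eps * b d d.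
  by rewrite ler_wpM2r ?b_ge0 // ltW.
have h6 : b d d * r_ n <= b d d * eps.
  by rewrite ler_wpM2l ?b_ge0 // ltW.
move: h4; rewrite (formBl bB) => h4.
have -> : b p d - l d = (b (d_ n) d - l d) - (b (d_ n) d - b p d) by ring.
set A := b (d_ n) d - l d in h3 *; set B := b (d_ n) d - b p d in h4 *.
have := sqr_ge0 (A + B); rewrite sqrrB sqrrD; lra.
Qed.

End RieszDensity.

Section SymmetricOperators.
Variables (R : realType) (E : lmodType R) (b : E -> E -> R).
Hypothesis bB : symm_bilinear b.
Hypothesis b_ge0 : forall u, 0 <= b u u.
Hypothesis b_eq0 : forall u, b u u = 0 -> u = 0.

Let bC u v : b u v = b v u. Proof. by case: bB. Qed.

Lemma form_sym_linear T a u v : form_sym b T ->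
  T (a *: u + v) = a *: T u + T v.
Proof.
move=> Ts; apply/eqP; rewrite -subr_eq0; apply/eqP; apply: b_eq0.
set w := (X in b _ X); move: w => w.
by rewrite !(formE bB) !Ts !(formE bB) subrr.
Qed.

Lemma form_sym_sub T k : form_sym b T -> form_sym b (fun x => T x - k *: x).
Proof. by move=> Ts u v; rewrite !(formE bB) Ts. Qed.

(** Cauchy-Schwarz for the semidefinite form (x, y) |-> b (D x) y, applied
to x and D x. *)
Lemma nonneg_op_bound D N x : form_sym b D -> (forall x, 0 <= b (D x) x) ->
  (forall x, b (D x) x <= N * b x x) -> b (D x) (D x) <= N * b (D x) x.
Proof.
move=> Ds D0 DN.
have dB : symm_bilinear (fun x y => b (D x) y).
  by split=> [a u v w|u v]; rewrite ?form_sym_linear ?(formE bB) // Ds bC.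
have := form_cauchy_schwarz dB D0 x (D x); rewrite expr2 /=.
have h1 : b (D x) x * b (D (D x)) (D x) <= b (D x) x * (N * b (D x) (D x)).
  by rewrite ler_wpM2l.
have [->|nz] := eqVneq (b (D x) (D x)) 0.
  move=> _; have [N0|N0] := leP 0 N; first by rewrite mulr_ge0.
  have -> : b (D x) x = 0; last by rewrite mulr0.
  apply/eqP; rewrite eq_le D0 andbT (le_trans (DN x)) //.
  by rewrite nmulr_rle0.
move=> h2; have /ler_pM2r <- : 0 < b (D x) (D x) by rewrite lt_def nz b_ge0.
by apply: le_trans h2 _; apply: le_trans h1 _; rewrite le_eqVlt; apply/orP; left; apply/eqP; ring.
Qed.

(** Let rho be the largest lower bound of |Tx|^2 / |x|^2. If rho < c^2, then
T^2 - rho is the product of T - sqrt rho and T + sqrt rho, hence bounded below;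
being positive as well, it is bounded below as a quadratic form, and rho could
be enlarged. *)
Lemma norm_ge_of_gap T M c : form_sym b T ->
  (forall x, b (T x) (T x) <= M * b x x) -> 0 <= c ->
  (forall r, 0 <= r < c -> bounded_below b (fun x => T x - r *: x) /\
                           bounded_below b (fun x => T x - (- r) *: x)) ->
  forall x, c ^+ 2 * b x x <= b (T x) (T x).
Proof.
move=> Ts TM c0 gap x0; rewrite leNgt; apply/negP => Tx0.
have bx0 : 0 < b x0 x0.
  rewrite lt_def b_ge0 andbT; apply/eqP => bx; move: Tx0.
  by rewrite bx mulr0 ltNge b_ge0.
pose S := [set a | forall x, a * b x x <= b (T x) (T x)]%classic.
have S0 : S 0 by move=> x; rewrite mul0r.
have Sub : ubound S (b (T x0) (T x0) / b x0 x0).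
  by move=> a /(_ x0); rewrite ler_pdivlMr.
have supS : has_sup S by split; [exists 0|exists (b (T x0) (T x0) / b x0 x0)].
have sup0 : 0 <= sup S by apply: ub_le_sup => //; case: supS.
have supP x : sup S * b x x <= b (T x) (T x).
  have [bx|nz] := eqVneq (b x x) 0; first by rewrite bx mulr0.
  have bx : 0 < b x x by rewrite lt_def nz b_ge0.
  rewrite -ler_pdivlMr //; apply: ge_sup; first by exists 0.
  by move=> a /(_ x); rewrite -ler_pdivlMr.
pose r := Num.sqrt (sup S).
have r2 : r ^+ 2 = sup S by rewrite sqr_sqrtr.
have rc : r < c.
  rewrite -ltr_sqr ?nnegrE ?sqrtr_ge0 // r2.
  have : sup S <= b (T x0) (T x0) / b x0 x0 by apply: ge_sup => //; exists 0.
  move=> h; apply: le_lt_trans h _; rewrite ltr_pdivrMr //.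
have [|[d1 d1p d1P] [d2 d2p d2P]] := gap r; first by rewrite sqrtr_ge0.
pose D x := T (T x) - sup S *: x.
have Ds : form_sym b D by move=> u v; rewrite /D !(formE bB) !Ts.
have DE x : b (D x) x = b (T x) (T x) - sup S * b x x.
  by rewrite /D !(formE bB) Ts.
have D0 x : 0 <= b (D x) x by rewrite DE subr_ge0.
have DM x : b (D x) x <= (`|M| + 1) * b x x.
  rewrite DE; have := supP x; have := TM x; have := b_ge0 x.
  have : M * b x x <= `|M| * b x x by rewrite ler_wpM2r ?ler_norm.
  have : 0 <= sup S * b x x by rewrite mulr_ge0.
  lra.
have M1 : 0 < `|M| + 1 by have := normr_ge0 M; lra.
suff : sup S + d1 * d2 / (`|M| + 1) <= sup S.
  suff : 0 < d1 * d2 / (`|M| + 1) by lra.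
  by rewrite divr_gt0 ?mulr_gt0.
apply: ub_le_sup; first by case: supS.
move=> x; rewrite mulrDl -lerBrDl -DE mulrAC ler_pdivrMr // [X in _ <= X]mulrC.
apply: le_trans (nonneg_op_bound x Ds D0 DM).
have Tl a u v : T (a *: u + v) = a *: T u + T v by apply: form_sym_linear.
have -> : D x = T (T x - (- r) *: x) - r *: (T x - (- r) *: x).
  rewrite /D -r2 scaleNr opprK (addrC (T x)) Tl scalerDr scalerA -expr2.
  by rewrite opprD [- _ - r *: _]addrC addrACA subrr add0r.
apply: le_trans (d1P _); rewrite -mulrA ler_wpM2l // ltW //.
Qed.

Hypothesis b_complete : form_complete b.

Lemma closure_range_proj T y : form_sym b T ->
  exists2 p, (forall d, range T d -> b p d = b y d) &
    forall eps, 0 < eps -> exists2 d, range T d & b (p - d) (p - d) < eps.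
Proof.
move=> Ts; apply: (@riesz_in_closure _ _ _ bB b_ge0 b_complete _ _ (b y y)).
- by exists 0 => //; apply: b_eq0; rewrite Ts (form0l bB).
- by move=> a _ _ [u _ <-] [v _ <-]; exists (a *: u + v); rewrite ?form_sym_linear.
- by move=> a u v; rewrite !(formE bB).
- exact: form_cauchy_schwarz.
Qed.

(** The lower bound makes the range closed and T injective; by symmetry the
orthogonal complement of the range is the kernel. *)
Lemma bounded_below_surj T M : form_sym b T ->
  (forall x, b (T x) (T x) <= M * b x x) -> bounded_below b T ->
  forall y, exists x, T x = y.
Proof.
move=> Ts TM [d d0 dP] y.
have Tl a u v : T (a *: u + v) = a *: T u + T v by apply: form_sym_linear.
have TB u v : T (u - v) = T u - T v.
  by rewrite addrC -scaleN1r Tl scaleN1r addrC.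
have [y' pP pD] := closure_range_proj y Ts.
have py : y' = y.
  apply/eqP; rewrite -subr_eq0; apply/eqP; apply: b_eq0; apply/eqP.
  rewrite eq_le b_ge0 andbT -(@pmulr_lle0 _ d) // mulrC.
  apply: le_trans (dP _) _; rewrite Ts (formBl bB) subr_le0.
  by rewrite pP //; exists (T (y' - y)).
rewrite {}py in pD => {pP}.
have [r_ r0 small] := ex_positive_null_sequence R.
have ex_x (n : nat) : exists x, b (y - T x) (y - T x) < r_ n.
  by have [_ [x _ <-] xP] := pD _ (r0 n); exists x.
have [x_ x_P] := choice ex_x.
have [x xP] : exists x, form_cvg b x_ x.
  apply: b_complete => eps e0.
  have [|N NP] := small (d * eps / 4).
    by rewrite divr_gt0 ?mulr_gt0.
  exists N => n p Nn Np.
  rewrite -(ltr_pM2l d0); apply: le_lt_trans (dP _) _; rewrite TB.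
  have -> : T (x_ n) - T (x_ p) = (y - T (x_ p)) - (y - T (x_ n)).
    by rewrite opprB [RHS]addrC addrA subrK.
  apply: le_lt_trans (form_sqB bB b_ge0 _ _) _.
  have := NP _ Nn; have := NP _ Np; have := x_P n; have := x_P p; lra.
exists x; apply/eqP; rewrite -subr_eq0; apply/eqP; apply: b_eq0; apply/eqP.
rewrite eq_le b_ge0 andbT; apply: (@le0_of_forall_eps _ _ (2 * `|M| + 2)).
  by have := normr_ge0 M; lra.
move=> eps e0.
have [N1 N1P] := xP _ e0; have [N2 N2P] := small _ e0.
pose n := maxn N1 N2.
have h1 := N1P n (leq_maxl _ _); have h2 := N2P n (leq_maxr _ _).
have -> : T x - y = - ((y - T (x_ n)) + T (x_ n - x)).
  by rewrite TB addrA subrK opprB.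
rewrite (formNl bB) (formNr bB) opprK.
apply: le_trans (form_sqD bB b_ge0 _ _) _.
have h3 := x_P n; have h4 := TM (x_ n - x).
have h5 : M * b (x_ n - x) (x_ n - x) <= `|M| * b (x_ n - x) (x_ n - x).
  by rewrite ler_wpM2r ?ler_norm.
have h6 : `|M| * b (x_ n - x) (x_ n - x) <= `|M| * eps.
  by rewrite ler_wpM2l // ltW.
lra.
Qed.

(** Suppose that C = k - T is injective. The spectral gap below k gives
eps C <= C^2, so C is bounded below as a form on its range. The range is dense,
since C is symmetric and injective; hence C is bounded below everywhere, and k is
not the supremum of the form of T. *)
Lemma isolated_top_eigenvector T M k eps : form_sym b T ->
  (forall x, b (T x) (T x) <= M * b x x) ->
  (forall x, b (T x) x <= k * b x x) ->
  (forall d, 0 < d -> exists x, (k - d) * b x x < b (T x) x) ->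
  0 < eps ->
  (forall r, k - eps < r < k -> bounded_below b (fun x => T x - r *: x)) ->
  exists2 x, x != 0 & T x = k *: x.
Proof.
move=> Ts TM Tk ksup e0 isol.
have Tl a u v : T (a *: u + v) = a *: T u + T v by apply: form_sym_linear.
apply: contrapT => nex.
have [C CD] : exists C, forall x, C x = k *: x - T x by exists (fun x => k *: x - T x).
have Cs : form_sym b C by move=> u v; rewrite !CD !(formE bB) Ts.
have CE x : b (C x) x = k * b x x - b (T x) x by rewrite CD !(formE bB).
have C0 x : 0 <= b (C x) x by rewrite CE subr_ge0.
pose N := `|k| + (`|M| + 1).
have N0 : 0 < N by have := normr_ge0 k; have := normr_ge0 M; rewrite /N; lra.
have CN x : b (C x) x <= N * b x x.
  rewrite CE; have := b_ge0 (T x + x); rewrite !(formE bB) (bC x (T x)).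
  have : M * b x x <= `|M| * b x x by rewrite ler_wpM2r ?ler_norm.
  have : k * b x x <= `|k| * b x x by rewrite ler_wpM2r ?ler_norm.
  have : 0 <= `|M| * b x x by rewrite mulr_ge0.
  have := TM x; rewrite /N; have := b_ge0 x; lra.
have kerC x : C x = 0 -> x = 0.
  move=> Cx; apply/eqP; apply: contrapT => /negP x0; apply: nex; exists x => //.
  by apply/esym/eqP; rewrite -subr_eq0 -CD Cx.
(* k - eps / 2 is the midpoint of the gap. *)
have gap x : (eps / 2) ^+ 2 * b x x <=
    b (T x - (k - eps / 2) *: x) (T x - (k - eps / 2) *: x).
  apply: (@norm_ge_of_gap (fun x => T x - (k - eps / 2) *: x)
     (2 * `|M| + 2 * (k - eps / 2) ^+ 2)).
  - exact: form_sym_sub.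
  - move=> {}x; apply: le_trans (form_sqB bB b_ge0 _ _) _; rewrite !(formE bB).
    have : M * b x x <= `|M| * b x x by rewrite ler_wpM2r ?ler_norm.
    set c := k - _.
    have -> : (2 * `|M| + 2 * c ^+ 2) * b x x =
      2 * (`|M| * b x x) + 2 * (c * (c * b x x)) by ring.
    have := TM x; lra.
  - lra.
  - move=> r rP; split.
      suff -> : (fun x => T x - (k - eps / 2) *: x - r *: x) =
          (fun x => T x - (k - eps / 2 + r) *: x) by apply: isol; lra.
      by apply/funext => z; rewrite -addrA -opprD -scalerDl.
    suff -> : (fun x => T x - (k - eps / 2) *: x - (- r) *: x) =
        (fun x => T x - (k - eps / 2 - r) *: x) by apply: isol; lra.
    by apply/funext => z; rewrite -addrA -opprD -scalerDl.
(* The previous estimate reads |(C - eps / 2) x| >= (eps / 2) |x|. *)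
have CC x : eps * b (C x) x <= b (C x) (C x).
  have := gap x; rewrite CD !(formE bB) (bC x (T x)).
  set p := b x x; set q := b (T x) x; set s := b (T x) (T x) => h.
  rewrite -subr_ge0; rewrite -subr_ge0 in h.
  by apply: le_trans h _; rewrite le_eqVlt; apply/orP; left; apply/eqP; field.
have dB : symm_bilinear (fun x y => b (C x) y).
  split=> [a u v w|u v]; last by rewrite Cs bC.
  by rewrite Cs !(formE bB) -!Cs.
have Crange x : eps * b (C x) (C x) <= b (C (C x)) (C x).
  have := form_cauchy_schwarz dB C0 x (C x).
  have [->|nz] := eqVneq (b (C x) (C x)) 0; first by rewrite mulr0.
  have p0 : 0 < b (C x) (C x) by rewrite lt_def nz b_ge0.
  move=> h; rewrite -(ler_pM2l p0).
  have h2 : eps * b (C x) x * b (C (C x)) (C x) <=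
            b (C x) (C x) * b (C (C x)) (C x).
    by rewrite ler_wpM2r.
  apply: le_trans h2; rewrite -mulrA mulrCA ler_wpM2l // ?ltW //.
have CB u v : C (u - v) = C u - C v.
  by apply/eqP; rewrite -subr_eq0; apply/eqP; apply: b_eq0;
    rewrite {1}(formBl bB) (formBl bB) !Cs !(formE bB); ring.
have dense x tau : 0 < tau -> exists z, b (x - C z) (x - C z) < tau.
  move=> t0.
  have [p pP pD] := closure_range_proj x Cs.
  have [_ [z _ <-] zP] := pD _ t0; exists z.
  suff <- : p = x by [].
  apply/eqP; rewrite -subr_eq0; apply/eqP; apply: kerC; apply: b_eq0.
  by rewrite Cs (formBl bB) pP ?subrr //; exists (C (p - x)).
have Cbelow x : eps / 4 * b x x <= b (C x) x.
  rewrite -subr_le0; apply: (@le0_of_forall_eps _ _ (N + eps)); first by lra.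
  move=> tau t0; have [z zP] := dense x _ t0.
  have h1 := form_sqB dB C0 x (x - C z); rewrite /= subKr in h1.
  have h2 := form_sqD bB b_ge0 (x - C z) (C z); rewrite subrK in h2.
  have h3 := CN (x - C z); have h4 := Crange z.
  have h5 : eps * b x x <= eps * (2 * b (x - C z) (x - C z) + 2 * b (C z) (C z)).
    by rewrite ler_wpM2l // ltW.
  have h6 : N * b (x - C z) (x - C z) <= N * tau by rewrite ler_wpM2l // ltW.
  have h7 : eps * b (x - C z) (x - C z) <= eps * tau by rewrite ler_wpM2l // ltW.
  have h8 : 0 < eps * tau by rewrite mulr_gt0.
  lra.
have [|x] := ksup (eps / 4); first by lra.
have := Cbelow x; rewrite CE; lra.
Qed.

End SymmetricOperators.

(** * Scalars, linear systems and subspaces *)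

Section ScalarTheory.
Variables (R : realType) (s : scalars).
Local Notation K := (scalar R s).
Local Notation "a %:K" := (of_real R s a) (at level 2, format "a %:K").
Local Notation conj := (scalar_conj R s).
Local Notation re := (@real_part R s).

Definition sqn (z : K) : R := re (z * conj z).

Lemma conjK (z : K) : conj (conj z) = z.
Proof. by move: z; case: s => //= z; exact: conjcK. Qed.

Lemma conj_of_real (a : R) : conj a%:K = a%:K.
Proof. by case: s => //=; rewrite oppr0. Qed.

Lemma re_of_real (a : R) : re a%:K = a.
Proof. by case: s. Qed.

Lemma reD (x y : K) : re (x + y) = re x + re y.
Proof. by move: x y; case: s => //= -[a b] [c d]. Qed.

Lemma re0 : re 0 = 0. Proof. by rewrite -(rmorph0 (of_real R s)) re_of_real. Qed.

Lemma re1 : re 1 = 1. Proof. by rewrite -(rmorph1 (of_real R s)) re_of_real. Qed.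

Lemma reN (x : K) : re (- x) = - re x.
Proof. by apply: (@addIr _ (re x)); rewrite -reD !addNr re0. Qed.

Lemma reZ (a : R) (x : K) : re (a%:K * x) = a * re x.
Proof. by move: x; case: s => //= -[b c] /=; rewrite mul0r subr0. Qed.

Lemma re_conj (x : K) : re (conj x) = re x.
Proof. by move: x; case: s => //= -[b c]. Qed.

Lemma re_fixed (x : K) : conj x = x -> x = (re x)%:K.
Proof.
move: x; case: s => //= -[b c] /= [] /eqP.
by rewrite -subr_eq0 -opprD oppr_eq0 -mulr2n mulrn_eq0 /= => /eqP ->.
Qed.

Lemma mul_conj (z : K) : z * conj z = (sqn z)%:K.
Proof. by apply: re_fixed; rewrite rmorphM conjK mulrC. Qed.

Lemma ler_of_real (a b : R) : (a%:K <= b%:K :> K) = (a <= b).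
Proof. by case: s => //=; rewrite lecE /= eqxx. Qed.

Lemma ltr_of_real (a b : R) : (a%:K < b%:K :> K) = (a < b).
Proof. by case: s => //=; rewrite ltcE /= eqxx. Qed.

Lemma ge0_of_real (z : K) : 0 <= z -> z = (re z)%:K.
Proof.
by move: z; case: s => //= -[a b]; rewrite lecE /= => /andP[/eqP -> _].
Qed.

Lemma norm_of_real_re (z : K) : `|z| = (re `|z|)%:K.
Proof. exact: ge0_of_real. Qed.

Lemma re_ge0 (z : K) : 0 <= z -> 0 <= re z.
Proof. by move=> z0; rewrite -ler_of_real -ge0_of_real // rmorph0. Qed.

Lemma sqn_norm (z : K) : sqn z = re `|z| ^+ 2.
Proof.
have zz : `|z| ^+ 2 = z * conj z.
  move: z; case: s => [z|z]; last exact: sqr_normc.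
  by rewrite /= real_normK ?num_real // expr2.
by rewrite -[RHS]re_of_real rmorphXn -norm_of_real_re zz.
Qed.

Lemma sqn_ge0 (z : K) : 0 <= sqn z.
Proof. by rewrite sqn_norm sqr_ge0. Qed.

Lemma sqn_eq0 (z : K) : (sqn z == 0) = (z == 0).
Proof.
rewrite sqn_norm sqrf_eq0 -(fmorph_eq0 (of_real R s)) -norm_of_real_re.
by rewrite normr_eq0.
Qed.

Lemma sqnM (x y : K) : sqn (x * y) = sqn x * sqn y.
Proof.
by rewrite {1}/sqn rmorphM mulrACA !mul_conj -rmorphM re_of_real.
Qed.

Lemma sqn_conj (x : K) : sqn (conj x) = sqn x.
Proof. by rewrite /sqn conjK mulrC. Qed.

Lemma sqn_of_real (a : R) : sqn a%:K = a ^+ 2.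
Proof. by rewrite /sqn conj_of_real -rmorphM re_of_real expr2. Qed.

Lemma re_sum (I : Type) (r : seq I) (P : pred I) (F : I -> K) :
  re (\sum_(i <- r | P i) F i) = \sum_(i <- r | P i) re (F i).
Proof. by apply: (big_morph re) => [x y|]; rewrite ?reD ?re0. Qed.

Lemma sqr_re_le_sqn (z : K) : re z ^+ 2 <= sqn z.
Proof.
rewrite /sqn; move: z; case: s => [z|[a b]] /=; first by rewrite expr2.
by rewrite mulrN opprK expr2 lerDl -expr2 sqr_ge0.
Qed.

Lemma sqn_B (x y : K) : sqn (x - y) <= 2 * sqn x + 2 * sqn y.
Proof.
have := sqn_ge0 (x + y); rewrite /sqn !rmorphD rmorphN.
rewrite !(mulrDl, mulrDr, mulrN, mulNr) opprK !reD !reN; lra.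
Qed.

Lemma sqn0 : sqn 0 = 0. Proof. by apply/eqP; rewrite sqn_eq0. Qed.

End ScalarTheory.

Section LinearSystems.
Variable K : fieldType.

Lemma underdetermined_system (p k : nat) (M : 'I_p -> 'I_k -> K) : (k < p)%N ->
  exists2 c : 'I_p -> K, exists i, c i != 0 & forall j, \sum_i c i * M i j = 0.
Proof.
move=> kp; pose A := \matrix_(i, j) M i j.
have : kermx A != 0.
  rewrite -mxrank_eq0 mxrank_ker -lt0n subn_gt0.
  exact: leq_ltn_trans (rank_leq_col A) kp.
case/rowV0Pn => v /sub_kermxP vA v0.
exists (v 0).
  by apply/existsP; apply: contra_neqT v0 => /existsPn vz; apply/rowP => i;
    rewrite mxE; apply/eqP; rewrite -[_ == _]negbK; exact: vz.
move=> j; move/rowP: vA => /(_ j); rewrite !mxE => {2}<-.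
by apply: eq_bigr => i _; rewrite mxE.
Qed.

Lemma nondegenerate_system (n : nat) (G : 'I_n -> 'I_n -> K) :
  (forall c : 'I_n -> K, (forall j, \sum_i c i * G i j = 0) ->
     forall i, c i = 0) ->
  forall r : 'I_n -> K, exists c : 'I_n -> K, forall j, \sum_i c i * G i j = r j.
Proof.
move=> Gfree r; pose A := \matrix_(i, j) G i j.
have Au : A \in unitmx.
  rewrite -row_free_unit -kermx_eq0; apply/eqP/row_matrixP => k.
  apply/rowP => i; rewrite row0 [RHS]mxE.
  apply: (Gfree (fun l => row k (kermx A) 0 l)) => j.
  have : row k (kermx A) *m A = 0 by rewrite -row_mul mulmx_ker row0.
  move/rowP => /(_ j); rewrite [RHS]mxE mxE => {2}<-.
  by apply: eq_bigr => l _; rewrite [A _ _]mxE.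
exists ((\row_j r j *m invmx A) 0) => j.
have : \row_j r j *m invmx A *m A = \row_j r j by rewrite mulmxKV.
move/rowP => /(_ j); rewrite mxE [RHS]mxE => <-.
by apply: eq_bigr => l _; rewrite [A _ _]mxE.
Qed.

End LinearSystems.

Section Subspaces.
Variables (K : fieldType) (E : lmodType K).

Record subspace := Subspace {
  sub_set :> E -> Prop;
  sub0 : sub_set 0;
  subP : forall (a : K) u v, sub_set u -> sub_set v -> sub_set (a *: u + v)
}.

Implicit Type V : subspace.

Lemma subD V u v : V u -> V v -> V (u + v).
Proof. by move=> Vu Vv; rewrite -[u]scale1r; exact: subP. Qed.
Lemma subZ V a u : V u -> V (a *: u).
Proof. by move=> Vu; rewrite -[_ *: _]addr0; apply: subP => //; exact: sub0. Qed.
Lemma subN V u : V u -> V (- u).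
Proof. by move=> Vu; rewrite -scaleN1r; exact: subZ. Qed.
Lemma subB V u v : V u -> V v -> V (u - v).
Proof. by move=> Vu Vv; apply: subD => //; exact: subN. Qed.
Lemma sub_sum V (I : Type) (r : seq I) (P : pred I) (F : I -> E) :
  (forall i, V (F i)) -> V (\sum_(i <- r | P i) F i).
Proof. by move=> VF; elim/big_ind : _ => //; [exact: sub0|exact: subD]. Qed.

Definition lincomb n (e : 'I_n -> E) (c : 'I_n -> K) : E := \sum_i c i *: e i.

Definition free_family n (e : 'I_n -> E) : Prop :=
  forall c, lincomb e c = 0 -> forall i, c i = 0.

Lemma lincombP n (e : 'I_n -> E) (a : K) c d :
  lincomb e (fun i => a * c i + d i) = a *: lincomb e c + lincomb e d.
Proof.
rewrite /lincomb scaler_sumr -big_split /=; apply: eq_bigr => i _.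
by rewrite scalerDl scalerA.
Qed.

Lemma span_proof0 n (e : 'I_n -> E) : range (lincomb e) 0.
Proof. by exists (fun=> 0) => //; apply: big1 => i _; rewrite scale0r. Qed.

Lemma span_proofP n (e : 'I_n -> E) a u v :
  range (lincomb e) u -> range (lincomb e) v -> range (lincomb e) (a *: u + v).
Proof.
by move=> [c _ <-] [d _ <-]; exists (fun i => a * c i + d i); rewrite ?lincombP.
Qed.

Definition span n (e : 'I_n -> E) : subspace :=
  Subspace (span_proof0 e) (@span_proofP n e).

Lemma span_mem n (e : 'I_n -> E) c : span e (lincomb e c).
Proof. by exists c. Qed.

Lemma span_gen n (e : 'I_n -> E) i : span e (e i).
Proof.
exists (fun j => (j == i)%:R) => //; rewrite /lincomb (bigD1 i) //= eqxx scale1r.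
by rewrite big1 ?addr0 // => j /negPf ->; rewrite scale0r.
Qed.

Lemma span_sub n (e : 'I_n -> E) V : (forall i, V (e i)) -> forall u, span e u -> V u.
Proof.
by move=> Ve u [c _ <-]; apply: sub_sum => i; apply: subZ.
Qed.

Lemma dependent_in_span p k (e : 'I_k -> E) (f : 'I_p -> E) : (k < p)%N ->
  (forall i, span e (f i)) -> exists2 c, exists i, c i != 0 & lincomb f c = 0.
Proof.
move=> kp fe; have ex_c i : exists c, lincomb e c = f i by case: (fe i) => c; exists c.
have [M MP] := choice ex_c.
have [c c0 cM] := underdetermined_system M kp.
exists c => //; rewrite /lincomb.
under eq_bigr => i _ do rewrite -MP scaler_sumr.
rewrite exchange_big /= big1 // => j _.
under eq_bigr => i _ do rewrite scalerA.
by rewrite -scaler_suml cM scale0r.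
Qed.

Lemma linear_lincomb (f : {linear E -> E}) n (e : 'I_n -> E) c :
  f (lincomb e c) = lincomb (fun i => f (e i)) c.
Proof.
by rewrite /lincomb linear_sum; apply: eq_bigr => i _; exact: linearZ_LR.
Qed.

Definition snoc n (e : 'I_n -> E) (z : E) (i : 'I_n.+1) : E :=
  if unlift ord_max i is Some j then e j else z.

Lemma lincomb_snoc n (e : 'I_n -> E) z a :
  lincomb (snoc e z) a =
  lincomb e (fun i => a (lift ord_max i)) + a ord_max *: z.
Proof.
rewrite /lincomb big_ord_recr /= {2}/snoc unlift_none; congr (_ + _).
apply: eq_bigr => i _.
have -> : widen_ord (leqnSn n) i = lift ord_max i.
  by apply/val_inj; rewrite /= /bump leqNgt ltn_ord.
by rewrite /snoc liftK.
Qed.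

(** Otherwise g and u would be n + 1 independent vectors in the span of n. *)
Lemma free_family_spans n (e g : 'I_n -> E) u : (forall i, span e (g i)) ->
  free_family g -> span e u -> span g u.
Proof.
move=> eg gfree eu.
have es i : span e (snoc g u i) by rewrite /snoc; case: unliftP.
have [c [i0 ci0]] := dependent_in_span (ltnSn n) es.
rewrite lincomb_snoc; set w := lincomb g _ => rel.
have cm : c ord_max != 0.
  apply: contra_neq ci0 => cm; move: rel; rewrite cm scale0r addr0 => w0.
  by case: (unliftP ord_max i0) => [j ->|->] //; exact: (gfree _ w0).
have -> : u = - (c ord_max)^-1 *: w.
  apply: (scalerI cm); rewrite scalerA mulrN divff // scaleN1r.
  by apply/eqP; rewrite -addr_eq0 addrC rel.
by apply: subZ; exact: span_mem.
Qed.

End Subspaces.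

(** * Hermitian forms on subspaces *)

Section HermitianForms.
Variables (R : realType) (s : scalars).
Local Notation K := (scalar R s).
Local Notation "a %:K" := (of_real R s a) (at level 2, format "a %:K").
Local Notation conj := (scalar_conj R s).
Local Notation re := (@real_part R s).
Variable E : lmodType K.
Implicit Types (V : subspace E) (b : E -> E -> K).

(** The axioms are restricted to V because the form of an unbounded operator
has meaning on its domain only. *)
Definition herm V b :=
  (forall a u v w, V u -> V v -> V w -> b (a *: u + v) w = a * b u w + b v w) /\
  (forall u v, V u -> V v -> b u v = conj (b v u)).

Definition qf b u : R := re (b u u).

Definition nonneg V b := forall u, V u -> 0 <= qf b u.

Definition pos V b := forall u, V u -> u != 0 -> 0 < qf b u.

Lemma herm_sub V V' b : (forall u, V' u -> V u) -> herm V b -> herm V' b.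
Proof. by move=> VV' [h1 h2]; split=> *; [apply: h1|apply: h2]; exact: VV'. Qed.

Section OneForm.
Variables (V : subspace E) (b : E -> E -> K).
Hypothesis bH : herm V b.

Lemma hC u v : V u -> V v -> b u v = conj (b v u).
Proof. by case: bH => _; apply. Qed.

Lemma hLl a u v w : V u -> V v -> V w -> b (a *: u + v) w = a * b u w + b v w.
Proof. by case: bH => h _; apply: h. Qed.

Lemma hDl u v w : V u -> V v -> V w -> b (u + v) w = b u w + b v w.
Proof. by move=> *; rewrite -{1}[u]scale1r hLl // mul1r. Qed.

Lemma h0l w : V w -> b 0 w = 0.
Proof.
move=> Vw; have V0 := sub0 V; apply: (@addrI _ (b 0 w)).
by rewrite -hDl // !addr0.
Qed.

Lemma hZl a u w : V u -> V w -> b (a *: u) w = a * b u w.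
Proof.
by move=> Vu Vw; rewrite -[_ *: _]addr0 hLl ?h0l ?addr0 //; exact: sub0.
Qed.

Lemma hNl u w : V u -> V w -> b (- u) w = - b u w.
Proof. by move=> *; rewrite -scaleN1r hZl // mulN1r. Qed.

Lemma hBl u v w : V u -> V v -> V w -> b (u - v) w = b u w - b v w.
Proof. by move=> *; rewrite hDl ?hNl //; exact: subN. Qed.

Lemma hDr u v w : V u -> V v -> V w -> b w (u + v) = b w u + b w v.
Proof.
move=> Vu Vv Vw; rewrite hC ?hDl //; last exact: subD.
by rewrite rmorphD -!hC.
Qed.

Lemma h0r w : V w -> b w 0 = 0.
Proof. by move=> Vw; rewrite hC ?h0l ?rmorph0 //; exact: sub0. Qed.

Lemma hZr a u w : V u -> V w -> b w (a *: u) = conj a * b w u.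
Proof.
move=> Vu Vw; rewrite hC ?hZl //; last exact: subZ.
by rewrite rmorphM -hC.
Qed.

Lemma hNr u w : V u -> V w -> b w (- u) = - b w u.
Proof. by move=> *; rewrite -scaleN1r hZr // rmorphN1 mulN1r. Qed.

Lemma hBr u v w : V u -> V v -> V w -> b w (u - v) = b w u - b w v.
Proof. by move=> *; rewrite hDr ?hNr //; exact: subN. Qed.

Lemma h_suml I (r : seq I) (P : pred I) (F : I -> E) w :
  (forall i, V (F i)) -> V w ->
  b (\sum_(i <- r | P i) F i) w = \sum_(i <- r | P i) b (F i) w.
Proof.
move=> VF Vw; elim: r => [|i r IH]; first by rewrite !big_nil h0l.
by rewrite !big_cons; case: ifP => // _; rewrite hDl ?IH //; exact: sub_sum.
Qed.

Lemma h_sumr I (r : seq I) (P : pred I) (F : I -> E) w :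
  (forall i, V (F i)) -> V w ->
  b w (\sum_(i <- r | P i) F i) = \sum_(i <- r | P i) b w (F i).
Proof.
move=> VF Vw; elim: r => [|i r IH]; first by rewrite !big_nil h0r.
by rewrite !big_cons; case: ifP => // _; rewrite hDr ?IH //; exact: sub_sum.
Qed.

Lemma h_lincombl n (e : 'I_n -> E) c w : (forall i, V (e i)) -> V w ->
  b (lincomb e c) w = \sum_i c i * b (e i) w.
Proof.
move=> Ve Vw; rewrite h_suml //; last by move=> i; exact: subZ.
by apply: eq_bigr => i _; rewrite hZl.
Qed.

Lemma h_lincombr n (e : 'I_n -> E) c w : (forall i, V (e i)) -> V w ->
  b w (lincomb e c) = \sum_i conj (c i) * b w (e i).
Proof.
move=> Ve Vw; rewrite h_sumr //; last by move=> i; exact: subZ.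
by apply: eq_bigr => i _; rewrite hZr.
Qed.

Lemma q_real u : V u -> b u u = (qf b u)%:K.
Proof. by move=> Vu; apply: re_fixed; rewrite -hC. Qed.

Lemma hreC u v : V u -> V v -> re (b u v) = re (b v u).
Proof. by move=> Vu Vv; rewrite hC // re_conj. Qed.

Lemma qD u v : V u -> V v -> qf b (u + v) = qf b u + 2 * re (b u v) + qf b v.
Proof.
move=> Vu Vv; rewrite /qf hDl ?hDr //; last exact: subD.
by rewrite !reD (hreC Vv Vu); ring.
Qed.

Lemma qB u v : V u -> V v -> qf b (u - v) = qf b u - 2 * re (b u v) + qf b v.
Proof.
move=> Vu Vv; rewrite qD ?hNr //; last exact: subN.
by rewrite reN mulrN /qf hNl ?hNr ?opprK //; exact: subN.
Qed.

Lemma qZ a u : V u -> qf b (a *: u) = sqn a * qf b u.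
Proof.
move=> Vu; rewrite /qf hZl ?hZr //; last exact: subZ.
by rewrite mulrA mul_conj reZ.
Qed.

Lemma qN u : V u -> qf b (- u) = qf b u.
Proof. by move=> Vu; rewrite /qf hNl ?hNr ?opprK //; exact: subN. Qed.

Lemma qBC u v : V u -> V v -> qf b (u - v) = qf b (v - u).
Proof. by move=> Vu Vv; rewrite -opprB qN //; exact: subB. Qed.

Lemma q0 : qf b 0 = 0.
Proof. by rewrite /qf h0l ?re0 //; exact: sub0. Qed.

Lemma h_diag n (e : 'I_n -> E) (d : 'I_n -> R) c c' :
  (forall i, V (e i)) -> (forall i j, b (e i) (e j) = (d i * (i == j)%:R)%:K) ->
  b (lincomb e c) (lincomb e c') = \sum_i c i * conj (c' i) * (d i)%:K.
Proof.
move=> Ve ed; rewrite h_lincombl //; last by apply: sub_sum => i; exact: subZ.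
apply: eq_bigr => i _; rewrite h_lincombr // (bigD1 i) //= big1 ?addr0.
  by rewrite ed eqxx mulr1 mulrA.
by move=> j /negPf ji; rewrite ed eq_sym ji mulr0 rmorph0 mulr0.
Qed.

Lemma q_diag n (e : 'I_n -> E) (d : 'I_n -> R) c :
  (forall i, V (e i)) -> (forall i j, b (e i) (e j) = (d i * (i == j)%:R)%:K) ->
  qf b (lincomb e c) = \sum_i sqn (c i) * d i.
Proof.
move=> Ve ed; rewrite /qf (h_diag _ _ Ve ed) re_sum; apply: eq_bigr => i _.
by rewrite mul_conj -rmorphM re_of_real.
Qed.

Hypothesis b0 : nonneg V b.

Lemma re_cauchy_schwarz u v : V u -> V v -> re (b u v) ^+ 2 <= qf b u * qf b v.
Proof.
move=> Vu Vv; rewrite [_ * qf b v]mulrC; apply: quad_ge0_discr => t.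
have Vt : V (t%:K *: v) by apply: subZ.
suff -> : qf b v * t ^+ 2 + 2 * re (b u v) * t + qf b u = qf b (u + t%:K *: v).
  by apply: b0; apply: subD.
by rewrite qD // qZ // hZr // conj_of_real reZ sqn_of_real; ring.
Qed.

Lemma herm_cauchy_schwarz u v : V u -> V v -> sqn (b u v) <= qf b u * qf b v.
Proof.
move=> Vu Vv; have [->|z0] := eqVneq (b u v) 0.
  by rewrite sqn0 mulr_ge0 ?b0.
have zp : 0 < sqn (b u v) by rewrite lt_def sqn_eq0 z0 sqn_ge0.
have := re_cauchy_schwarz (subZ (conj (b u v)) Vu) Vv.
rewrite hZl // qZ // sqn_conj [conj _ * _]mulrC => /=.
rewrite -[re _]/(sqn _) expr2 -mulrA => h.
by rewrite -(ler_pM2l zp).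
Qed.

Lemma q_null u v : V u -> V v -> qf b u = 0 -> b u v = 0.
Proof.
move=> Vu Vv qu; apply/eqP; rewrite -sqn_eq0 eq_le sqn_ge0 andbT.
by apply: le_trans (herm_cauchy_schwarz Vu Vv) _; rewrite qu mul0r.
Qed.

Lemma q_sqD u v : V u -> V v -> qf b (u + v) <= 2 * qf b u + 2 * qf b v.
Proof.
move=> Vu Vv; have := b0 (subB Vu Vv); rewrite qB // qD //; lra.
Qed.

End OneForm.

Lemma pos_nonneg V b : herm V b -> pos V b -> nonneg V b.
Proof.
move=> bH bp u Vu; have [->|u0] := eqVneq u 0; first by rewrite (q0 bH).
by apply/ltW/bp.
Qed.

Lemma pos_eq0 V b u : pos V b -> V u -> qf b u = 0 -> u = 0.
Proof.
move=> bp Vu qu; have [//|u0] := eqVneq u 0.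
by have := bp _ Vu u0; rewrite qu ltxx.
Qed.

Lemma h_eq V b u v : herm V b -> pos V b -> V u -> V v ->
  (forall w, V w -> b u w = b v w) -> u = v.
Proof.
move=> bH bp Vu Vv uv; apply/eqP; rewrite -subr_eq0; apply/eqP.
have Vuv := subB Vu Vv.
by apply: (pos_eq0 bp) => //; rewrite /qf (hBl bH) // uv // subrr re0.
Qed.

Definition ortho_normal b n (e : 'I_n -> E) :=
  forall i j, b (e i) (e j) = (i == j)%:R.

Lemma ortho_normalE b n (e : 'I_n -> E) : ortho_normal b e ->
  forall i j, b (e i) (e j) = (1 * (i == j)%:R)%:K.
Proof. by move=> eo i j; rewrite eo mul1r rmorph_nat. Qed.

Section OrthonormalFamilies.
Variables (V : subspace E) (b : E -> E -> K).
Hypothesis bH : herm V b.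

Lemma ortho_normal_coef n (e : 'I_n -> E) c j : (forall i, V (e i)) ->
  ortho_normal b e -> b (lincomb e c) (e j) = c j.
Proof.
move=> Ve eo; rewrite (h_lincombl bH) // (bigD1 j) //= eo eqxx mulr1.
by rewrite big1 ?addr0 // => i /negPf ij; rewrite eo ij mulr0.
Qed.

Lemma ortho_normal_free n (e : 'I_n -> E) : (forall i, V (e i)) ->
  ortho_normal b e -> free_family e.
Proof.
by move=> Ve eo c ce j; rewrite -(ortho_normal_coef c j Ve eo) ce (h0l bH).
Qed.

Lemma q_ortho_normal n (e : 'I_n -> E) c : (forall i, V (e i)) ->
  ortho_normal b e -> qf b (lincomb e c) = \sum_i sqn (c i).
Proof.
move=> Ve /ortho_normalE eo; rewrite (q_diag bH _ Ve eo).
by apply: eq_bigr => i _; rewrite mulr1.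
Qed.

Lemma ortho_normal_complete n (e f : 'I_n -> E) u : (forall i, V (e i)) ->
  (forall i, span e (f i)) -> ortho_normal b f -> span e u ->
  u = lincomb f (fun i => b u (f i)).
Proof.
move=> Ve fe fo eu.
have Vf i : V (f i) by apply: (span_sub Ve).
have [c _ <-] := free_family_spans fe (ortho_normal_free Vf fo) eu.
by congr lincomb; apply/funext => i; rewrite ortho_normal_coef.
Qed.

End OrthonormalFamilies.

Section NormEquivalence.
Variables (n : nat) (e : 'I_n -> E) (b c : E -> E -> K).
Hypotheses (efree : free_family e).
Hypotheses (bH : herm (span e) b) (cH : herm (span e) c).
Hypotheses (b0 : nonneg (span e) b) (cp : pos (span e) c).

Lemma q_sum_bound p (x : 'I_p -> E) : (forall i, span e (x i)) ->
  qf b (\sum_i x i) <= 2 ^+ p * \sum_i qf b (x i).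
Proof.
elim: p x => [|p IH] x xe; first by rewrite !big_ord0 mulr0 (q0 bH).
rewrite !big_ord_recl /=.
have h1 := q_sqD bH b0 (xe ord0) (sub_sum _ xpredT (fun i => xe (lift ord0 i))).
have h2 := IH _ (fun i => xe (lift ord0 i)).
apply: le_trans (h1 _) _.
have h3 : qf b (x ord0) <= 2 ^+ p * qf b (x ord0).
  by rewrite ler_peMl ?b0 // exprn_ege1 // ler1n.
by rewrite exprS mulrDr; lra.
Qed.

(** The Gram matrix of e for the inner product c is invertible. *)
Lemma dual_family : exists d : 'I_n -> E, (forall i, span e (d i)) /\
  forall i j, c (e i) (d j) = (i == j)%:R.
Proof.
have eg := span_gen e; have em := span_mem e.
have G a : (forall j, \sum_i a i * c (e i) (e j) = 0) -> forall i, a i = 0.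
  move=> aG; apply: efree; apply: (pos_eq0 cp (em a)).
  rewrite /qf (h_lincombr cH) // big1 ?re0 // => j _.
  by rewrite (h_lincombl cH) ?aG ?mulr0.
have ex_d j : exists d, span e d /\ forall i, c (e i) d = (i == j)%:R.
  have [a aP] := nondegenerate_system G (fun i => (i == j)%:R).
  exists (lincomb e a); split=> [|i] //.
  by rewrite (hC cH) // (h_lincombl cH) // aP rmorph_nat.
have [d dP] := choice ex_d.
by exists d; split=> [i|i j]; [case: (dP i)|case: (dP j)].
Qed.

(** The coordinates of u are its products for c with the dual family, so
Cauchy-Schwarz for c bounds them. *)
Lemma norm_equivalence : exists2 M, 0 < M &
  forall u, span e u -> qf b u <= M * qf c u.
Proof.
have [d [de dP]] := dual_family; have eg := span_gen e.
have c0 := pos_nonneg cH cp.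
pose M := 2 ^+ n * \sum_i qf c (d i) * qf b (e i).
have M0 : 0 <= M.
  rewrite mulr_ge0 ?exprn_ge0 // sumr_ge0 // => i _.
  by rewrite mulr_ge0 ?b0 ?c0.
exists (M + 1) => [|u eu]; first by lra.
have h1 : qf b u <= M * qf c u; last first.
  by have := c0 _ eu; lra.
case: (eu) => a _ au; rewrite -{1}au.
apply: le_trans (q_sum_bound _) _ => [i|]; first exact: subZ.
rewrite -mulrA ler_wpM2l ?exprn_ge0 // mulr_suml ler_sum // => i _.
rewrite (qZ bH) // mulrAC ler_wpM2r ?b0 //.
have -> : a i = c u (d i).
  rewrite -au (h_lincombl cH) //.
  rewrite (bigD1 i) //= dP eqxx mulr1 big1 ?addr0 // => j /negPf ji.
  by rewrite dP ji mulr0.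
by rewrite mulrC; apply: (herm_cauchy_schwarz cH c0).
Qed.

End NormEquivalence.

End HermitianForms.

(** * Simultaneous diagonalisation in finite dimension *)

Section Diagonalisation.
Variables (R : realType) (s : scalars).
Local Notation K := (scalar R s).
Local Notation "a %:K" := (of_real R s a) (at level 2, format "a %:K").
Variable E : lmodType K.
Implicit Types (V : subspace E) (b t : E -> E -> K).

Lemma herm_comb V b t (x y : R) : herm V b -> herm V t ->
  herm V (fun u v => x%:K * b u v + y%:K * t u v).
Proof.
move=> bH tH; split=> [a u v w Vu Vv Vw|u v Vu Vv].
  by rewrite (hLl bH) // (hLl tH) //; ring.
by rewrite (hC bH) // (hC tH) // rmorphD !rmorphM !conj_of_real.
Qed.

Lemma q_comb b t (x y : R) u :
  qf (fun u v => x%:K * b u v + y%:K * t u v) u = x * qf b u + y * qf t u.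
Proof. by rewrite /qf reD !reZ. Qed.

Lemma pos_normalise V b u : herm V b -> pos V b -> V u -> u != 0 ->
  qf b ((Num.sqrt (qf b u))^-1%:K *: u) = 1.
Proof.
move=> bH bp Vu u0; have qu := bp _ Vu u0.
rewrite (qZ bH) // sqn_of_real exprVn sqr_sqrtr ?ltW // mulVf //.
by rewrite gt_eqF.
Qed.

(** Let x be the supremum of t / b. If x b - t were definite, comparing it
with b would lower the supremum. A null vector of the semidefinite form x b - t
lies in its radical, and this is the eigenvalue equation. *)
Lemma top_eigenvector n (e : 'I_n.+1 -> E) b t : free_family e ->
  herm (span e) b -> herm (span e) t -> pos (span e) b ->
  nonneg (span e) t -> (forall u, span e u -> qf t u <= qf b u) ->
  exists2 f, span e f /\ b f f = 1 & exists x : R,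
    (forall v, span e v -> t f v = x%:K * b f v) /\
    (forall v, span e v -> qf t v <= x * qf b v).
Proof.
move=> efree bH tH bp t0 tb; have eg := span_gen e.
have b0 := pos_nonneg bH bp.
pose S := [set x | exists2 u, span e u & qf b u = 1 /\ x = qf t u].
have e0 : e ord0 != 0.
  apply/negP => /eqP e0.
  have := efree (fun i => (i == ord0)%:R); rewrite /lincomb (bigD1 ord0) //= ?eqxx.
  rewrite e0 scaler0 big1 ?addr0 => [/(_ erefl ord0) /eqP|i /negPf ->].
    by rewrite ?eqxx oner_eq0.
  by rewrite scale0r.
have Sne : S !=set0.
  exists (qf t ((Num.sqrt (qf b (e ord0)))^-1%:K *: e ord0)).
  exists ((Num.sqrt (qf b (e ord0)))^-1%:K *: e ord0) => //; first exact: subZ.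
  by rewrite (pos_normalise bH).
have Sub : ubound S 1 by move=> _ [u eu [bu ->]]; rewrite -bu; exact: tb.
have Ssup : has_sup S by split=> //; exists 1.
set x := sup S.
have tx u : span e u -> qf t u <= x * qf b u.
  move=> eu; have [->|u0] := eqVneq u 0.
    by rewrite (q0 tH) (q0 bH) mulr0.
  have qu := bp _ eu u0.
  have : qf t ((Num.sqrt (qf b u))^-1%:K *: u) <= x.
    apply: ub_le_sup; first by case: Ssup.
    exists ((Num.sqrt (qf b u))^-1%:K *: u); first exact: subZ.
    by rewrite (pos_normalise bH bp).
  rewrite (qZ tH) // sqn_of_real exprVn sqr_sqrtr ?(ltW qu) //.
  by rewrite ler_pdivrMl // [_ * x]mulrC.
pose c u v := x%:K * b u v + (-1)%:K * t u v.
have cH : herm (span e) c by apply: herm_comb.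
have cE u : qf c u = x * qf b u - qf t u by rewrite q_comb mulN1r.
have c0 : nonneg (span e) c by move=> u eu; rewrite cE subr_ge0 tx.
have [[f [ef f0 cf]]|nf] := pselect (exists f, [/\ span e f, f != 0 & qf c f = 0]).
  pose g := (Num.sqrt (qf b f))^-1%:K *: f.
  have eg' : span e g by apply: subZ.
  exists g.
    by split=> //; rewrite (q_real bH) // (pos_normalise bH bp) // rmorph1.
  exists x; split=> // v ev; apply/eqP; rewrite eq_sym -subr_eq0; apply/eqP.
  have <- : c g v = x%:K * b g v - t g v by rewrite /c rmorphN1 mulN1r.
  by apply: (q_null cH) => //; rewrite (qZ cH) // cf mulr0.
exfalso.
have cp : pos (span e) c.
  move=> u eu u0; rewrite lt_def c0 // andbT; apply/eqP => cu.
  by apply: nf; exists u.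
have [M M0 MP] := norm_equivalence efree bH cH b0 cp.
have Mi : 0 < M^-1 by rewrite invr_gt0.
suff : x <= x - M^-1 by lra.
apply: ge_sup => // _ [u eu [bu ->]].
have := MP _ eu; rewrite cE bu mulr1 mulrC -ler_pdivrMr // div1r; lra.
Qed.

(** Induction on n: split off a top eigenvector f and pass to its
b-orthogonal complement. A basis of the complement is obtained by projecting all
the e_i but one, for which f has a nonzero coordinate. *)
Lemma simultaneous_diagonalisation n (e : 'I_n -> E) b t : free_family e ->
  herm (span e) b -> herm (span e) t -> pos (span e) b ->
  nonneg (span e) t -> (forall u, span e u -> qf t u <= qf b u) ->
  exists f : 'I_n -> E, exists x : 'I_n -> R,
    [/\ forall i, span e (f i), ortho_normal b f,
        forall i j, t (f i) (f j) = (x i * (i == j)%:R)%:K &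
        forall i j : 'I_n, (i <= j)%N -> x i <= x j].
Proof.
elim: n e => [|n IH] e efree bH tH bp t0 tb.
  by exists e, (fun=> 0); split=> [|||] [].
have [f [ef bf] [x [tf tx]]] := top_eigenvector efree bH tH bp t0 tb.
have eg := span_gen e.
have [a _ af] := ef.
have f0 : f != 0.
  apply/eqP => f0; move: bf; rewrite f0 (h0l bH); last exact: sub0.
  by move/eqP; rewrite eq_sym oner_eq0.
have [k ak] : exists k, a k != 0.
  apply: contrapT => ak; move: f0; rewrite -af /lincomb big1 ?eqxx // => i _.
  have [->|ai] := eqVneq (a i) 0; first by rewrite scale0r.
  by case: ak; exists i.
pose g i := e (lift k i) - b (e (lift k i)) f *: f.
have ge i : span e (g i) by apply: subB => //; exact: subZ.
have gf i : b (g i) f = 0.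
  by rewrite (hBl bH) // ?(hZl bH) // ?bf ?mulr1 ?subrr //; exact: subZ.
have sge u : span g u -> span e u by apply: span_sub.
have sgf u : span g u -> b u f = 0.
  case=> c _ <-; rewrite (h_lincombl bH) // big1 // => i _.
  by rewrite gf mulr0.
have gfree : free_family g.
  move=> c cg.
  pose y := \sum_i c i * b (e (lift k i)) f.
  pose c' j := (if unlift k j is Some i then c i else 0) - y * a j.
  have c'0 : lincomb e c' = 0.
    rewrite -cg /lincomb.
    have -> : \sum_i c i *: g i = \sum_i c i *: e (lift k i) - y *: f.
      rewrite scaler_suml -sumrB; apply: eq_bigr => i _.
      by rewrite scalerBr scalerA.
    rewrite -af /lincomb scaler_sumr.
    under eq_bigr => i _ do rewrite scalerBl -scalerA.
    rewrite sumrB; congr (_ - _).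
    rewrite (bigD1_ord k) //= unlift_none scale0r add0r.
    by apply: eq_bigr => i _; rewrite liftK.
  have := efree _ c'0 k; rewrite /c' unlift_none sub0r => /eqP.
  rewrite oppr_eq0 mulf_eq0 (negPf ak) orbF => /eqP y0 i.
  by have := efree _ c'0 (lift k i); rewrite /c' liftK y0 mul0r subr0.
have [|||||f' [x' [f'e f'o f't x'm]]] := IH g gfree.
- exact: herm_sub bH.
- exact: herm_sub tH.
- by move=> u /sge; exact: bp.
- by move=> u /sge; exact: t0.
- by move=> u /sge; exact: tb.
pose F i := if unlift ord_max i is Some j then f' j else f.
pose X i := if unlift ord_max i is Some j then x' j else x.
have bff' j : b f (f' j) = 0.
  by rewrite (hC bH) ?sgf ?rmorph0 //; exact: sge.
exists F, X; split=> [i|i j|i j|i j].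
- by rewrite /F; case: unliftP => // j _; exact: sge.
- rewrite /F; case: unliftP => [i' ->|->]; case: unliftP => [j' ->|->].
  + by rewrite f'o (inj_eq lift_inj).
  + by rewrite sgf // eq_sym (negPf (neq_lift _ _)).
  + by rewrite bff' (negPf (neq_lift _ _)).
  + by rewrite bf eqxx.
- rewrite /F /X; case: unliftP => [i' ->|->]; case: unliftP => [j' ->|->].
  + by rewrite f't (inj_eq lift_inj).
  + rewrite (hC tH) ?tf //; try exact: sge.
    rewrite bff' mulr0 rmorph0 eq_sym (negPf (neq_lift _ _)).
    by rewrite mulr0 rmorph0.
  + rewrite tf ?bff' ?mulr0 ?(negPf (neq_lift _ _)) ?mulr0 ?rmorph0 //.
    exact: sge.
  + by rewrite eqxx tf // bf (_ : true%:R = 1 :> R) // !mulr1.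
- rewrite /X; case: unliftP => [i' ->|->]; case: unliftP => [j' ->|->] //.
  + by rewrite !lift_max; exact: x'm.
  + move=> _; have := tx _ (sge _ (f'e i')).
    rewrite /qf f't f'o eqxx (_ : true%:R = 1 :> R) // (_ : true%:R = 1 :> K) //.
    by rewrite re1 !mulr1 re_of_real.
  + by rewrite lift_max /= leqNgt ltn_ord.
Qed.

End Diagonalisation.

(** * Hermitian forms over the scalars as real inner products *)

Section RealSubspace.
Variables (R : realType) (s : scalars).
Local Notation K := (scalar R s).
Local Notation "a %:K" := (of_real R s a) (at level 2, format "a %:K").
Variables (E : lmodType K) (V : subspace E).

(** Restriction of scalars makes re b a real inner product on V, to which the
results on symmetric operators apply. A separate type is needed since b is an
inner product on V alone. *)
Definition real_sub : Type := {u : E | `[< V u >]}.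
HB.instance Definition _ := Choice.on real_sub.

Lemma real_subP (u : real_sub) : V (val u).
Proof. by case: u => u /= /asboolP. Qed.

Definition to_real_sub u (Vu : V u) : real_sub := exist _ u (asboolT Vu).

Let add (u v : real_sub) := to_real_sub (subD (real_subP u) (real_subP v)).
Let opp (u : real_sub) := to_real_sub (subN (real_subP u)).
Let zero := to_real_sub (sub0 V).
Let scale (a : R) (u : real_sub) := to_real_sub (subZ a%:K (real_subP u)).

Let addA : associative add.
Proof. by move=> u v w; apply/val_inj; rewrite /= addrA. Qed.
Let addC : commutative add.
Proof. by move=> u v; apply/val_inj; rewrite /= addrC. Qed.
Let add0 : left_id zero add.
Proof. by move=> u; apply/val_inj; rewrite /= add0r. Qed.
Let addN : left_inverse zero opp add.
Proof. by move=> u; apply/val_inj; rewrite /= addNr. Qed.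

HB.instance Definition _ := GRing.isZmodule.Build real_sub addA addC add0 addN.

Let scaleA a b (v : real_sub) : scale a (scale b v) = scale (a * b) v.
Proof. by apply/val_inj; rewrite /= scalerA rmorphM. Qed.
Let scale1 : left_id 1 scale.
Proof. by move=> v; apply/val_inj; rewrite /= rmorph1 scale1r. Qed.
Let scaleDr : right_distributive scale +%R.
Proof. by move=> a u v; apply/val_inj; rewrite /= scalerDr. Qed.
Let scaleDl (v : real_sub) : {morph scale^~ v : a b / a + b}.
Proof. by move=> a b; apply/val_inj; rewrite /= rmorphD scalerDl. Qed.

HB.instance Definition _ :=
  GRing.Zmodule_isLmodule.Build R real_sub scaleA scale1 scaleDr scaleDl.

Lemma val_real_subD (u v : real_sub) : val (u + v) = val u + val v.
Proof. by []. Qed.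
Lemma val_real_subZ (a : R) (u : real_sub) : val (a *: u) = a%:K *: val u.
Proof. by []. Qed.

End RealSubspace.

Section HilbertForms.
Variables (R : realType) (s : scalars).
Local Notation K := (scalar R s).
Local Notation "a %:K" := (of_real R s a) (at level 2, format "a %:K").
Local Notation conj := (scalar_conj R s).
Local Notation re := (@real_part R s).
Variables (E : lmodType K) (V : subspace E) (b : E -> E -> K).

Definition hcauchy (u : nat -> E) := forall eps : R, 0 < eps ->
  exists N : nat, forall n p, (N <= n)%N -> (N <= p)%N -> qf b (u n - u p) < eps.

Definition hcvg (u : nat -> E) (l : E) := forall eps : R, 0 < eps ->
  exists N : nat, forall n, (N <= n)%N -> qf b (u n - l) < eps.

Definition hcomplete := forall u, (forall n, V (u n)) -> hcauchy u ->
  exists2 l, V l & hcvg u l.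

Definition bounded_below_on (T : E -> E) :=
  exists2 d : R, 0 < d & forall u, V u -> d * qf b u <= qf b (T u).

Hypotheses (bH : herm V b) (bp : pos V b).

Let rb (u v : real_sub V) : R := re (b (val u) (val v)).

Let rbB : symm_bilinear rb.
Proof.
split=> [a u v w|u v]; last by apply: (hreC bH); exact: real_subP.
rewrite /rb val_real_subD val_real_subZ (hLl bH) ?reD ?reZ //; exact: real_subP.
Qed.

Let rb_ge0 u : 0 <= rb u u.
Proof. exact: (pos_nonneg bH bp (real_subP u)). Qed.

Let rb_eq0 u : rb u u = 0 -> u = 0.
Proof. by move=> /(pos_eq0 bp (real_subP u)) u0; apply/val_inj. Qed.

Let rb_complete : hcomplete -> form_complete rb.
Proof.
move=> bc u uC; have [l Vl ul] := bc (val \o u) (fun n => real_subP _) uC.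
by exists (to_real_sub Vl).
Qed.

Lemma riesz_on (D : subspace E) (l : E -> K) (C : R) : hcomplete ->
  (forall u, D u -> V u) ->
  (forall a u v, V u -> V v -> l (a *: u + v) = conj a * l u + l v) ->
  (forall u, V u -> sqn (l u) <= C * qf b u) ->
  exists p, [/\ V p, forall d, D d -> b p d = l d &
    forall eps : R, 0 < eps -> exists2 d, D d & qf b (p - d) < eps].
Proof.
move=> bc DV llin lC.
have [||a u v|u|p pP pD] := @riesz_in_closure _ _ _ rbB rb_ge0 (rb_complete bc)
    (fun u => D (val u)) (fun u => re (l (val u))) C.
- exact: sub0.
- by move=> a u v Du Dv; apply: subD => //; apply: subZ.
- rewrite val_real_subD val_real_subZ llin; try exact: real_subP.
  by rewrite conj_of_real reD reZ.
- by apply: le_trans (sqr_re_le_sqn _) _; apply: lC; exact: real_subP.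
exists (val p); split=> [|d Dd|eps e0]; first exact: real_subP.
- apply/eqP; rewrite -subr_eq0 -sqn_eq0; apply/eqP.
  set z := b (val p) d - l d.
  have Dz : D (z *: d) by apply: subZ.
  (* Multiplying d by the defect z turns the real part of the defect into
     |z|^2. *)
  have := pP (to_real_sub (DV _ Dz)) Dz; rewrite /rb /=.
  rewrite (hZr bH) ?real_subP //; try exact: DV; try exact: real_subP.
  have l0 : l 0 = 0.
    have := llin 1 0 0 (sub0 V) (sub0 V); rewrite scale1r addr0 rmorph1 mul1r.
    by move/eqP; rewrite -subr_eq0 opprD addNKr oppr_eq0 => /eqP.
  rewrite -[z *: d]addr0 llin; try exact: sub0; last exact: DV.
  rewrite l0 addr0 => /eqP; rewrite -subr_eq0 -reN -reD -mulrN -mulrDr -/z.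
  by rewrite mulrC => /eqP.
- by have [d Dd dP] := pD _ e0; exists (val d).
Qed.

Section Operator.
Variable T : E -> E.
Hypotheses (TV : forall u, V u -> V (T u)).
Hypotheses (Ts : forall u v, V u -> V v -> b (T u) v = b u (T v)).
Variable M : R.
Hypotheses (TM : forall u, V u -> qf b (T u) <= M * qf b u).

Let rT (u : real_sub V) : real_sub V := to_real_sub (TV (real_subP u)).

Let rTs : form_sym rb rT.
Proof. by move=> u v; rewrite /rb /= Ts //; exact: real_subP. Qed.

Let rTM u : rb (rT u) (rT u) <= M * rb u u.
Proof. exact: (TM (real_subP u)). Qed.

Let bounded_below_real k :
  bounded_below_on (fun u => T u - k%:K *: u) ->
  bounded_below rb (fun u => rT u - k *: u).
Proof. by case=> d d0 dP; exists d => // u; apply: (dP _ (real_subP u)). Qed.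

Lemma nonneg_op_bound_on N u :
  (forall u, V u -> 0 <= re (b (T u) u)) ->
  (forall u, V u -> re (b (T u) u) <= N * qf b u) ->
  V u -> qf b (T u) <= N * re (b (T u) u).
Proof.
move=> T0 TN Vu.
apply: (nonneg_op_bound rbB rb_ge0 rb_eq0 (to_real_sub Vu) rTs) => w.
  exact: (T0 _ (real_subP w)).
exact: (TN _ (real_subP w)).
Qed.

Lemma norm_ge_of_gap_on c : 0 <= c ->
  (forall k, `|k| < c -> bounded_below_on (fun u => T u - k%:K *: u)) ->
  forall u, V u -> c ^+ 2 * qf b u <= qf b (T u).
Proof.
move=> c0 gap u Vu.
apply: (norm_ge_of_gap rbB rb_ge0 rb_eq0 rTs rTM c0 _ (to_real_sub Vu)) => r rc.
by split; apply/bounded_below_real/gap; rewrite ?normrN ger0_norm; lra.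
Qed.

Lemma bounded_below_surj_on : hcomplete -> bounded_below_on T ->
  forall v, V v -> exists2 u, V u & T u = v.
Proof.
move=> bc [d d0 dP] v Vv.
have Tbb : bounded_below rb rT by exists d => // u; apply: (dP _ (real_subP u)).
have [u uv] := bounded_below_surj rbB rb_ge0 rb_eq0 (rb_complete bc) rTs rTM Tbb
  (to_real_sub Vv).
by exists (val u); [exact: real_subP|have := congr1 val uv].
Qed.

Lemma isolated_top_eigenvector_on k eps : hcomplete ->
  (forall u, V u -> re (b (T u) u) <= k * qf b u) ->
  (forall d, 0 < d -> exists2 u, V u & (k - d) * qf b u < re (b (T u) u)) ->
  0 < eps ->
  (forall r, k - eps < r < k -> bounded_below_on (fun u => T u - r%:K *: u)) ->
  exists u, [/\ V u, u != 0 & T u = k%:K *: u].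
Proof.
move=> bc Tk kT e0 gap.
have [|||u u0 uP] := isolated_top_eigenvector rbB rb_ge0 rb_eq0 (rb_complete bc)
    rTs rTM (k := k) _ _ e0.
- by move=> u; apply: (Tk _ (real_subP u)).
- by move=> d /kT[u Vu uP]; exists (to_real_sub Vu).
- by move=> r /gap/bounded_below_real.
exists (val u); split; first exact: real_subP.
- by apply: contra_neq u0 => u0; apply/val_inj.
- by have := congr1 val uP.
Qed.

End Operator.

End HilbertForms.

(** * The form domain as a Hilbert space *)

Section HilbertSpaceForms.
Variables (R : realType) (s : scalars) (H : hilbert R s).
Local Notation K := (scalar R s).
Local Notation "a %:K" := (of_real R s a) (at level 2, format "a %:K").
Local Notation re := (@real_part R s).

Definition full : subspace H :=
  @Subspace _ H (fun=> True) I (fun _ _ _ _ _ => I).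

Lemma ip_herm (V : subspace H) : herm V (ip H).
Proof.
split=> [a u v w _ _ _|u v _ _]; first by rewrite linearPl.
by rewrite hermC expr0 mul1r.
Qed.

Lemma norm_rnorm (u : H) : `|u| = (rnorm u)%:K.
Proof. exact/ge0_of_real/normr_ge0. Qed.

Lemma q_ip u : qf (ip H) u = rnorm u ^+ 2.
Proof. by rewrite /qf ip_norm norm_rnorm -rmorphXn re_of_real. Qed.

Lemma ip_pos (V : subspace H) : pos V (ip H).
Proof.
move=> u _ u0; rewrite q_ip exprn_gt0 // /rnorm lt_def re_ge0 ?normr_ge0 // andbT.
by rewrite -(fmorph_eq0 (of_real R s)) -norm_rnorm normr_eq0.
Qed.

Lemma ip_nonneg (V : subspace H) : nonneg V (ip H).
Proof. exact: pos_nonneg (ip_herm V) (@ip_pos V). Qed.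

Lemma rnorm_ge0 (u : H) : 0 <= rnorm u.
Proof. exact/re_ge0/normr_ge0. Qed.

Lemma norm_lt (u : H) (eps : R) : 0 < eps ->
  (`|u| < eps%:K) = (qf (ip H) u < eps ^+ 2).
Proof.
move=> e0; rewrite q_ip norm_rnorm ltr_of_real ltr_sqr ?nnegrE ?rnorm_ge0 //.
exact: ltW.
Qed.

Lemma K_gt0 (e : K) : 0 < e -> exists2 r : R, 0 < r & e = r%:K.
Proof.
move=> e0; exists (re e); last exact/ge0_of_real/ltW.
by rewrite -(ltr_of_real s) -ge0_of_real ?rmorph0 // ltW.
Qed.

Lemma hcvg_ipP (u : nat -> H) l : hcvg (ip H) u l <-> u @ \oo --> l.
Proof.
split=> [ul|/cvgrPdist_lt ul].
  apply/cvgrPdist_lt => e /K_gt0[r r0 ->].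
  have [N NP] := ul (r ^+ 2) (exprn_gt0 2 r0).
  by exists N => // n /= Nn; rewrite distrC norm_lt // NP.
move=> e e0; have r0 : 0 < Num.sqrt e by rewrite sqrtr_gt0.
have [|N _ NP] := ul (Num.sqrt e)%:K.
  by rewrite -(rmorph0 (of_real R s)) ltr_of_real.
exists N => n Nn; have := NP n Nn.
by rewrite distrC norm_lt // sqr_sqrtr // ltW.
Qed.

Lemma ip_complete : hcomplete full (ip H).
Proof.
move=> u _ uC.
have /cvg_ex[l ul] : cvg (u @ \oo).
  apply/cauchy_cvgP/cauchy_ballP => e /K_gt0[r r0 ->].
  have [N NP] := uC (r ^+ 2) (exprn_gt0 2 r0); rewrite near_map2.
  exists ([set n | (N <= n)%N], [set n | (N <= n)%N]) => /=.
    by split; exists N.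
  by move=> [n p] [/= Nn Np]; rewrite -ball_normE /= norm_lt // NP.
by exists l => //; apply/hcvg_ipP.
Qed.

Variable h : posdef_form H.

Definition fdom : subspace H := Subspace (form_dom0 h) (@form_domP _ _ _ h).

Lemma form_herm : herm fdom h.
Proof. by split; [exact: form_linear|exact: form_symmetric]. Qed.

Lemma form_coercive : exists2 c : R, 0 < c &
  forall u, fdom u -> c * qf (ip H) u <= qf h u.
Proof.
have [c c0 cP] := form_posdef h; exists c => // u hu.
rewrite -(ler_of_real s) rmorphM -(q_real form_herm) //.
by rewrite q_ip rmorphXn -norm_rnorm; exact: cP.
Qed.

Lemma form_pos : pos fdom h.
Proof.
have [c c0 cP] := form_coercive => u hu u0.
by apply: lt_le_trans (cP _ hu); rewrite mulr_gt0 // (@ip_pos full).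
Qed.

Definition perp_set (Y : set H) u := form_dom h u /\ forall y, Y y -> ip H u y = 0.

Lemma perp_set0 Y : perp_set Y 0.
Proof. by split=> [|y _]; [exact: form_dom0|exact: (h0l (ip_herm full))]. Qed.

Lemma perp_setP Y a u v : perp_set Y u -> perp_set Y v ->
  perp_set Y (a *: u + v).
Proof.
move=> [hu uY] [hv vY]; split=> [|y Yy]; first exact: form_domP.
by rewrite (hLl (ip_herm full)) // uY // vY // mulr0 addr0.
Qed.

(** For Y empty this is the whole form domain, for Y = range P the form
domain of W, and for Y a set of eigenvectors the space in the min-max
principle. *)
Definition perp Y : subspace H := Subspace (perp_set0 Y) (@perp_setP Y).

Lemma perp_dom Y u : perp Y u -> fdom u.
Proof. by case. Qed.

Lemma perp_herm Y : herm (perp Y) h.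
Proof. exact: herm_sub (@perp_dom Y) form_herm. Qed.

Lemma perp_pos Y : pos (perp Y) h.
Proof. by move=> u /perp_dom; exact: form_pos. Qed.

(** By coercivity a Cauchy sequence for h converges in norm, then for h
because the form is closed; orthogonality to Y passes to limits in norm. *)
Lemma perp_complete Y : hcomplete (perp Y) h.
Proof.
move=> u uV uC; have [c c0 cP] := form_coercive.
have uC' : hcauchy (ip H) u.
  move=> e e0; have [N NP] := uC (c * e) (mulr_gt0 c0 e0).
  exists N => n p Nn Np; rewrite -(ltr_pM2l c0).
  apply: le_lt_trans (NP n p Nn Np); apply: cP; apply: (@subB _ _ fdom);
  exact: perp_dom.
have [l _ ul] := ip_complete (fun=> I) uC'.
have [|hl hul] := form_closed (fun n => (uV n).1) ((hcvg_ipP _ _).1 ul).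
  move=> e e0; have [N NP] := uC e e0; exists N => n p Nn Np.
  rewrite (q_real form_herm) ?ltr_of_real ?NP //; apply: (@subB _ _ fdom);
  exact: perp_dom.
exists l; last first.
  move=> e e0; have [N NP] := hul e e0; exists N => n Nn.
  rewrite -(ltr_of_real s) -(q_real form_herm) ?NP //; apply: (@subB _ _ fdom) => //;
  exact: perp_dom.
split=> // y Yy; apply/eqP; rewrite -sqn_eq0 eq_le sqn_ge0 andbT.
apply: (@le0_of_forall_eps _ _ (qf (ip H) y)); first exact: (@ip_nonneg full).
move=> e e0; have [N NP] := ul e e0.
have -> : sqn (ip H l y) = sqn (ip H (u N - l) y).
  rewrite (hBl (ip_herm full)) // (uV N).2 // sub0r.
  by rewrite -mulN1r -(rmorphN1 (of_real R s)) sqnM sqn_of_real sqrrN expr1n mul1r.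
apply: le_trans (herm_cauchy_schwarz (ip_herm full) (@ip_nonneg full) _ _) _ => //.
by rewrite mulrC ler_wpM2l ?(@ip_nonneg full) // ltW // NP.
Qed.

End HilbertSpaceForms.

(** * Solution operators of the form *)

Section GreenOperator.
Variables (R : realType) (s : scalars) (H : hilbert R s) (h : posdef_form H).
Local Notation K := (scalar R s).
Local Notation "a %:K" := (of_real R s a) (at level 2, format "a %:K").
Local Notation re := (@real_part R s).
Local Notation fdom := (fdom h).

Let iH := @ip_herm R s H (full H).
Let i0 := @ip_nonneg R s H (full H).

Lemma ex_form_projection Y a : fdom a ->
  exists2 z, perp h Y z & forall v, perp h Y v -> h z v = h a v.
Proof.
move=> ha; have hH := form_herm h; have h0 := pos_nonneg hH (@form_pos _ _ _ h).
have [|||p [Vp pP _]] := @riesz_on _ _ _ (perp h Y) h (perp_herm h Y)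
  (@perp_pos _ _ _ h Y) (perp h Y) (h a) (qf h a) (@perp_complete _ _ _ h Y).
- by [].
- move=> x u v /perp_dom hu /perp_dom hv.
  by rewrite (hDr hH) ?(hZr hH) //; exact: (@subZ _ _ fdom).
- by move=> u /perp_dom hu; exact: (herm_cauchy_schwarz hH h0).
by exists p.
Qed.

Lemma ex_form_solution Y f :
  exists2 z, perp h Y z & forall v, perp h Y v -> h z v = ip H f v.
Proof.
have [c c0 cP] := form_coercive h.
have [|||p [Vp pP _]] := @riesz_on _ _ _ (perp h Y) h (perp_herm h Y)
  (@perp_pos _ _ _ h Y) (perp h Y) (ip H f) (qf (ip H) f / c)
  (@perp_complete _ _ _ h Y).
- by [].
- by move=> x u v _ _; rewrite (hDr iH) ?(hZr iH).
- move=> u /perp_dom hu.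
  apply: le_trans (herm_cauchy_schwarz iH i0 _ _) _ => //.
  by rewrite -mulrA ler_wpM2l ?i0 // ler_pdivlMl // cP.
by exists p.
Qed.

Section Green.
Variables (Y : set H) (G : H -> H).
(* G inverts the operator defined by h in the orthogonal complement of Y. *)
Hypotheses (GV : forall f, perp h Y (G f)).
Hypotheses (GP : forall f v, perp h Y v -> h (G f) v = ip H f v).
Local Notation V := (perp h Y).

Let hH := perp_herm h Y.
Let hp := @perp_pos _ _ _ h Y.
Let h0 := pos_nonneg hH hp.

Lemma green_sym u v : V u -> V v -> h (G u) v = h u (G v).
Proof.
by move=> Vu Vv; rewrite GP // (hC hH Vu (GV v)) GP // -(hC iH).
Qed.

Lemma green_linear a u v : G (a *: u + v) = a *: G u + G v.
Proof.
have VGuv : V (a *: G u + G v) by exact: subP.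
apply: (h_eq hH hp) => // w Vw.
by rewrite (hLl hH) // !GP // (hLl iH).
Qed.

Lemma green_sub u v : G (u - v) = G u - G v.
Proof. by rewrite addrC -scaleN1r green_linear scaleN1r addrC. Qed.

Lemma green_quad u : V u -> re (h (G u) u) = qf (ip H) u.
Proof. by move=> Vu; rewrite GP. Qed.

(** From h[Gf] = (f, Gf), Cauchy-Schwarz and coercivity. *)
Lemma green_bound : exists2 M : R, 0 < M & forall f, qf h (G f) <= M * qf (ip H) f.
Proof.
have [c c0 cP] := form_coercive h.
exists c^-1 => [|f]; first by rewrite invr_gt0.
have [->|nz] := eqVneq (qf h (G f)) 0; first by rewrite mulr_ge0 ?i0 // invr_ge0 ltW.
have hp' : 0 < qf h (G f) by rewrite lt_def nz h0.
have := re_cauchy_schwarz iH i0 (u := f) (v := G f) I I.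
rewrite -GP // -[re _]/(qf h (G f)) expr2 => h1.
have h2 := cP _ (perp_dom (GV f)).
rewrite -(ler_pM2r hp') -mulrA ler_pdivlMl //.
have h3 : qf (ip H) f * (c * qf (ip H) (G f)) <= qf (ip H) f * qf h (G f).
  by rewrite ler_wpM2l // i0.
by apply: le_trans h3; rewrite [X in _ <= X]mulrCA ler_pM2l.
Qed.

Lemma green_bound_on : exists2 M : R, 0 < M & forall u, V u -> qf h (G u) <= M * qf h u.
Proof.
have [c c0 cP] := form_coercive h; have [M M0 MP] := green_bound.
exists (M / c) => [|u Vu]; first by rewrite divr_gt0.
apply: le_trans (MP _) _; rewrite -mulrA ler_pM2l // ler_pdivlMl // cP //.
exact: perp_dom Vu.
Qed.

Lemma green_shift_sym (x y : R) u v : V u -> V v ->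
  h (x%:K *: u + y%:K *: G u) v = h u (x%:K *: v + y%:K *: G v).
Proof.
move=> Vu Vv.
rewrite (hDl hH) ?(hZl hH) // ?(hDr hH) ?(hZr hH) //; try exact: subZ.
by rewrite !conj_of_real green_sym.
Qed.

Lemma green_shift_bound (x y : R) : exists M : R, forall u, V u ->
  qf h (x%:K *: u + y%:K *: G u) <= M * qf h u.
Proof.
have [M M0 MP] := green_bound_on.
exists (2 * x ^+ 2 + 2 * y ^+ 2 * M) => u Vu.
apply: le_trans (q_sqD hH h0 _ _) _; try exact: subZ.
rewrite !(qZ hH) // !sqn_of_real mulrDl -!mulrA.
have : y ^+ 2 * qf h (G u) <= y ^+ 2 * (M * qf h u).
  by rewrite ler_wpM2l ?sqr_ge0 // MP.
lra.
Qed.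

(** Let A be the inverse of G and y = G x - x / t. Then (A - t) (G x) = - t y,
so the resolvent bound controls the norm of G x by that of y, and
h[Gx] = t ((Gx, Gx) - (y, Gx)) improves this to the norm of h. *)
Lemma bounded_below_of_resolvent_bound (t C : R) : 0 < t ->
  (forall x u, V x -> V u ->
     (forall v, V v -> h u v = ip H (x + t%:K *: u) v) ->
     rnorm u <= C * rnorm x) ->
  bounded_below_on V h (fun u => G u - t^-1%:K *: u).
Proof.
move=> t0 tC; have [c c0 cP] := form_coercive h.
pose a := C ^+ 2 * t ^+ 2 / c.
have a0 : 0 <= a by apply: divr_ge0; [rewrite mulr_ge0 ?sqr_ge0|exact: ltW].
pose D := 2 * t ^+ 2 * (t * a + t / 2 * (c^-1 + a) + 1).
have D0 : 0 < D.
  have ci : 0 < c^-1 by rewrite invr_gt0.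
  apply: mulr_gt0; first by rewrite mulr_gt0 ?exprn_gt0.
  have : 0 <= t * a by rewrite mulr_ge0 // ltW.
  have : 0 <= t / 2 * (c^-1 + a) by apply: mulr_ge0; lra.
  lra.
exists D^-1 => [|x Vx]; first by rewrite invr_gt0.
rewrite ler_pdivrMl //.
set y := G x - _.
have Vy : V y by apply: subB => //; exact: subZ.
have xE : x = t%:K *: (G x - y).
  by rewrite /y subKr scalerA -rmorphM divff ?gt_eqF // rmorph1 scale1r.
clearbody y.
have y_ip : qf (ip H) y <= c^-1 * qf h y.
  by rewrite ler_pdivlMl // cP //; exact: perp_dom Vy.
have Gx_ip : qf (ip H) (G x) <= a * qf h y.
  have Vty : V (- (t%:K *: y)) by apply: subN; exact: subZ.
  have := tC _ _ Vty (GV x).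
  have -> : - (t%:K *: y) + t%:K *: G x = x.
    by rewrite addrC -scalerBr -xE.
  move=> /(_ (fun v Vv => GP x Vv)) le1.
  have : qf (ip H) (G x) <= C ^+ 2 * qf (ip H) (- (t%:K *: y)).
    rewrite !q_ip -exprMn ler_sqr ?nnegrE ?rnorm_ge0 //.
    exact: le_trans (rnorm_ge0 _) le1.
  rewrite -scaleNr -rmorphN (qZ iH) // sqn_of_real sqrrN => le2.
  apply: le_trans le2 _; rewrite /a -[_ / c * _]mulrA -[C ^+ 2 * _ * _]mulrA.
  apply: ler_wpM2l; first exact: sqr_ge0.
  by apply: ler_wpM2l; first exact: sqr_ge0.
have Gx_h : qf h (G x) <= (t * a + t / 2 * (c^-1 + a)) * qf h y.
  have -> : qf h (G x) = t * (qf (ip H) (G x) - re (ip H y (G x))).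
    rewrite {1}/qf GP // {1}xE (hZl iH) // reZ (hBl iH) //.
    by rewrite reD reN.
  have := i0 (subD (I : full H y) (I : full H (G x))).
  rewrite (qD iH) // => h1.
  have : t * (qf (ip H) (G x) - re (ip H y (G x))) <=
         t * (qf (ip H) (G x) + (qf (ip H) y + qf (ip H) (G x)) / 2).
    by rewrite ler_pM2l //; lra.
  move=> h2; apply: le_trans h2 _.
  have -> : (t * a + t / 2 * (c^-1 + a)) * qf h y =
    t * (a * qf h y + (c^-1 * qf h y + a * qf h y) / 2) by field; rewrite gt_eqF.
  by rewrite ler_pM2l //; lra.
rewrite {1}xE (qZ hH) ?sqn_of_real; last exact: subB.
rewrite /D -[2 * _ * _ * _]mulrA -[2 * _ * _]mulrA mulrCA ler_pM2l ?exprn_gt0 //.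
have := h0 (subD (GV x) Vy); rewrite (qD hH) // (qB hH) //.
move: Gx_h; move: (t * a + _) => z; rewrite mulrDl mul1r; lra.
Qed.

End Green.

End GreenOperator.

(** * Spectrum and lower bounds *)

Section Spectrum.
Variables (R : realType) (s : scalars) (H : hilbert R s) (h : posdef_form H).
Local Notation K := (scalar R s).
Local Notation "a %:K" := (of_real R s a) (at level 2, format "a %:K").
Local Notation re := (@real_part R s).
Local Notation fdom := (fdom h).

Let iH := @ip_herm R s H (full H).
Let i0 := @ip_nonneg R s H (full H).

Lemma ex_green Y : exists G : H -> H, (forall f, perp h Y (G f)) /\
  forall f v, perp h Y v -> h (G f) v = ip H f v.
Proof.
have ex f : exists z, perp h Y z /\ forall v, perp h Y v -> h z v = ip H f v.
  by have [z] := ex_form_solution h Y f; exists z.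
by have [G GP] := choice ex; exists G; split=> f; case: (GP f).
Qed.

(** The equation A u = f + t u amounts to (1 - t G) u = G f in the form
domain, where 1 - t G is symmetric for h and therefore onto as soon as it is
bounded below. *)
Lemma resolvent_of_bounded_below (Y X : set H) (A : operator H) (G : H -> H) t :
  (forall f, perp h Y (G f)) ->
  (forall f v, perp h Y v -> h (G f) v = ip H f v) ->
  (forall u f, A (u, f) <->
     [/\ perp h Y u, X f & forall v, perp h Y v -> h u v = ip H f v]) ->
  (forall f u, X f -> perp h Y u -> X (f + t%:K *: u)) ->
  bounded_below_on (perp h Y) h (fun u => 1%:K *: u + (- t)%:K *: G u) ->
  resolvent_set X A t%:K.
Proof.
move=> GV GP AE Xt bb.
have hH := perp_herm h Y; have hp := @perp_pos _ _ _ h Y.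
have h0 := pos_nonneg hH hp.
set T := fun u : H => _ in bb.
have TE u : T u = u - t%:K *: G u.
  by rewrite /T rmorph1 scale1r rmorphN scaleNr.
have TV u : perp h Y u -> perp h Y (T u).
  by move=> Vu; rewrite TE; apply: subB => //; exact: subZ.
have AT f u : X f -> perp h Y u -> (A (u, f + t%:K *: u) <-> T u = G f).
  move=> Xf Vu; split=> [/AE[_ _ uP]|Tu].
    apply: (h_eq hH hp) => //; first exact: TV.
    move=> v Vv; rewrite TE (hBl hH) //; last exact: subZ.
    by rewrite (hZl hH) // !GP // uP // (hDl iH) // (hZl iH) // addrK.
  apply/AE; split=> // [|v Vv]; first exact: Xt.
  have -> : u = G f + t%:K *: G u by rewrite -Tu TE subrK.
  have VtG : perp h Y (t%:K *: G u) by apply: subZ.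
  rewrite (hDl hH) // (hZl hH) // !GP // (hDl iH) // (hZl iH) //.
  by rewrite -Tu TE subrK.
have [M TM] := green_shift_bound GV GP 1 (- t).
have Ts u v : perp h Y u -> perp h Y v -> h (T u) v = h u (T v).
  exact: (green_shift_sym GV GP).
have [d d0 dP] := bb.
split=> [f Xf|].
  have [u Vu uP] := bounded_below_surj_on hH hp TV Ts TM
    (@perp_complete _ _ _ h Y) bb (GV f).
  exists u; split=> [|u' Au']; first by apply/AT.
  have Vu' : perp h Y u' by case/AE: Au'.
  have Tu' : T u' = G f by apply/AT.
  apply/eqP; rewrite -subr_eq0; apply/eqP/(pos_eq0 hp); first exact: subB.
  apply/eqP; rewrite eq_le h0 ?andbT; last exact: subB.
  rewrite -(ler_pM2l d0) mulr0; apply: le_trans (dP _ (subB Vu Vu')) _.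
  have -> : T (u - u') = T u - T u'.
    rewrite !TE (green_sub GV GP) scalerBr !opprB addrACA [RHS]addrACA.
    by congr (_ + _); exact: addrC.
  by rewrite uP Tu' subrr (q0 hH).
have [c c0 cP] := form_coercive h; have [N N0 NP] := green_bound GV GP.
exists (Num.sqrt (N / (c * d))) => u f Xf Au.
have Vu : perp h Y u by case/AE: Au.
have Tu : T u = G f by apply/AT.
rewrite -ler_sqr ?nnegrE ?mulr_ge0 ?rnorm_ge0 ?sqrtr_ge0 //.
have cd : 0 < c * d by rewrite mulr_gt0.
rewrite exprMn sqr_sqrtr; last by apply: divr_ge0; exact: ltW.
rewrite -!q_ip mulrAC ler_pdivlMr //.
apply: le_trans (NP f); rewrite -Tu; apply: le_trans (dP _ Vu).
have -> : qf (ip H) u * (c * d) = d * (c * qf (ip H) u) by ring.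
by rewrite ler_pM2l // cP //; exact: perp_dom Vu.
Qed.

(** The lower half of the min-max principle; the second hypothesis says that
Y reduces the form. Let k be the supremum of (u, u) / h[u] over the complement
of Y, the top of the spectrum of its Green operator. If 1 / k < Lam, then 1 / k
is a point of the spectrum of H below the essential spectrum, hence isolated,
and there is an eigenvector for it in the complement of Y. *)
Lemma form_ge_below_ess (Y : set H) (Lam : R) :
  (Lam%:E <= lambda_ess (op_H h))%E ->
  (forall u, fdom u -> exists2 a, fdom a &
     perp h Y (u - a) /\
     forall v, perp h Y v -> ip H v a = 0 /\ h v a = 0) ->
  (forall t x, t < Lam -> eigenspace (op_H h) t x -> perp h Y x -> x = 0) ->
  forall u, perp h Y u -> Lam * qf (ip H) u <= qf h u.
Proof.
move=> Less decomp noev u0 Vu0; rewrite leNgt; apply/negP => u0P.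
have hH := perp_herm h Y; have hp := @perp_pos _ _ _ h Y.
have h0 := pos_nonneg hH hp.
have [G [GV GP]] := ex_green Y.
(* As Y reduces the form, weak solutions may be tested on the complement of
   Y only. *)
have ext u x : perp h Y u -> full H x ->
    (forall v, perp h Y v -> h u v = ip H x v) ->
    (forall a, fdom a -> (forall v, perp h Y v -> ip H v a = 0 /\ h v a = 0) ->
      ip H x a = 0) ->
    forall v, fdom v -> h u v = ip H x v.
  move=> Vu _ uP xa v hv; have [a ha [va vP]] := decomp v hv.
  have -> : v = (v - a) + a by rewrite subrK.
  rewrite (hDr (form_herm h)) //; try exact: perp_dom va; try exact: perp_dom Vu.
  by rewrite (hDr iH) // (uP _ va) (xa _ ha vP) (vP _ Vu).2.
have bb r : 0 < r -> resolvent_set setT (op_H h) r%:K ->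
    bounded_below_on (perp h Y) h (fun u => G u - r^-1%:K *: u).
  move=> r0 [_ [C CP]]; apply: (bounded_below_of_resolvent_bound GV GP (C := C)) => //.
  move=> x u Vx Vu uP; apply: CP => //; split; first exact: perp_dom Vu.
  split=> // v hv; apply: ext => // a ha aP.
  by rewrite (hDl iH) // (hZl iH) // (aP _ Vx).1 (aP _ Vu).1 mulr0 addr0.
have u0n : u0 != 0.
  by apply/eqP => u00; move: u0P; rewrite u00 (q0 hH) (q0 iH) mulr0 ltxx.
have hu0 := hp _ Vu0 u0n.
have Lam0 : 0 < Lam.
  have := lt_trans hu0 u0P; rewrite pmulr_lgt0 //.
  exact: (@ip_pos _ _ _ (full H)).
have [c c0 cP] := form_coercive h.
pose S := [set x | exists2 u, perp h Y u & u != 0 /\ x = qf (ip H) u / qf h u].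
have Su0 : S (qf (ip H) u0 / qf h u0) by exists u0.
have Sub : ubound S c^-1.
  move=> _ [u Vu [un ->]]; rewrite ler_pdivrMr ?hp // ler_pdivlMl // cP //.
  exact: perp_dom Vu.
have Ssup : has_sup S by split; [exists (qf (ip H) u0 / qf h u0)|exists c^-1].
set k := sup S.
have kP u : perp h Y u -> qf (ip H) u <= k * qf h u.
  move=> Vu; have [->|un] := eqVneq u 0; first by rewrite (q0 iH) (q0 hH) mulr0.
  by rewrite -ler_pdivrMr ?hp //; apply: ub_le_sup; [case: Ssup|exists u].
have kL : Lam^-1 < k.
  apply: lt_le_trans (ub_le_sup (proj2 Ssup) Su0).
  by rewrite ltr_pdivlMr // ltr_pdivrMl.
have k0 : 0 < k by apply: lt_trans kL; rewrite invr_gt0.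
have kinv : k^-1 < Lam by rewrite invf_plt ?posrE.
have ksup d : 0 < d -> exists2 u, perp h Y u & (k - d) * qf h u < re (h (G u) u).
  move=> d0; have [_ [u Vu [un ->]] uP] := sup_adherent d0 Ssup.
  exists u => //; rewrite (green_quad GP) //.
  by rewrite -ltr_pdivlMr ?hp.
(* Otherwise k - G would be bounded below, and k would not be the
   supremum. *)
have kspec : real_spectrum setT (op_H h) k^-1.
  move=> /bb; rewrite invr_gt0 invrK => /(_ k0)[d d0 dP].
  have CV u : perp h Y u -> perp h Y (k%:K *: u + (- 1)%:K *: G u).
    by move=> Vu; apply: subD; exact: subZ.
  have Cs u v : perp h Y u -> perp h Y v ->
      h (k%:K *: u + (- 1)%:K *: G u) v = h u (k%:K *: v + (- 1)%:K *: G v).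
    exact: (green_shift_sym GV GP).
  have Cq u : perp h Y u ->
      re (h (k%:K *: u + (- 1)%:K *: G u) u) = k * qf h u - qf (ip H) u.
    move=> Vu; rewrite (hDl hH) ?(hZl hH) //; try exact: subZ.
    by rewrite reD !reZ mulN1r (green_quad GP).
  have [M CM] := green_shift_bound GV GP k (- 1).
  have CC u : perp h Y u ->
      qf h (k%:K *: u + (- 1)%:K *: G u) <= k * (k * qf h u - qf (ip H) u).
    move=> Vu; rewrite -Cq //.
    apply: (nonneg_op_bound_on hH hp CV Cs) => // v Vv; rewrite Cq ?subr_ge0 ?kP //.
    by rewrite gerBl i0.
  have [_ [u Vu [un ->]] uP] := sup_adherent (divr_gt0 d0 k0) Ssup.
  move: uP; rewrite -/k => uP; have hu := hp _ Vu un.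
  move: uP; rewrite ltr_pdivlMr // ltNge => /negP; apply.
  have := CC u Vu; have := dP u Vu.
  have -> : qf h (G u - k%:K *: u) = qf h (k%:K *: u + (- 1)%:K *: G u).
    rewrite rmorphN1 scaleN1r -opprB -[- _]scaleN1r (qZ hH); last first.
      by apply: subB => //; exact: subZ.
    by rewrite -(rmorphN1 (of_real R s)) sqn_of_real sqrrN expr1n mul1r.
  move=> h1 h2; have := le_trans h1 h2; rewrite -ler_pdivrMl // => h3.
  have -> : (k - d / k) * qf h u = k * qf h u - k^-1 * (d * qf h u) by ring.
  lra.
have kdisc : discrete_spectrum (op_H h) k^-1.
  apply: contrapT => nd.
  have : (lambda_ess (op_H h) <= k^-1%:E)%E.
    by apply: ereal_inf_lbound; exists k^-1.
  by move=> /(le_trans Less); rewrite lee_fin leNgt kinv.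
have [_ [eps e0 isol] _] := kdisc.
(* With this radius r |-> 1 / r maps (k - e, k) into the neighbourhood of
   1 / k that contains no other point of the spectrum. *)
pose e := Num.min (k / 2) (eps * k ^+ 2 / 4).
have ep : 0 < e.
  by rewrite lt_min !divr_gt0 // mulr_gt0 // exprn_gt0.
have [M _ GM] := green_bound_on GV GP.
have [||r rP|x [Vx xn xP]] := isolated_top_eigenvector_on hH hp
  (fun u _ => GV u) (green_sym GV GP) GM (k := k) (@perp_complete _ _ _ h Y)
  _ _ ep.
- by move=> u Vu; rewrite (green_quad GP) // kP.
- exact: ksup.
- have re2 : k / 2 < r.
    have : e <= k / 2 by rewrite ge_min lexx.
    lra.
  have r0 : 0 < r by lra.
  have := @bb r^-1; rewrite invr_gt0 invrK; apply => //.
  apply: contrapT => rs; have : r^-1 = k^-1; last first.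
    by move=> /invr_inj rk; move: rP; rewrite rk ltxx andbF.
  apply: isol => //.
  have -> : r^-1 - k^-1 = (k - r) / (r * k) by field; rewrite !gt_eqF.
  rewrite ger0_norm ?divr_ge0 ?mulr_ge0 //; [|lra..].
  rewrite ltr_pdivrMr ?mulr_gt0 //.
  have : e <= eps * k ^+ 2 / 4 by rewrite ge_min lexx orbT.
  have : eps * (k / 2 * k) <= eps * (r * k).
    by rewrite !ler_pM2l // ler_pM2r // ltW.
  have -> : eps * (k / 2 * k) = eps * k ^+ 2 / 2 by field.
  have : 0 < eps * k ^+ 2 by rewrite mulr_gt0 // exprn_gt0.
  lra.
move: xn; rewrite (noev k^-1 x) ?eqxx //.
split; first exact: perp_dom Vx.
split=> // v hv; apply: ext => // [w Vw|a ha aP].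
  rewrite (hZl iH) // -GP // xP (hZl hH) // mulrA -rmorphM mulVf ?gt_eqF //.
  by rewrite rmorph1 mul1r.
by rewrite (hZl iH) // (aP _ Vx).1 mulr0.
Qed.

End Spectrum.

(** * The square root and the Rayleigh quotient *)

Section SquareRoot.
Variables (R : realType) (s : scalars) (H : hilbert R s) (h : posdef_form H).
Local Notation K := (scalar R s).
Local Notation "a %:K" := (of_real R s a) (at level 2, format "a %:K").
Local Notation conj := (scalar_conj R s).
Local Notation re := (@real_part R s).
Local Notation fdom := (fdom h).

Let iH := @ip_herm R s H (full H).
Let i0 := @ip_nonneg R s H (full H).
Let ip_p := @ip_pos R s H (full H).

Lemma closure_approx (A : set H) z (e : R) : 0 < e -> closure A z ->
  exists2 w, A w & qf (ip H) (z - w) < e.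
Proof.
move=> e0 Az; have r0 : 0 < Num.sqrt e by rewrite sqrtr_gt0.
have [|w [Aw /=]] := Az (ball z (Num.sqrt e)%:K).
  by apply: nbhsx_ballx; rewrite -(rmorph0 (of_real R s)) ltr_of_real.
rewrite -ball_normE /= norm_lt // sqr_sqrtr ?ltW // => zw.
by exists w.
Qed.

Lemma dense_orthogonal (A : set H) z : setT `<=` closure A ->
  (forall w, A w -> ip H w z = 0) -> z = 0.
Proof.
move=> Ad Az; apply: (pos_eq0 ip_p) => //; apply/eqP.
rewrite -sqrf_eq0 eq_le sqr_ge0 andbT.
apply: (@le0_of_forall_eps _ _ (qf (ip H) z)); first exact: i0.
move=> e e0; have [w Aw wP] := closure_approx e0 (Ad z I).
have zE : qf (ip H) z = re (ip H (z - w) z).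
  by rewrite (hBl iH) // (Az _ Aw) subr0.
rewrite {1}zE; apply: le_trans (re_cauchy_schwarz iH i0 _ _) _ => //.
by rewrite mulrC ler_wpM2l ?i0 // ltW.
Qed.

(** If w is h-orthogonal to the operator domain, it is so to G w, where G
inverts the operator, and h (G w) w = |w|^2. *)
Lemma op_H_dense u (e : R) : fdom u -> 0 < e ->
  exists2 d, op_dom (op_H h) d & qf h (u - d) < e.
Proof.
move=> hu e0; have hH := perp_herm h set0; have hp := @perp_pos _ _ _ h set0.
have V_ v : fdom v -> perp h set0 v by [].
have dom0 : op_dom (op_H h) 0.
  exists 0; split; first exact: (sub0 fdom).
  by split=> // v hv; rewrite (h0l (form_herm h)) // (h0l iH).
have domP a x y : op_dom (op_H h) x -> op_dom (op_H h) y ->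
    op_dom (op_H h) (a *: x + y).
  move=> [f [/= hx [_ xP]]] [g [/= hy [_ yP]]]; exists (a *: f + g); split=> /=.
    exact: (@subP _ _ fdom).
  by split=> // v hv; rewrite (hLl (form_herm h)) // (hLl iH) // xP // yP.
pose D := Subspace dom0 domP.
have [|||p [Vp pP pD]] := @riesz_on _ _ _ (perp h set0) h hH hp D (h u) (qf h u)
  (@perp_complete _ _ _ h set0).
- by move=> v [f []] /V_.
- by move=> a v w Vv Vw; rewrite (hDr hH) ?(hZr hH) //; try exact: V_;
    apply: subZ.
- by move=> v Vv; apply: (herm_cauchy_schwarz hH (pos_nonneg hH hp)).
have -> : u = p; last by have [d Dd dP] := pD _ e0; exists d.
have [G [GV GP]] := ex_green h set0.
apply/eqP; rewrite -subr_eq0; apply/eqP/(pos_eq0 ip_p) => //.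
have Vup : perp h set0 (u - p) by apply: subB => //; exact: V_.
rewrite /qf -GP // (hC hH) // (hBl hH) ?pP ?subrr ?rmorph0 ?re0 //; try exact: V_.
exists (u - p); split; first exact: perp_dom (GV _).
by split=> // v /V_ Vv; exact: GP.
Qed.

Variable S : operator H.
Hypothesis hS : positive_sqrt S (op_H h).

Let SE u f : S (u, f) <-> forall w g, S (w, g) -> ip H g u = ip H w f.
Proof.
have [[_ Sa] _ _] := hS.
rewrite -[S in S (u, f)]Sa /op_adjoint /=; split=> [[_ []]//|].
by [].
Qed.

Let S_fun u f f' : S (u, f) -> S (u, f') -> f = f'.
Proof.
have [[[_ Sd] _] _ _] := hS.
move=> /SE uf /SE uf'; apply/eqP; rewrite -subr_eq0; apply/eqP.
apply: dense_orthogonal Sd _ => w [g wg].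
by rewrite (hBr iH) // -(uf _ _ wg) -(uf' _ _ wg) subrr.
Qed.

Let S_lin a u f v g : S (u, f) -> S (v, g) -> S (a *: u + v, a *: f + g).
Proof.
move=> /SE uf /SE vg; apply/SE => w k wk.
by rewrite !(hDr iH) // !(hZr iH) // (uf _ _ wk) (vg _ _ wk).
Qed.

Let S_H u k : op_H h (u, k) <-> exists2 f, S (u, f) & S (f, k).
Proof. by have [_ _ <-] := hS; split. Qed.

Let S_sub u f v g : S (u, f) -> S (v, g) -> S (u - v, f - g).
Proof.
by move=> uf vg; have := S_lin (-1) vg uf; rewrite !scaleN1r ![- _ + _]addrC.
Qed.

Let S_mixed u f v k g : fdom u -> S (u, f) -> op_H h (v, k) -> S (v, g) ->
  ip H f g = h u v.
Proof.
move=> hu uf vk vg; have [g' vg' gk] := (S_H _ _).1 vk.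
have gg := S_fun vg vg'; rewrite -{g' vg'}gg in gk.
have [/= hv [_ vP]] := vk.
rewrite ((SE g k).1 gk _ _ uf) (hC iH) // -vP //.
by rewrite -(hC (form_herm h)).
Qed.

(** Let d_n in the operator domain converge to u for h. Since |S d|^2 = h[d]
there, S d_n is a Cauchy sequence, and its limit is S u because S is closed. *)
Let S_approx u : fdom u -> exists f, S (u, f) /\
  forall e : R, 0 < e -> exists d k g, [/\ op_H h (d, k), S (d, g),
    qf h (u - d) < e & qf (ip H) (f - g) < e].
Proof.
move=> hu; have [r_ r0 small] := ex_positive_null_sequence R.
have hH := form_herm h; have hn := pos_nonneg hH (@form_pos _ _ _ h).
have ex_d n : exists dgk : H * H * H, [/\ S (dgk.1.1, dgk.1.2),
    S (dgk.1.2, dgk.2) & qf h (u - dgk.1.1) < r_ n].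
  have [d [k dk] dP] := op_H_dense hu (r0 n).
  by have [g dg gk] := (S_H _ _).1 dk; exists (d, g, k).
have [x_ xP] := choice ex_d.
pose d n := (x_ n).1.1; pose g n := (x_ n).1.2; pose k n := (x_ n).2.
have dg n : S (d n, g n) by case: (xP n).
have gk n : S (g n, k n) by case: (xP n).
have dn n : qf h (u - d n) < r_ n by case: (xP n).
have dk n : op_H h (d n, k n) by apply/S_H; exists (g n).
have hd n : fdom (d n) by case: (dk n).
have Sq v f l : S (v, f) -> S (f, l) -> qf (ip H) f = qf h v.
  move=> vf fl; have vl : op_H h (v, l) by apply/S_H; exists f.
  by rewrite /qf (S_mixed _ vf vl vf) //; case: vl.
have gC : hcauchy (ip H) g.
  move=> e e0; have [|N NP] := small (e / 4); first by lra.
  exists N => n p Nn Np.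
  rewrite (Sq (d n - d p) _ (k n - k p)); try exact: S_sub.
  have -> : d n - d p = (u - d p) - (u - d n) by rewrite opprB [RHS]addrC addrA subrK.
  have hup : fdom (u - d p) by exact: subB.
  have hun : fdom (u - d n) by exact: subB.
  apply: le_lt_trans (q_sqD hH hn hup (subN hun)) _.
  rewrite (qN hH hun).
  have := dn n; have := dn p; have := NP n Nn; have := NP p Np; lra.
have [f _ gf] := ip_complete (fun=> I) gC.
have approx e : 0 < e -> exists n, qf h (u - d n) < e /\ qf (ip H) (f - g n) < e.
  move=> e0; have [N NP] := gf e e0; have [N' NP'] := small e e0.
  exists (maxn N N'); split; last by rewrite (qBC iH) // NP ?leq_maxl.
  by apply: lt_trans (dn _) _; apply: NP'; apply: leq_maxr.
exists f; split; last first.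
  by move=> e /approx[n [h1 h2]]; exists (d n), (k n), (g n).
apply/SE => w l wl; apply/eqP; rewrite -subr_eq0 -sqn_eq0 eq_le sqn_ge0 andbT.
have [c c0 cP] := form_coercive h.
apply: (@le0_of_forall_eps _ _ (2 * (qf (ip H) l / c) + 2 * qf (ip H) w)).
  have := i0 (I : full H l); have := i0 (I : full H w) => h1 h2.
  have : 0 <= qf (ip H) l / c by rewrite divr_ge0 // ltW.
  lra.
move=> e e0; have [n [h1 h2]] := approx _ e0.
have -> : ip H l u - ip H w f = ip H l (u - d n) - ip H w (f - g n).
  by rewrite !(hBr iH) // ((SE _ _).1 (dg n) _ _ wl) opprB addrA subrK.
apply: le_trans (_ : 2 * sqn (ip H l (u - d n)) + 2 * sqn (ip H w (f - g n)) <= _).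
  exact: sqn_B.
have h3 := herm_cauchy_schwarz iH i0 (u := l) (v := u - d n) I I.
have h4 := herm_cauchy_schwarz iH i0 (u := w) (v := f - g n) I I.
have hud : fdom (u - d n) by exact: subB.
have h5 := cP _ hud.
have h6 : qf (ip H) l * qf (ip H) (u - d n) <= qf (ip H) l / c * e.
  rewrite -mulrA ler_wpM2l ?i0 // ler_pdivlMl //; apply: le_trans h5 _; exact: ltW.
have h7 : qf (ip H) w * qf (ip H) (f - g n) <= qf (ip H) w * e.
  by rewrite ler_wpM2l ?i0 // ltW.
lra.
Qed.

Lemma sqrt_dom u : fdom u -> exists f, S (u, f).
Proof. by move=> /S_approx[f [uf _]]; exists f. Qed.

(** For v in the operator domain the identity follows from the symmetry of S
and S S = H; the general case is a limit. *)
Lemma sqrt_form u v f g : fdom u -> fdom v -> S (u, f) -> S (v, g) ->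
  ip H f g = h u v.
Proof.
move=> hu hv uf vg; have [g' [vg' approx]] := S_approx hv.
rewrite -{g' vg'}(S_fun vg vg') in approx.
have hH := form_herm h; have hn := pos_nonneg hH (@form_pos _ _ _ h).
apply/eqP; rewrite -subr_eq0 -sqn_eq0 eq_le sqn_ge0 andbT.
apply: (@le0_of_forall_eps _ _ (2 * qf (ip H) f + 2 * qf h u)).
  have := i0 (I : full H f); have := hn _ hu; lra.
move=> e e0; have [d [k [l [dk dl h1 h2]]]] := approx e e0.
have hd : fdom d by case: dk.
have hvd : fdom (v - d) by exact: subB.
have -> : ip H f g - h u v = ip H f (g - l) - h u (v - d).
  rewrite (hBr iH) // (hBr hH) // (S_mixed hu uf dk dl).
  by rewrite opprB addrA subrK.
apply: le_trans (sqn_B _ _) _.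
have h3 := herm_cauchy_schwarz iH i0 (u := f) (v := g - l) I I.
have h4 := herm_cauchy_schwarz hH hn hu hvd.
have h5 : qf (ip H) f * qf (ip H) (g - l) <= qf (ip H) f * e.
  by rewrite ler_wpM2l ?i0 // ltW.
have h6 : qf h u * qf h (v - d) <= qf h u * e.
  by rewrite ler_wpM2l ?hn // ltW.
lra.
Qed.

Variable P : {linear H -> H}.
Hypothesis Pdom : range P `<=` form_dom h.

(** Through this description the Rayleigh quotient is accessible from the
form, without the square root. *)
Lemma rayleigh_quotientP u g : rayleigh_quotient P S (u, g) <->
  [/\ range P u, range P g & forall v, range P v -> h u v = ip H g v].
Proof.
split=> [[f [/= Pu uf] [_ [/= Pg fg]]]|[Pu Pg ug]].
  split=> // v Pv; have [l vl] := sqrt_dom (Pdom Pv).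
  have := fg v l (Logic.conj Pv vl); rewrite (sqrt_form (Pdom Pv) (Pdom Pu) vl uf).
  by rewrite (hC (form_herm h) (Pdom Pu) (Pdom Pv)) => ->; rewrite -(hC iH).
have [f uf] := sqrt_dom (Pdom Pu); exists f => //=; split=> //; split=> //=.
move=> v l [/= Pv vl]; rewrite (sqrt_form (Pdom Pv) (Pdom Pu) vl uf).
by rewrite (hC (form_herm h) (Pdom Pv) (Pdom Pu)) ug // -(hC iH).
Qed.

End SquareRoot.

(** * Bases of eigenvectors *)

Section CountTake.
Variable T : eqType.

Lemma count_take_lt (x0 t : T) (L : seq T) i j : (i < j)%N -> (j <= size L)%N ->
  nth x0 L i = t -> (count_mem t (take i L) < count_mem t (take j L))%N.
Proof.
move=> ij jL Lt; have iL := leq_trans ij jL.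
have -> : take j L = take i.+1 L ++ drop i.+1 (take j L).
  by rewrite -(take_takel L ij) cat_take_drop.
by rewrite count_cat (take_nth x0) // Lt -cats1 count_cat /= eqxx addn1 leq_addr.
Qed.

Lemma ex_count_take (x0 t : T) (L : seq T) k : (k < count_mem t L)%N ->
  exists2 i, (i < size L)%N & nth x0 L i = t /\ count_mem t (take i L) = k.
Proof.
elim: L k => //= x L IH k; have [->|xt] := eqVneq x t.
  case: k => [|k] kL; first by exists 0%N; rewrite ?take0.
  have [|i iL [ti ci]] := IH k; first by [].
  by exists i.+1 => //=; rewrite eqxx ci.
rewrite add0n => /IH[i iL [ti ci]]; exists i.+1 => //=.
by rewrite (negPf xt) ci.
Qed.

End CountTake.

Section OrthonormalBases.
Variables (R : realType) (s : scalars) (H : hilbert R s).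

Let iH := @ip_herm R s H (full H).

Lemma has_dim_ortho_normal (V : set H) n : has_dim V n ->
  exists2 f : 'I_n -> H, ortho_normal (ip H) f & forall u, V u <-> span f u.
Proof.
move=> [e [efree ->]]; have eH := ip_herm (span e).
have [//|f [x [fe fo _ _]]] := simultaneous_diagonalisation efree eH eH
  (@ip_pos _ _ _ _) (@ip_nonneg _ _ _ _).
exists f => // u; split=> [eu|]; last exact: (span_sub fe).
by rewrite (ortho_normal_complete iH _ fe fo eu) //; exact: span_mem.
Qed.

Lemma ortho_normal_nat (V : set H) n : has_dim V n -> exists F : nat -> H,
  [/\ forall k l, (k < n)%N -> (l < n)%N -> ip H (F k) (F l) = (k == l)%:R,
      forall k, (k < n)%N -> V (F k) &
      forall x, V x -> (forall k, (k < n)%N -> ip H x (F k) = 0) -> x = 0].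
Proof.
move=> /has_dim_ortho_normal[f fo Vf].
pose F k := if insub k is Some i then f i else 0.
have FE (i : 'I_n) : F i = f i by rewrite /F valK.
exists F; split=> [k l kn ln|k kn|x /Vf[c _ <-] xF].
- by rewrite (FE (Ordinal kn)) (FE (Ordinal ln)) fo.
- by apply/Vf; rewrite (FE (Ordinal kn)); exact: span_gen.
rewrite /lincomb big1 // => i _.
by rewrite -(ortho_normal_coef iH c i _ fo) // -FE xF // scale0r.
Qed.

(** The i-th vector comes from an orthonormal basis of the i-th eigenspace, at
the position counted by the earlier occurrences of the same eigenvalue. *)
Lemma ex_eigenbasis (ES : R -> set H) (L : seq R) :
  (forall t, t \in L -> has_dim (ES t) (count_mem t L)) ->
  (forall t t' x y, t != t' -> ES t x -> ES t' y -> ip H x y = 0) ->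
  exists e : nat -> H,
  [/\ forall i j, (i < size L)%N -> (j < size L)%N ->
        ip H (e i) (e j) = (i == j)%:R,
      forall i, (i < size L)%N -> ES (nth 0 L i) (e i) &
      forall t x, t \in L -> ES t x ->
        (forall i, (i < size L)%N -> nth 0 L i = t -> ip H x (e i) = 0) ->
        x = 0].
Proof.
move=> dimL orthL.
have ex_F t : exists F : nat -> H, t \in L ->
  [/\ forall k l, (k < count_mem t L)%N -> (l < count_mem t L)%N ->
        ip H (F k) (F l) = (k == l)%:R,
      forall k, (k < count_mem t L)%N -> ES t (F k) &
      forall x, ES t x -> (forall k, (k < count_mem t L)%N -> ip H x (F k) = 0) ->
        x = 0].
  have [tL|] := boolP (t \in L); last by exists (fun=> 0).
  by have [F FP] := ortho_normal_nat (dimL _ tL); exists F.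
have [F FP] := choice ex_F.
pose e i := F (nth 0 L i) (count_mem (nth 0 L i) (take i L)).
have cL i t : (i < size L)%N -> nth 0 L i = t ->
    (count_mem t (take i L) < count_mem t L)%N.
  move=> iL it; rewrite -[X in (_ < count_mem _ X)%N](take_size L).
  exact: count_take_lt it.
exists e; split=> [i j iL jL|i iL|t x tL tx xe].
- have [ij|tt] := eqVneq (nth 0 L i) (nth 0 L j); last first.
    rewrite (orthL _ _ _ _ tt); first by case: (eqVneq i j) tt => [->|//]; rewrite eqxx.
      by have [_ + _] := FP _ (mem_nth 0 iL); apply; apply: (cL).
    by have [_ + _] := FP _ (mem_nth 0 jL); apply; apply: (cL).
  have [Fo _ _] := FP _ (mem_nth 0 jL).
  rewrite /e ij Fo ?(cL _ _ iL ij) ?(cL _ _ jL erefl) //.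
  congr (nat_of_bool _)%:R; apply/eqP/eqP => [cc|->//].
  have [lt|lt|//] := ltngtP i j.
    by have := count_take_lt lt (ltnW jL) ij; rewrite cc ltnn.
  by have := count_take_lt lt (ltnW iL) (esym ij); rewrite ij cc ltnn.
- have [_ Fi _] := FP _ (mem_nth 0 iL); exact: (Fi _ (cL _ _ iL erefl)).
have [_ _ Fx] := FP _ tL; apply: Fx => // k kt.
have [i iL [ti ci]] := ex_count_take 0 kt.
by have := xe i iL ti; rewrite /e ti ci.
Qed.

Lemma ex_orthogonal_in_span p k (f : 'I_p -> H) (e : 'I_k -> H) : (k < p)%N ->
  free_family f -> exists u, [/\ span f u, u != 0 & forall i, ip H u (e i) = 0].
Proof.
move=> kp ffree.
have [c [i ci] cP] := underdetermined_system (fun i j => ip H (f i) (e j)) kp.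
exists (lincomb f c); split=> [||j]; first exact: span_mem.
  by apply: contra_neq ci => /ffree.
by rewrite (h_lincombl iH).
Qed.

Lemma has_dim0 (V : set H) u : has_dim V 0 -> V u -> u = 0.
Proof. by move=> [e [_ ->]] [c _ <-]; rewrite big_ord0. Qed.

End OrthonormalBases.

Section LowestEigenvalues.
Variables (R : realType) (s : scalars) (H : hilbert R s) (h : posdef_form H).
Local Notation K := (scalar R s).
Local Notation "a %:K" := (of_real R s a) (at level 2, format "a %:K").
Local Notation fdom := (fdom h).

Let iH := @ip_herm R s H (full H).

(** For V = range P these are the Ritz pairs; for V everything, the
eigenpairs of H. *)
Definition weak_eigenpair (V : H -> Prop) t u :=
  [/\ V u, fdom u & forall v, V v -> fdom v -> h u v = t%:K * ip H u v].

Lemma weak_eigenpair_orthogonal V t t' x y : t != t' -> weak_eigenpair V t x ->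
  weak_eigenpair V t' y -> ip H x y = 0.
Proof.
move=> tt [Vx hx xP] [Vy hy yP].
have : (t - t')%:K * ip H x y = 0.
  rewrite rmorphB mulrBl -xP // (hC (form_herm h)) // yP // rmorphM.
  by rewrite conj_of_real -(hC iH) // subrr.
by move/eqP; rewrite mulf_eq0 fmorph_eq0 subr_eq0 (negPf tt) => /eqP.
Qed.

Lemma eigenspaceP t u : eigenspace (op_H h) t u <-> weak_eigenpair (fun=> True) t u.
Proof.
split=> [[/= hu [_ uP]]|[_ hu uP]].
  by split=> // v _ hv; rewrite uP // (hZl iH).
by split=> //; split=> // v hv; rewrite uP // (hZl iH).
Qed.

Lemma occurrences_map (lam : nat -> R) n t :
  occurrences lam n t = count_mem t [seq lam i | i <- iota 1 n].
Proof. by rewrite count_map /occurrences /index_iota subn1. Qed.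

Lemma nth_lam (lam : nat -> R) n i : (i < n)%N ->
  nth 0 [seq lam i | i <- iota 1 n] i = lam i.+1.
Proof. by move=> ni; rewrite (nth_map 0%N) ?size_iota // nth_iota. Qed.

(** The last eigenvalue may occur further on, so the list determines the
eigenspaces strictly below it only. *)
Lemma ex_eigenvectors (lam : nat -> R) n : (0 < n)%N ->
  lowest_eigenvalues (op_H h) lam n.+1 -> lam n < lam n.+1 ->
  exists e : nat -> H,
  [/\ forall i j, (i < n)%N -> (j < n)%N -> ip H (e i) (e j) = (i == j)%:R,
      forall i, (i < n)%N -> weak_eigenpair (fun=> True) (lam i.+1) (e i) &
      forall t x, t < lam n.+1 -> weak_eigenpair (fun=> True) t x ->
        (forall i, (i < n)%N -> lam i.+1 = t -> ip H x (e i) = 0) -> x = 0].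
Proof.
move=> n0 [_ lam_mono _ lam_dim _] lam_gap.
pose L := [seq lam i | i <- iota 1 n].
have sL : size L = n by rewrite size_map size_iota.
have occ t : t < lam n.+1 -> occurrences lam n.+1 t = count_mem t L.
  move=> tl; rewrite occurrences_map.
  have -> : iota 1 n.+1 = iota 1 n ++ [:: n.+1] by rewrite -(addn1 n) iotaD add1n addn1.
  rewrite map_cat count_cat /=.
  by rewrite gt_eqF // !addn0.
have Ll t : t \in L -> t < lam n.+1.
  move=> /mapP[k]; rewrite mem_iota add1n => /andP[i1 il] ->.
  by apply: le_lt_trans lam_gap; apply: lam_mono.
have [t tL|t t' x y tt /eigenspaceP tx /eigenspaceP ty|e [eo eE ex]] :=
    @ex_eigenbasis _ _ H (eigenspace (op_H h)) L.
- by rewrite -occ ?Ll //; apply: lam_dim; exact: Ll.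
- exact: weak_eigenpair_orthogonal tt tx ty.
rewrite sL in eo eE ex.
exists e; split=> // [i ni|t x tl tx xe].
  by apply/eigenspaceP; rewrite -(nth_lam lam ni); exact: eE.
have [tL|tL] := boolP (t \in L).
  by apply: (ex t) => // [|i ni]; [apply/eigenspaceP|rewrite nth_lam //; exact: xe].
apply: (@has_dim0 _ _ _ (eigenspace (op_H h) t)); last exact/eigenspaceP.
by have := lam_dim t tl; rewrite occ // (count_memPn tL).
Qed.

(** Eigenvectors reduce the form, as a vector orthogonal to them is also
h-orthogonal to them. *)
Lemma form_ge_of_orthogonal (lam : nat -> R) (e : nat -> H) k (Lam : R) :
  (Lam%:E <= lambda_ess (op_H h))%E ->
  (forall i j, (i < k)%N -> (j < k)%N -> ip H (e i) (e j) = (i == j)%:R) ->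
  (forall i, (i < k)%N -> weak_eigenpair (fun=> True) (lam i.+1) (e i)) ->
  (forall t x, t < Lam -> weak_eigenpair (fun=> True) t x ->
        (forall i, (i < k)%N -> ip H x (e i) = 0) -> x = 0) ->
  forall u, fdom u -> (forall i, (i < k)%N -> ip H u (e i) = 0) ->
    Lam * qf (ip H) u <= qf h u.
Proof.
move=> Less eo eE noev u hu ue.
pose f (i : 'I_k) := e i.
have fo : ortho_normal (ip H) f by move=> i j; apply: eo.
have hf i : fdom (f i) by case: (eE i (ltn_ord i)).
pose Y : set H := [set f i | i in setT].
have perpY v : perp h Y v <-> fdom v /\ forall i, ip H v (f i) = 0.
  split=> [[hv vY]|[hv vf]]; first by split=> // i; apply: vY; exists i.
  by split=> // _ [i _ <-].
apply: (form_ge_below_ess (Y := Y) Less) => [v hv|t x tL tx /perpY[hx xf]|]; last first.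
- by apply/perpY; split=> // i; apply: ue.
- apply: (noev t) => // [|i ik]; first by apply/eigenspaceP.
  exact: (xf (Ordinal ik)).
pose a := lincomb f (fun i => ip H v (f i)).
have ha : fdom a by apply: (span_sub hf); exact: span_mem.
exists a => //; split.
  apply/perpY; split=> [|i]; first exact: subB.
  by rewrite (hBl iH) // (ortho_normal_coef iH) ?subrr.
move=> w /perpY[hw wf]; split.
  by rewrite (h_lincombr iH) // big1 // => i _; rewrite wf mulr0.
rewrite (h_lincombr (form_herm h)) // big1 // => i _.
have [_ _ fP] := eE i (ltn_ord i).
rewrite (hC (form_herm h)) // fP // (hC iH (u := f i)) // wf rmorph0 mulr0 rmorph0.
by rewrite mulr0.
Qed.

End LowestEigenvalues.

(** * The coupling operator and the numbers eta *)

Section TestSubspace.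
Variables (R : realType) (s : scalars) (H : hilbert R s) (h : posdef_form H).
Variables (P : {linear H -> H}) (n : nat).
Hypothesis hP : test_projection h P n.
Local Notation fdom := (fdom h).
Local Notation Vp := (perp h (range P)).

Let iH := @ip_herm R s H (full H).
Let fH := form_herm h.
Let fp := @form_pos _ _ _ h.
Let f0 := pos_nonneg fH fp.

Lemma projK u : P (P u) = P u. Proof. by have [[]] := hP. Qed.

Lemma proj_sym u v : ip H (P u) v = ip H u (P v).
Proof. by have [[]] := hP. Qed.

Lemma proj_range u : range P (P u). Proof. by exists u. Qed.

Lemma rangeP u : range P u <-> P u = u.
Proof. by split=> [[v _ <-]|<-]; [exact: projK|exact: proj_range]. Qed.

Lemma range_fdom u : range P u -> fdom u.
Proof. by have [_ _ hu] := hP; exact: hu. Qed.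

Lemma proj_fdom u : fdom (P u). Proof. exact/range_fdom/proj_range. Qed.

Lemma perp_range u : Vp u <-> fdom u /\ P u = 0.
Proof.
split=> [[hu uP]|[hu Pu]].
  split=> //; apply: (pos_eq0 (@ip_pos _ _ _ (full H))) => //.
  by rewrite /qf proj_sym projK uP ?re0 //; exact: proj_range.
by split=> // _ [v _ <-]; rewrite -proj_sym Pu (h0l iH).
Qed.

Lemma perp_orth u a : Vp u -> range P a -> ip H a u = 0.
Proof. by move=> [_ uP] Pa; rewrite (hC iH) // uP // rmorph0. Qed.

Lemma Pperp_perp u : fdom u -> Vp (Pperp P u).
Proof.
move=> hu; apply/perp_range; split; last by rewrite raddfB /= projK subrr.
by apply: (@subB _ _ fdom) => //; exact: proj_fdom.
Qed.

Lemma proj_decomp u : u = P u + Pperp P u.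
Proof. by rewrite /Pperp addrC subrK. Qed.

Lemma range0 : range P 0. Proof. by exists 0; rewrite ?raddf0. Qed.

Lemma range_lin a u v : range P u -> range P v -> range P (a *: u + v).
Proof. by move=> [x _ <-] [y _ <-]; exists (a *: x + y); rewrite ?linearP. Qed.

Definition range_subspace : subspace H := Subspace range0 range_lin.

(** Z a is the h-orthogonal projection of a to the form domain of W; on
range P it represents the off-diagonal block of the form. *)
Lemma ex_coupling : exists Z : H -> H,
  (forall a, fdom a -> Vp (Z a)) /\
  (forall a v, fdom a -> Vp v -> h (Z a) v = h a v).
Proof.
have ex a : exists z, fdom a -> Vp z /\ forall v, Vp v -> h z v = h a v.
  have [ha|nha] := pselect (fdom a); last by exists 0.
  by have [z] := ex_form_projection (range P) ha; exists z.
have [Z ZP] := choice ex.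
by exists Z; split=> [a /ZP[]//|a v /ZP[_]]; apply.
Qed.

Section Coupling.
Variable Z : H -> H.
Hypotheses (ZV : forall a, fdom a -> Vp (Z a)).
Hypotheses (ZP : forall a v, fdom a -> Vp v -> h (Z a) v = h a v).

Let hZ a : fdom a -> fdom (Z a). Proof. by move=> ha; exact: perp_dom (ZV ha). Qed.

Lemma coupling_linear a u v : fdom u -> fdom v ->
  Z (a *: u + v) = a *: Z u + Z v.
Proof.
move=> hu hv; have huv : fdom (a *: u + v) by exact: (@subP _ _ fdom).
have V1 := ZV huv; have V2 : Vp (a *: Z u + Z v) by apply: subP; exact: ZV.
apply: (h_eq (perp_herm h (range P)) (@perp_pos _ _ _ h (range P))) => // w Vw.
have hw := perp_dom Vw; have hZu := hZ hu; have hZv := hZ hv.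
by rewrite (hLl fH) // !ZP // (hLl fH).
Qed.

Definition coupling_form u v := h (Z u) (Z v).

Lemma coupling_herm : herm fdom coupling_form.
Proof.
split=> [a u v w hu hv hw|u v hu hv]; last by apply: (hC fH); exact: hZ.
by rewrite /coupling_form coupling_linear // (hLl fH) //; exact: hZ.
Qed.

(** Pythagoras for the h-orthogonal projection Z. *)
Lemma coupling_gap a : fdom a -> qf h (a - Z a) = qf h a - qf h (Z a).
Proof.
move=> ha; rewrite (qB fH) //; last exact: hZ.
rewrite -(ZP ha (ZV ha)) -/(qf h (Z a)); ring.
Qed.

Lemma coupling_le a : fdom a -> qf h (Z a) <= qf h a.
Proof.
move=> ha; rewrite -subr_ge0 -coupling_gap // f0 //.
by apply: subB => //; exact: hZ.
Qed.

(** Equality forces a = Z a, which P sends to a and to 0. *)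
Lemma coupling_lt a : range P a -> a != 0 -> qf h (Z a) < qf h a.
Proof.
move=> Pa a0; have ha := range_fdom Pa.
rewrite -subr_gt0 -coupling_gap // fp //; first by apply: subB => //; exact: hZ.
apply: contra_neq a0 => aZ.
have [_ PZ] := (perp_range _).1 (ZV ha).
by rewrite -((rangeP a).1 Pa) -[LHS]subr0 -PZ -raddfB aZ raddf0.
Qed.

End Coupling.

End TestSubspace.

Section Eta.
Variables (R : realType) (s : scalars) (H : hilbert R s) (h : posdef_form H).
Variables (P : {linear H -> H}) (m : nat).
Hypothesis hP : test_projection h P m.+1.
Local Notation K := (scalar R s).
Local Notation "a %:K" := (of_real R s a) (at level 2, format "a %:K").
Local Notation conj := (scalar_conj R s).
Local Notation fdom := (fdom h).
Local Notation Vp := (perp h (range P)).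

Let iH := @ip_herm R s H (full H).
Let fH := form_herm h.
Let fp := @form_pos _ _ _ h.
Let f0 := pos_nonneg fH fp.

Variable Z : H -> H.
Hypotheses (ZV : forall a, fdom a -> Vp (Z a)).
Hypotheses (ZP : forall a v, fdom a -> Vp v -> h (Z a) v = h a v).

(** The f_i are right singular vectors of Z for the inner product h, with
singular values sqrt (x_i). *)
Lemma ex_coupling_basis : exists f : 'I_m.+1 -> H, exists x : 'I_m.+1 -> R,
  [/\ forall u, range P u <-> span f u, ortho_normal h f,
      forall i j, h (Z (f i)) (Z (f j)) = (x i * (i == j)%:R)%:K,
      forall i j : 'I_m.+1, (i <= j)%N -> x i <= x j &
      forall i, 0 <= x i < 1].
Proof.
have [_ [e [efree Pe]] _] := hP.
have Pe' u : range P u <-> span e u by rewrite Pe.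
have se u : span e u -> fdom u by move=> /Pe'; exact: (range_fdom hP).
have eH := herm_sub se fH; have ep : pos (span e) h by move=> u /se; exact: fp.
have tH := herm_sub se (coupling_herm ZV ZP).
have t0 : nonneg (span e) (coupling_form h Z).
  by move=> u /se hu; apply: f0; exact: perp_dom (ZV hu).
have tb u : span e u -> qf (coupling_form h Z) u <= qf h u.
  by move=> /se; exact: (coupling_le ZV ZP).
have [f [x [fe fo ft xm]]] := simultaneous_diagonalisation efree eH tH ep t0 tb.
exists f, x; split=> // [u|i].
  rewrite Pe'; split=> [eu|]; last exact: (span_sub fe).
  rewrite (ortho_normal_complete eH (span_gen e) fe fo eu); exact: span_mem.
have xE : x i = qf (coupling_form h Z) (f i).
  by rewrite /qf ft eqxx mulr1 re_of_real.
have fi0 : f i != 0.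
  apply/eqP => fi; have := fo i i; rewrite fi (h0l fH) ?eqxx; last exact: sub0.
  by move/eqP; rewrite eq_sym oner_eq0.
have qf : qf h (f i) = 1 by rewrite /qf fo eqxx re1.
rewrite xE; apply/andP; split; first by apply: t0; exact: fe.
by rewrite -qf; apply: (coupling_lt hP ZV ZP) => //; apply/Pe'/fe.
Qed.

Variables (f : 'I_m.+1 -> H) (x : 'I_m.+1 -> R).
Hypothesis fP : forall u, range P u <-> span f u.
Hypothesis fo : ortho_normal h f.
Hypothesis fZ : forall i j, h (Z (f i)) (Z (f j)) = (x i * (i == j)%:R)%:K.
Hypothesis xm : forall i j : 'I_m.+1, (i <= j)%N -> x i <= x j.
Hypothesis x01 : forall i, 0 <= x i < 1.

Let Pf i : range P (f i). Proof. exact/fP/span_gen. Qed.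
Let hf i : fdom (f i). Proof. exact: (range_fdom hP). Qed.
Let Zf i : Vp (Z (f i)). Proof. exact: ZV. Qed.
Let x1 i : 0 < 1 - x i. Proof. by rewrite subr_gt0; case/andP: (x01 i). Qed.

Lemma coupling_basis_coef u : range P u -> u = lincomb f (fun i => h u (f i)).
Proof. by move=> /fP; apply: (ortho_normal_complete fH hf (span_gen f) fo). Qed.

Lemma coupling_bound a : range P a -> qf h (Z a) <= x ord_max * qf h a.
Proof.
move=> Pa; have ha := range_fdom hP Pa.
rewrite {1 2}(coupling_basis_coef Pa).
rewrite (q_ortho_normal fH _ hf fo).
have -> : qf h (Z (lincomb f (fun i => h a (f i)))) =
    qf (coupling_form h Z) (lincomb f (fun i => h a (f i))) by [].
rewrite (q_diag (coupling_herm ZV ZP) _ hf fZ) mulr_sumr ler_sum // => i _.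
by rewrite mulrC ler_wpM2r ?sqn_ge0 // xm // -ltnS.
Qed.

Lemma op_apply_eq (A : operator H) u v : A (u, v) ->
  (forall w, A (u, w) -> w = v) -> op_apply A u = v.
Proof.
move=> Auv uniq; apply: uniq.
by have := @xgetPex _ 0 [set w | A (u, w)] (ex_intro _ v Auv).
Qed.

(** The vectors f_i - Z f_i are h-orthogonal to the form domain of W and, up
to the factors 1 - x_i, h-biorthogonal to f; so their combinations solve H u = psi
when psi is in range P. *)
Lemma op_H_inv psi : range P psi ->
  op_apply (op_inv (op_H h)) psi =
  lincomb (fun i => f i - Z (f i)) (fun i => ip H psi (f i) / (1 - x i)%:K).
Proof.
move=> Ppsi; pose c i := ip H psi (f i).
pose g i := f i - Z (f i); have hg i : fdom (g i).
  by apply: subB => //; exact: perp_dom (Zf i).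
have hu a : fdom (lincomb g a) by apply: (span_sub hg); exact: span_mem.
have gperp i w : Vp w -> h (g i) w = 0.
  move=> Vw; have hw := perp_dom Vw; have hZf := perp_dom (Zf i).
  by rewrite (hBl fH) // ZP // subrr.
have gf i j : h (g i) (f j) = (1 - x i)%:K * (i == j)%:R.
  have hZi := perp_dom (Zf i); have hZj := perp_dom (Zf j).
  rewrite (hBl fH) // fo; have -> : h (Z (f i)) (f j) = h (Z (f i)) (Z (f j)).
    by rewrite (hC fH) // -ZP // -(hC fH).
  by rewrite fZ rmorphM rmorph_nat rmorphB rmorph1 mulrBl mul1r.
have uP v : fdom v -> h (lincomb g (fun i => c i / (1 - x i)%:K)) v = ip H psi v.
  move=> hv; have hPv := proj_fdom hP v.
  have -> : h (lincomb g (fun i => c i / (1 - x i)%:K)) v =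
      h (lincomb g (fun i => c i / (1 - x i)%:K)) (P v).
    have Vv := Pperp_perp hP hv; have hVv := perp_dom Vv.
    rewrite {1}(proj_decomp P v) (hDr fH) //.
    rewrite [X in _ + X](h_lincombl fH) // [X in _ + X]big1 ?addr0 // => i _.
    by rewrite gperp ?mulr0.
  have -> : ip H psi v = ip H psi (P v).
    by rewrite -(proj_sym hP) ((rangeP hP psi).1 Ppsi).
  rewrite (coupling_basis_coef (proj_range P v)).
  rewrite (h_lincombr fH) // (h_lincombr iH) //.
  apply: eq_bigr => j _; congr (_ * _); rewrite (h_lincombl fH) //.
  rewrite (bigD1 j) //= big1 ?addr0 => [|i /negPf ij].
    by rewrite gf eqxx mulr1 divfK // fmorph_eq0 gt_eqF.
  by rewrite gf ij !mulr0.
apply: op_apply_eq => [|w [/= hw [_ wP]]].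
  by split; [exact: hu|split; [|exact: uP]].
apply: (h_eq fH fp hw (hu _)) => v hv.
by rewrite wP // uP.
Qed.

(** The form of H_P couples range P to nothing else, and on range P the
h-orthonormal basis f gives the solution. *)
Lemma op_HP_inv psi : range P psi ->
  op_apply (op_inv (op_HP h P)) psi = lincomb f (fun i => ip H psi (f i)).
Proof.
move=> Ppsi; set p := lincomb f _.
have hp : fdom p by apply: (span_sub hf); exact: span_mem.
have Pp : P p = p by apply/(rangeP hP)/fP/span_mem.
have pP v : fdom v -> h p (P v) = ip H psi v.
  move=> hv; rewrite -((rangeP hP psi).1 Ppsi) (proj_sym hP).
  rewrite (coupling_basis_coef (proj_range P v)).
  rewrite (h_lincombr fH) // (h_lincombr iH) //; apply: eq_bigr => j _.
  by rewrite /p (ortho_normal_coef fH).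
apply: op_apply_eq => [|w [/= hw [_ wP]]].
  split=> //; split=> // v hv /=.
  by rewrite /Pperp Pp subrr (h0l fH) ?addr0 ?pP //; exact: perp_dom (Pperp_perp hP hv).
apply/eqP; rewrite -subr_eq0; apply/eqP; set d := w - p.
have hd : fdom d by apply: subB.
have hPd := proj_fdom hP d; have hQd := perp_dom (Pperp_perp hP hd).
have hPw := proj_fdom hP w; have hQw := perp_dom (Pperp_perp hP hw).
have QE : Pperp P d = Pperp P w by rewrite /Pperp /d raddfB /= Pp opprB addrA subrK.
have : qf h (P d) + qf h (Pperp P d) = 0.
  have Pd : P d = P w - p by rewrite raddfB /= Pp.
  have e1 : h (P d) (P d) = h (P w) (P d) - ip H psi d.
    by rewrite {1}Pd (hBl fH) // pP.
  have e2 : h (Pperp P d) (Pperp P d) = h (Pperp P w) (Pperp P d) by rewrite {1}QE.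
  by rewrite /qf -reD e1 e2 addrAC wP // subrr re0.
have := f0 hPd; have := f0 hQd => h1 h2 h12.
rewrite (proj_decomp P d) (pos_eq0 fp hPd) ?add0r; last by lra.
by rewrite (pos_eq0 fp hQd) //; lra.
Qed.

(** An average of the x_i with weights |(psi, f_i)|^2 / (1 - x_i): the
explicit inverses turn the quotient in the definition of eta into a Rayleigh
quotient with eigenvalues x_i. *)
Lemma eta_ratioE psi (A := fun i => sqn (ip H psi (f i)) / (1 - x i)) :
  range P psi -> eta_ratio h P psi = (\sum_i x i * A i) / \sum_i A i.
Proof.
move=> Ppsi; rewrite /eta_ratio op_H_inv // op_HP_inv //.
have -> : rip psi (lincomb (fun i => f i - Z (f i))
    (fun i => ip H psi (f i) / (1 - x i)%:K)) = \sum_i A i.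
  rewrite /rip (h_lincombr iH) // re_sum; apply: eq_bigr => i _.
  rewrite (hBr iH) // (perp_orth (Zf i) Ppsi) subr0 rmorphM /=.
  rewrite -fmorphV conj_of_real mulrAC [conj _ * _]mulrC mul_conj -rmorphM.
  by rewrite re_of_real.
have -> : rip psi (lincomb f (fun i => ip H psi (f i))) =
    \sum_i (1 - x i) * A i.
  rewrite /rip (h_lincombr iH) // re_sum; apply: eq_bigr => i _.
  by rewrite mulrC mul_conj re_of_real /A mulrC divfK // gt_eqF.
congr (_ / _); rewrite -sumrB; apply: eq_bigr => i _; ring.
Qed.

Let A_ge0 psi i : 0 <= sqn (ip H psi (f i)) / (1 - x i).
Proof. by rewrite divr_ge0 ?sqn_ge0 // ltW. Qed.

Let A_gt0 psi : range P psi -> psi != 0 ->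
  0 < \sum_i sqn (ip H psi (f i)) / (1 - x i).
Proof.
move=> Ppsi psi0; rewrite lt_def sumr_ge0 ?andbT => [|i _]; last exact: A_ge0.
apply: contra_neq psi0 => /psumr_eq0P A0.
apply: (pos_eq0 (@ip_pos _ _ _ (full H))) => //.
rewrite /qf {2}(coupling_basis_coef Ppsi) (h_lincombr iH) // big1 ?re0 // => i _.
have /eqP := A0 (fun i _ => A_ge0 psi i) i isT.
rewrite mulf_eq0 sqn_eq0 invr_eq0 (gt_eqF (x1 i)) orbF => /eqP ->.
by rewrite mulr0.
Qed.

Lemma eta_ratio_le psi : range P psi -> psi != 0 -> eta_ratio h P psi <= x ord_max.
Proof.
move=> Ppsi psi0; rewrite eta_ratioE // ler_pdivrMr ?A_gt0 // mulr_sumr.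
by apply: ler_sum => i _; rewrite ler_wpM2r ?A_ge0 // xm // -ltnS.
Qed.

Lemma eta_ratio_ge psi (i : 'I_m.+1) : range P psi -> psi != 0 ->
  (forall j : 'I_m.+1, (j < i)%N -> ip H psi (f j) = 0) ->
  x i <= eta_ratio h P psi.
Proof.
move=> Ppsi psi0 psij; rewrite eta_ratioE // ler_pdivlMr ?A_gt0 // mulr_sumr.
apply: ler_sum => j _; have [ji|ij] := ltnP j i.
  by rewrite psij // sqn0 mul0r !mulr0.
by rewrite ler_wpM2r ?A_ge0 // xm.
Qed.

Let unit_neq0 (u : H) : rnorm u = 1 -> u != 0.
Proof.
move=> u1; apply/eqP => u0; move: u1 (q_ip u); rewrite u0 (q0 iH) => ->.
by rewrite expr1n => /eqP; rewrite eq_sym oner_eq0.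
Qed.

Let ratios (S : set H) := [set eta_ratio h P psi | psi in [set u | S u /\ rnorm u = 1]].

Let ratios_lb S : S `<=` range P -> lbound (ratios S) 0.
Proof.
move=> SP _ [u [Su u1] <-].
have x0 : 0 <= x ord0 by case/andP: (x01 ord0).
by apply: le_trans x0 _; apply: eta_ratio_ge; [exact: SP|exact: unit_neq0|].
Qed.

Let ratios_ne S k : has_dim S k.+1 -> ratios S !=set0.
Proof.
move=> /has_dim_ortho_normal[e eo Se]; exists (eta_ratio h P (e ord0)).
exists (e ord0) => //; split; first by apply/Se/span_gen.
have := q_ip (e ord0); rewrite /qf eo eqxx re1 => /esym/eqP.
rewrite sqrf_eq1 => /orP[/eqP //|/eqP e1].
by have := rnorm_ge0 (e ord0); rewrite e1 ler0N1.
Qed.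

(** For the lower bound the maximum is tested on the span of the vectors dual
to f_i, ..., f_m, where the average involves x_i, ..., x_m only. *)
Lemma eta_bounds (i : 'I_m.+1) : Num.sqrt (x i) <= eta h P m.+1 i.+1 <=
  Num.sqrt (x ord_max).
Proof.
set E := [set y | exists S : set H, [/\ S `<=` range P,
  has_dim S (m.+1 - i.+1).+1 & y = inf (ratios S)]].
have Eub : ubound E (x ord_max).
  move=> _ [S [SP Sdim ->]]; have [y [u [Su u1] _]] := ratios_ne Sdim.
  apply: le_trans (_ : eta_ratio h P u <= _).
    by apply: ge_inf; [exists 0; exact: ratios_lb|exists u].
  by apply: eta_ratio_le; [exact: SP|exact: unit_neq0].
have [g [gf gE]] := dual_family (ortho_normal_free fH hf fo) (ip_herm (span f))
  (@ip_pos _ _ _ (span f)).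
have gE' j k : ip H (g j) (f k) = (j == k)%:R.
  by rewrite (hC iH) // gE rmorph_nat eq_sym.
pose G (k : 'I_(m.+1 - i.+1).+1) := g (inord (i + k)).
have ik (k : 'I_(m.+1 - i.+1).+1) : (i + k < m.+1)%N.
  have := ltn_ord k; have := ltn_ord i; move: (nat_of_ord i) (nat_of_ord k).
  by move=> i' k'; lia.
have Gf k (j : 'I_m.+1) : ip H (G k) (f j) = (i + k == j)%N%:R.
  by rewrite gE' -val_eqE /= inordK.
have PG k : range P (G k) by apply/fP/gf.
have Gfree : free_family G.
  move=> c cG k; have : ip H (lincomb G c) (f (inord (i + k))) = c k.
    rewrite (h_lincombl iH) // (bigD1 k) //= Gf inordK // eqxx mulr1.
    rewrite big1 ?addr0 // => j jk; rewrite Gf inordK // eqn_add2l.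
    by rewrite val_eqE (negPf jk) mulr0.
  by rewrite cG (h0l iH) // => <-.
have GP u : span G u -> range P u.
  by move=> /(span_sub (V := range_subspace P)); apply; exact: PG.
have ES : E (inf (ratios (span G))).
  by exists (span G); split=> //; exists G; split.
have ix : x i <= inf (ratios (span G)).
  apply: lb_le_inf; first by apply: (@ratios_ne _ (m.+1 - i.+1)); exists G; split.
  move=> _ [u [Gu u1] <-]; apply: eta_ratio_ge; [exact: GP|exact: unit_neq0|].
  move=> j ji; case: Gu => c _ <-; rewrite (h_lincombl iH) // big1 // => k _.
  by rewrite Gf gtn_eqF ?mulr0 // ltn_addr.
have Esup : has_sup E by split; [exists (inf (ratios (span G)))|exists (x ord_max)].
apply/andP; split; rewrite /eta -/E; apply: ler_wsqrtr.
  by apply: le_trans ix _; apply: ub_le_sup => //; case: Esup.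
by apply: ge_sup => //; case: Esup.
Qed.

Lemma eta_last : eta h P m.+1 m.+1 = Num.sqrt (x ord_max).
Proof. by apply/eqP; rewrite eq_le andbC; exact: (eta_bounds ord_max). Qed.

End Eta.

(** * Perturbation of the block-diagonal form *)

Section Perturbation.
Variables (R : realType) (s : scalars) (H : hilbert R s) (h : posdef_form H).
Variables (P : {linear H -> H}) (m : nat).
Hypothesis hP : test_projection h P m.
Local Notation K := (scalar R s).
Local Notation "a %:K" := (of_real R s a) (at level 2, format "a %:K").
Local Notation conj := (scalar_conj R s).
Local Notation re := (@real_part R s).
Local Notation fdom := (fdom h).
Local Notation Vp := (perp h (range P)).

Let iH := @ip_herm R s H (full H).
Let i0 := @ip_nonneg R s H (full H).
Let ipp := @ip_pos R s H (full H).
Let fH := form_herm h.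
Let fp := @form_pos _ _ _ h.
Let f0 := pos_nonneg fH fp.

(* Z is the coupling operator, sg a bound for its norm, later eta_m, and mu1
   and mum enclose the Ritz values. *)
Variables (Z : H -> H) (sg mu1 mum : R).
Hypotheses (ZV : forall a, fdom a -> Vp (Z a)).
Hypotheses (ZP : forall a v, fdom a -> Vp v -> h (Z a) v = h a v).
Hypotheses (sg01 : 0 <= sg < 1).
Hypothesis Zsg : forall a, range P a -> qf h (Z a) <= sg ^+ 2 * qf h a.
Hypothesis mu_le : forall a, range P a -> qf h a <= mum * qf (ip H) a.
Hypothesis mu_ge : forall a, range P a -> mu1 * qf (ip H) a <= qf h a.

Lemma q_ip_decomp a b : range P a -> Vp b ->
  qf (ip H) (a + b) = qf (ip H) a + qf (ip H) b.
Proof.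
by move=> Pa Vb; rewrite (qD iH) // (perp_orth Vb Pa) re0 mulr0 addr0.
Qed.

(** The left-hand side is the cross term 2 re h(Z a, b), which Cauchy-Schwarz
and |Z a| <= sg |a| for the norm of h bound by the right-hand side. *)
Lemma form_two_sided a b : range P a -> Vp b ->
  `|qf h (a + b) - (qf h a + qf h b)| <= sg * (qf h a + qf h b).
Proof.
move=> Pa Vb; have ha := range_fdom hP Pa; have hb := perp_dom Vb.
have hZ := perp_dom (ZV ha).
rewrite (qD fH) // -(ZP ha Vb).
have -> : qf h a + 2 * re (h (Z a) b) + qf h b - (qf h a + qf h b) =
  2 * re (h (Z a) b) by ring.
have qa := f0 ha; have qb := f0 hb.
have [sg0 sg1] := andP sg01.
have rhs0 : 0 <= sg * (qf h a + qf h b) by rewrite mulr_ge0 // addr_ge0.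
rewrite -[leRHS]ger0_norm // -ler_sqr ?nnegrE // !real_normK ?num_real //.
have h1 := re_cauchy_schwarz fH f0 hZ hb.
have h2 : qf h (Z a) * qf h b <= sg ^+ 2 * qf h a * qf h b by rewrite ler_wpM2r ?Zsg.
have h3 : 0 <= sg ^+ 2 * (qf h a - qf h b) ^+ 2 by rewrite mulr_ge0 ?sqr_ge0.
have -> : (2 * re (h (Z a) b)) ^+ 2 = 4 * re (h (Z a) b) ^+ 2 by ring.
have -> : (sg * (qf h a + qf h b)) ^+ 2 =
  sg ^+ 2 * (qf h a - qf h b) ^+ 2 + 4 * (sg ^+ 2 * qf h a * qf h b) by ring.
lra.
Qed.

(** On the span of e the block-diagonal form is at most c / (1 - sg), while
on range P it is at least mu1, which is larger. So no vector of the span lies in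
range P, and dropping the component in range P, whose quotient is above the
bound, preserves the bound. *)
Lemma compress_low_subspace k (e : 'I_k -> H) c :
  free_family e -> (forall i, fdom (e i)) -> 0 <= c -> c < (1 - sg) * mu1 ->
  (forall u, span e u -> qf h u <= c * qf (ip H) u) ->
  exists F : 'I_k -> H, [/\ free_family F, forall i, Vp (F i) &
    forall u, span F u -> qf h u <= c / (1 - sg) * qf (ip H) u].
Proof.
move=> efree he c0 cmu ec; have [sg0 sg1] := andP sg01.
have s1 : 0 < 1 - sg by lra.
have cmu1 : c / (1 - sg) < mu1 by rewrite ltr_pdivrMr // mulrC.
have c10 : 0 <= c / (1 - sg) by rewrite divr_ge0 // ltW.
have key u : span e u -> qf h (P u) + qf h (Pperp P u) <=
    c / (1 - sg) * (qf (ip H) (P u) + qf (ip H) (Pperp P u)).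
  move=> eu; have hu : fdom u by apply: (span_sub he).
  have Vu := Pperp_perp hP hu; have Pu := proj_range P u.
  have := form_two_sided Pu Vu; rewrite -proj_decomp ler_norml => /andP[h1 _].
  have := ec u eu; rewrite {2}(proj_decomp P u) q_ip_decomp // => h2.
  by rewrite mulrAC ler_pdivlMr //; lra.
pose F i := Pperp P (e i).
have FE a : lincomb F a = Pperp P (lincomb e a).
  rewrite /F /Pperp /lincomb linear_sum -sumrB; apply: eq_bigr => i _.
  by rewrite scalerBr; congr (_ - _); rewrite linearZ_LR.
exists F; split=> [a|i|_ [a _ <-]].
- rewrite FE => Qa; apply: efree.
  have eu := span_mem e a; have := key _ eu; set u := lincomb e a in Qa eu *.
  rewrite Qa (q0 fH) (q0 iH) !addr0 => h1.
  have := mu_ge (proj_range P u); have := i0 (I : full H (P u)) => h2 h3.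
  rewrite (proj_decomp P u) Qa addr0; apply: (pos_eq0 ipp) => //.
  apply/eqP; rewrite eq_le h2 andbT.
  have : 0 <= (c / (1 - sg) - mu1) * qf (ip H) (P u) by rewrite mulrBl; lra.
  by rewrite nmulr_rge0 //; lra.
- by apply: (Pperp_perp hP).
have := key _ (span_mem e a); rewrite FE; set u := lincomb e a => h1.
have := mu_ge (proj_range P u); have := i0 (I : full H (P u)) => h2 h3.
have : c / (1 - sg) * qf (ip H) (P u) <= mu1 * qf (ip H) (P u).
  by rewrite ler_wpM2r // ltW.
lra.
Qed.

(** On range P plus a low subspace of W the block-diagonal form is at most
the maximum of the two bounds, and passing to h costs a factor 1 + sg. *)
Lemma extend_by_range p (F : 'I_p -> H) c : free_family F ->
  (forall i, Vp (F i)) ->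
  (forall u, span F u -> qf h u <= c * qf (ip H) u) ->
  exists2 G : 'I_(m + p) -> H, free_family G & forall u, span G u -> fdom u /\
    qf h u <= (1 + sg) * Num.max mum c * qf (ip H) u.
Proof.
move=> Ffree FV Fc; have [_ [f [ffree Pf]] _] := hP.
have [sg0 sg1] := andP sg01.
pose G (i : 'I_(m + p)) := match fintype.split i with inl a => f a | inr b => F b end.
have Pf' a : range P (lincomb f a) by rewrite Pf; exists a.
have VF a : Vp (lincomb F a) by apply: (span_sub FV); exact: span_mem.
have GE a : lincomb G a = lincomb f (fun i => a (lshift p i)) +
    lincomb F (fun i => a (rshift m i)).
  rewrite {1}/lincomb big_split_ord /=; congr (_ + _); apply: eq_bigr => i _.
    by rewrite /G (unsplitK (inl _ : _ + _)%type).
  by rewrite /G (unsplitK (inr _ : _ + _)%type).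
exists G => [a|_ [a _ <-]].
  rewrite GE => fF0.
  have F0 : lincomb F (fun i => a (rshift m i)) = 0.
    have := congr1 P fF0; rewrite raddfD raddf0 /=.
    rewrite ((rangeP hP _).1 (Pf' _)) (((perp_range hP _).1 (VF _)).2) addr0 => f0'.
    by move: fF0; rewrite f0' add0r.
  have f0' : lincomb f (fun i => a (lshift p i)) = 0.
    by move: fF0; rewrite F0 addr0.
  by move=> i; rewrite -(splitK i); case: (fintype.split i) => j /=;
    [exact: (ffree _ f0')|exact: (Ffree _ F0)].
rewrite GE; set u := lincomb f _; set v := lincomb F _.
have Pu : range P u by exact: Pf'.
have Vv : Vp v by exact: VF.
have hu := range_fdom hP Pu; have hv := perp_dom Vv.
split; first by apply: subD.
have := form_two_sided Pu Vv; rewrite ler_norml => /andP[_ h1].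
rewrite q_ip_decomp //; have h2 := mu_le Pu; have h3 := Fc v (span_mem _ _).
have u0 := i0 (I : full H u); have v0 := i0 (I : full H v).
have h4 : qf h u + qf h v <= Num.max mum c * (qf (ip H) u + qf (ip H) v).
  rewrite mulrDr lerD //; [apply: le_trans h2 _|apply: le_trans h3 _];
  by rewrite ler_wpM2r // le_max lexx ?orbT.
rewrite -mulrA; apply: le_trans (_ : (1 + sg) * (qf h u + qf h v) <= _).
  by lra.
by rewrite ler_wpM2l //; lra.
Qed.

(** The span has dimension greater than k, so it contains a nonzero vector
orthogonal to k given ones. *)
Lemma minmax_upper p (F : 'I_p -> H) c k (e : nat -> H) Lam : free_family F ->
  (forall i, Vp (F i)) ->
  (forall u, span F u -> qf h u <= c * qf (ip H) u) -> (k < m + p)%N ->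
  (forall u, fdom u -> (forall i, (i < k)%N -> ip H u (e i) = 0) ->
    Lam * qf (ip H) u <= qf h u) ->
  Lam <= (1 + sg) * Num.max mum c.
Proof.
move=> Ffree FV Fc kmp LB.
have [G Gfree GP] := extend_by_range Ffree FV Fc.
have [u [Gu un ue]] := ex_orthogonal_in_span (fun i : 'I_k => e i) kmp Gfree.
have [hu uc] := GP u Gu.
have := le_trans (LB u hu (fun i ik => ue (Ordinal ik))) uc.
by rewrite ler_pM2r // ipp.
Qed.

(** The form h - c' is definite on the span of F, hence has an invertible Gram
matrix there, and so a projection to the span along the orthogonal complement
exists although h - c' is indefinite. *)
Lemma indefinite_decomposition p (F : 'I_p -> H) c c' : free_family F ->
  (forall i, Vp (F i)) -> c < c' ->
  (forall u, span F u -> qf h u <= c * qf (ip H) u) ->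
  forall u, Vp u -> exists y z, [/\ u = y + z, span F y, Vp z &
    forall w, span F w -> h z w = c'%:K * ip H z w].
Proof.
move=> Ffree FV cc Fc u Vu.
pose a v w := h v w - c'%:K * ip H v w.
have FVs w : span F w -> Vp w by exact: span_sub.
have hF w : span F w -> fdom w by move=> /FVs /perp_dom.
have ad v w z : fdom v -> fdom w -> fdom z -> a (v - w) z = a v z - a w z.
  by move=> hv hw hz; rewrite /a (hBl fH) // (hBl iH) //; ring.
have alin c0 w : fdom w -> a (lincomb F c0) w = \sum_i c0 i * a (F i) w.
  move=> hw; have hFi i : fdom (F i) := perp_dom (FV i).
  rewrite /a (h_lincombl fH) // (h_lincombl iH) // mulr_sumr -sumrB.
  by apply: eq_bigr => i _; rewrite mulrBr mulrCA.
have alinr c0 w : fdom w -> a w (lincomb F c0) = \sum_i conj (c0 i) * a w (F i).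
  move=> hw; have hFi i : fdom (F i) := perp_dom (FV i).
  rewrite /a (h_lincombr fH) // (h_lincombr iH) // mulr_sumr -sumrB.
  by apply: eq_bigr => i _; rewrite mulrBr mulrCA.
have nondeg c0 : (forall j, \sum_i c0 i * a (F i) (F j) = 0) -> forall i, c0 i = 0.
  move=> aF; apply: Ffree; apply: (pos_eq0 ipp) => //.
  set w := lincomb F c0; have Fw : span F w by exact: span_mem.
  have : a w w = 0.
    have := alinr c0 w (hF _ Fw); rewrite -/w => ->; apply: big1 => j _.
    have := alin c0 (F j) (perp_dom (FV j)); rewrite -/w => ->.
    by rewrite aF mulr0.
  have hw := hF _ Fw; rewrite /a (q_real fH) // (q_real iH) // -rmorphM -rmorphB.
  move/eqP; rewrite fmorph_eq0 => /eqP qa.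
  have := Fc w Fw; have := i0 (I : full H w) => h1 h2.
  apply/eqP; rewrite eq_le h1 andbT.
  have : 0 <= (c - c') * qf (ip H) w by rewrite mulrBl; lra.
  by rewrite nmulr_rge0 //; lra.
have [c0 c0P] := nondegenerate_system nondeg (fun j => a u (F j)).
have hu := perp_dom Vu.
have Fy := span_mem F c0; exists (lincomb F c0), (u - lincomb F c0).
split=> //; first by rewrite addrC subrK.
  by apply: subB => //; exact: FVs.
move=> w [d _ <-]; have hd := hF _ (span_mem F d); have hy := hF _ Fy.
have : a (u - lincomb F c0) (lincomb F d) = 0.
  rewrite ad // !alinr // -sumrB big1 // => i _.
  by rewrite alin ?c0P ?subrr //; exact: perp_dom (FV i).
by rewrite /a => /eqP; rewrite subr_eq0 => /eqP.
Qed.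

End Perturbation.

(** * The form away from the test subspace *)

Section Gap.
Variables (R : realType) (s : scalars) (H : hilbert R s) (h : posdef_form H).
Variables (P : {linear H -> H}) (m : nat).
Hypothesis hP : test_projection h P m.
Local Notation K := (scalar R s).
Local Notation "a %:K" := (of_real R s a) (at level 2, format "a %:K").
Local Notation re := (@real_part R s).
Local Notation fdom := (fdom h).
Local Notation Vp := (perp h (range P)).

Let iH := @ip_herm R s H (full H).
Let i0 := @ip_nonneg R s H (full H).
Let fH := form_herm h.
Let fp := @form_pos _ _ _ h.
Let f0 := pos_nonneg fH fp.
Let vH := perp_herm h (range P).
Let vp := @perp_pos _ _ _ h (range P).
Let v0 := pos_nonneg vH vp.

Variables (Z : H -> H) (sg mu1 mum : R).
Hypotheses (ZV : forall a, fdom a -> Vp (Z a)).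
Hypotheses (ZP : forall a v, fdom a -> Vp v -> h (Z a) v = h a v).
Hypotheses (sg01 : 0 <= sg < 1).
Hypothesis Zsg : forall a, range P a -> qf h (Z a) <= sg ^+ 2 * qf h a.
Hypothesis mu_le : forall a, range P a -> qf h a <= mum * qf (ip H) a.
Hypothesis mu_ge : forall a, range P a -> mu1 * qf (ip H) a <= qf h a.

(** If h - c' were negative at z, then F and z would span a space one
dimension larger on which h <= c', and min-max would push Lam below
(1 + sg) max (mum, c'). *)
Lemma complement_above p (F : 'I_p -> H) c c' k (e : nat -> H) Lam :
  free_family F -> (forall i, Vp (F i)) -> c < c' ->
  (forall u, span F u -> qf h u <= c * qf (ip H) u) -> (k <= m + p)%N ->
  (forall u, fdom u -> (forall i, (i < k)%N -> ip H u (e i) = 0) ->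
    Lam * qf (ip H) u <= qf h u) ->
  (1 + sg) * Num.max mum c' < Lam ->
  forall z, Vp z -> (forall w, span F w -> h z w = c'%:K * ip H z w) ->
    c' * qf (ip H) z <= qf h z.
Proof.
move=> Ffree FV cc Fc kmp LB cLam z Vz zF; rewrite leNgt; apply/negP => zneg.
have FVs w : span F w -> Vp w by exact: span_sub.
have hz := perp_dom Vz.
have zn : z != 0.
  by apply/eqP => z0; move: zneg; rewrite z0 (q0 fH) (q0 iH) mulr0 ltxx.
have qsplit a w : span F w -> qf h (w + a *: z) - c' * qf (ip H) (w + a *: z) =
    (qf h w - c' * qf (ip H) w) + sqn a * (qf h z - c' * qf (ip H) z).
  move=> Fw; have hw := perp_dom (FVs w Fw); have haz : fdom (a *: z) by exact: subZ.
  rewrite (qD fH) // (qD iH) // (qZ fH) // (qZ iH) //.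
  have -> : re (h w (a *: z)) = c' * re (ip H w (a *: z)).
    rewrite (hreC fH) // (hZl fH) // zF // mulrCA reZ -(hZl iH) //.
    by rewrite (hreC iH).
  by ring.
have qF w : span F w -> qf h w - c' * qf (ip H) w <= (c - c') * qf (ip H) w.
  by move=> Fw; have := Fc w Fw; rewrite mulrBl; lra.
have qF0 w : span F w -> qf h w - c' * qf (ip H) w <= 0.
  move=> Fw; apply: le_trans (qF w Fw) _; rewrite nmulr_rle0 ?i0 //; lra.
suff : Lam <= (1 + sg) * Num.max mum c' by rewrite leNgt cLam.
apply: (minmax_upper hP ZV ZP sg01 Zsg mu_le (F := snoc F z) (k := k) (e := e)) => //.
- move=> a; rewrite lincomb_snoc; set w := lincomb F _ => waz.
  have Fw : span F w by exact: span_mem.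
  have := qsplit (a ord_max) w Fw; rewrite waz (q0 fH) (q0 iH) mulr0 subr0.
  have h1 := qF0 w Fw.
  have h2 : sqn (a ord_max) * (qf h z - c' * qf (ip H) z) <= 0.
    by rewrite mulr_ge0_le0 ?sqn_ge0 //; lra.
  move=> h3; have am : a ord_max = 0.
    have /eqP : sqn (a ord_max) * (qf h z - c' * qf (ip H) z) = 0 by lra.
    by rewrite mulf_eq0 sqn_eq0 => /orP[/eqP //|/eqP h4]; exfalso; lra.
  have w0 : w = 0 by move: waz; rewrite am scale0r addr0.
  by move=> i; case: (unliftP ord_max i) => [j ->|->] //; exact: (Ffree _ w0).
- by move=> i; rewrite /snoc; case: unliftP => [j _|_].
- move=> _ [a _ <-]; rewrite lincomb_snoc; set w := lincomb F _.
  have Fw : span F w by exact: span_mem.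
  have := qsplit (a ord_max) w Fw; have h1 := qF0 w Fw.
  have h2 : sqn (a ord_max) * (qf h z - c' * qf (ip H) z) <= 0.
    by rewrite mulr_ge0_le0 ?sqn_ge0 //; lra.
  lra.
- by rewrite addnS ltnS.
Qed.

Variable G : H -> H.
Hypotheses (GV : forall f, Vp (G f)).
Hypotheses (GP : forall f v, Vp v -> h (G f) v = ip H f v).

(** Put a = h - L. The vector u = y + z is tested against z - y: the mixed
terms cancel in re a(y + z, z - y) = a[z] - a[y], and both a[z] and - a[y] are
positive. *)
Lemma bounded_below_of_split (L c L' : R) : 0 < c -> c < L -> L < L' ->
  (forall u, Vp u -> exists y z, [/\ u = y + z, Vp y, Vp z,
     qf h y <= c * qf (ip H) y & L' * qf (ip H) z <= qf h z]) ->
  bounded_below_on Vp h (fun u => u - L%:K *: G u).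
Proof.
move=> c0 cL LL' splitP.
pose d := Num.min (1 - L / L') (L / c - 1).
have d0 : 0 < d.
  by rewrite lt_min !subr_gt0 ltr_pdivrMr ?ltr_pdivlMr ?mul1r ?cL ?LL' //; lra.
exists (d ^+ 2 / 4) => [|u Vu]; first by rewrite divr_gt0 ?exprn_gt0.
have [y [z [uyz Vy Vz yc zL]]] := splitP u Vu.
set x := u - L%:K *: G u.
have Vx : Vp x by apply: subB => //; exact: subZ.
have Vzy : Vp (z - y) by exact: subB.
have hx v : Vp v -> h x v = h u v - L%:K * ip H u v.
  by move=> Vv; rewrite (hBl vH) ?(hZl vH) ?GP //; exact: subZ.
have hy := perp_dom Vy; have hz := perp_dom Vz.
have testE : re (h x (z - y)) =
    (qf h z - L * qf (ip H) z) + (L * qf (ip H) y - qf h y).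
  rewrite hx // reD reN reZ uyz.
  rewrite (hBr fH) ?(hDl fH) //; try exact: subD.
  rewrite (hBr iH) // !(hDl iH) // !(reD, reN) -!/(qf _ _).
  by rewrite (hreC fH hy hz) (hreC iH (I : full H y) (I : full H z)); ring.
have qz := f0 hz; have qy := f0 hy.
have h1 : d * qf h z <= qf h z - L * qf (ip H) z.
  have : d * qf h z <= (1 - L / L') * qf h z by rewrite ler_wpM2r // ge_min lexx.
  have L'0 : 0 < L' by lra.
  have : L * qf (ip H) z <= L / L' * qf h z.
    rewrite -mulrA ler_pM2l ?ler_pdivlMl //; lra.
  by rewrite mulrBl mul1r; lra.
have h2 : d * qf h y <= L * qf (ip H) y - qf h y.
  have : d * qf h y <= (L / c - 1) * qf h y.
    by rewrite ler_wpM2r // ge_min lexx orbT.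
  have : L / c * qf h y <= L * qf (ip H) y.
    by rewrite -mulrA ler_pM2l ?ler_pdivrMl //; lra.
  by rewrite mulrBl mul1r; lra.
have h3 := re_cauchy_schwarz vH v0 Vx Vzy.
have h4 : qf h (z - y) <= 2 * qf h z + 2 * qf h y.
  have := f0 (subD hz hy); rewrite (qD fH) // (qB fH) //; lra.
have h5 : qf h u <= 2 * qf h y + 2 * qf h z by rewrite uyz; apply: (q_sqD fH f0).
pose S := qf h z + qf h y; have S0 : 0 <= S by exact: addr_ge0.
have h6 : (d * S) ^+ 2 <= re (h x (z - y)) ^+ 2.
  have t0 : d * S <= re (h x (z - y)) by rewrite testE /S mulrDr; lra.
  have t1 : 0 <= d * S by apply: mulr_ge0 => //; exact: ltW.
  by rewrite ler_sqr ?nnegrE //; exact: le_trans t0.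
have h7 : qf h x * qf h (z - y) <= qf h x * (2 * S).
  by rewrite ler_wpM2l ?v0 // /S mulrDr.
have h8 : d ^+ 2 * S <= 2 * qf h x.
  have [->|Sn] := eqVneq S 0; first by rewrite mulr0 mulr_ge0 ?v0.
  have Sp : 0 < S by rewrite lt_def Sn.
  rewrite -(ler_pM2r Sp); have -> : d ^+ 2 * S * S = (d * S) ^+ 2 by ring.
  have -> : 2 * qf h x * S = qf h x * (2 * S) by ring.
  exact: le_trans h6 (le_trans h3 h7).
have h9 : d ^+ 2 * qf h u <= d ^+ 2 * (2 * S).
  by rewrite ler_wpM2l ?sqr_ge0 // /S; lra.
rewrite mulrAC ler_pdivrMr //; lra.
Qed.

Lemma op_WP u f : op_W h P (u, f) <->
  [/\ Vp u, range (Pperp P) f & forall v, Vp v -> h u v = ip H f v].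
Proof.
have rangeQ w : range (Pperp P) w <-> P w = 0.
  split=> [[v _ <-]|Pw]; last by exists w; rewrite // /Pperp Pw subr0.
  by rewrite /Pperp raddfB /= (projK hP) subrr.
have QE w : P w = 0 -> Pperp P w = w by rewrite /Pperp => ->; rewrite subr0.
have VE w : Vp w <-> form_dom h w /\ range (Pperp P) w.
  by split=> [/(perp_range hP)[? /rangeQ]|[? /rangeQ ?]] //; apply/(perp_range hP).
split=> [[/= /VE Vu [Qf uP]]|[Vu Qf uP]].
  split=> // v Vv; have := uP v ((VE v).1 Vv).
  by rewrite !QE //; apply/rangeQ; case/VE: Vu; case/VE: Vv.
split; first exact/VE.
split=> // v /VE Vv /=; rewrite !QE ?uP //; apply/rangeQ; by [case/VE: Vv|case/VE: Vu].
Qed.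

Lemma W_resolvent t :
  bounded_below_on Vp h (fun u => 1%:K *: u + (- t)%:K *: G u) ->
  resolvent_set (range (Pperp P)) (op_W h P) t%:K.
Proof.
apply: (resolvent_of_bounded_below GV GP); first exact: op_WP.
move=> f u [v _ <-] Vu; exists (v + t%:K *: u) => //.
have [_ Pu] := (perp_range hP u).1 Vu.
rewrite /Pperp raddfD /= linearZ_LR Pu scaler0 addr0 addrAC //.
Qed.

Lemma bounded_below_of_W_resolvent t : 0 < t ->
  resolvent_set (range (Pperp P)) (op_W h P) t%:K ->
  bounded_below_on Vp h (fun u => G u - t^-1%:K *: u).
Proof.
move=> t0 [_ [C CP]]; apply: (bounded_below_of_resolvent_bound GV GP (C := C)) => //.
move=> x u Vx Vu uP.
have Qx w : Vp w -> range (Pperp P) w.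
  move=> /(perp_range hP)[_ Pw]; exists w => //.
  by rewrite /Pperp Pw subr0.
apply: CP; first exact: Qx.
by apply/op_WP; split=> //; apply: Qx; apply: subD => //; exact: subZ.
Qed.

End Gap.

(** * The relative gap *)

Section RelativeGap.
Variables (R : realType) (s : scalars) (H : hilbert R s) (h : posdef_form H).
Variables (P : {linear H -> H}) (m : nat).
Hypothesis hP : test_projection h P m.
Local Notation K := (scalar R s).
Local Notation "a %:K" := (of_real R s a) (at level 2, format "a %:K").
Local Notation re := (@real_part R s).
Local Notation Vp := (perp h (range P)).

Let iH := @ip_herm R s H (full H).
Let i0 := @ip_nonneg R s H (full H).
Let ipp := @ip_pos R s H (full H).
Let vH := perp_herm h (range P).
Let vp := @perp_pos _ _ _ h (range P).
Let v0 := pos_nonneg vH vp.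

Variable G : H -> H.
Hypotheses (GV : forall f, Vp (G f)).
Hypotheses (GP : forall f v, Vp v -> h (G f) v = ip H f v).

(** If w is h-orthogonal to the range of G, then |w|^2 = h (G w) w = 0. *)
Lemma green_range_dense u (e : R) : Vp u -> 0 < e ->
  exists2 v, Vp v & qf h (u - G v) < e.
Proof.
move=> Vu e0.
pose D0 w := exists2 v, Vp v & w = G v.
have D00 : D0 0.
  exists 0; first exact: sub0.
  by have := green_sub GV GP 0 0; rewrite subr0 subrr => ->.
have DP a x y : D0 x -> D0 y -> D0 (a *: x + y).
  move=> [v Vv ->] [w Vw ->]; exists (a *: v + w); first exact: subP.
  by rewrite (green_linear GV GP).
pose D := Subspace D00 DP.
have [|||p [Vpp pP pD]] := @riesz_on _ _ _ Vp h vH vp D (h u) (qf h u)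
  (@perp_complete _ _ _ h (range P)).
- by move=> _ [v _ ->].
- by move=> a v w Vv Vw; rewrite (hDr vH) ?(hZr vH) //; exact: subZ.
- by move=> v Vv; apply: (herm_cauchy_schwarz vH v0).
have -> : u = p; last by have [_ [v Vv ->] vP] := pD e e0; exists v.
have Vup : Vp (u - p) by exact: subB.
apply/eqP; rewrite -subr_eq0; apply/eqP/(pos_eq0 ipp) => //.
rewrite /qf -GP // (hC vH) // (hBl vH) // pP ?subrr ?rmorph0 ?re0 //.
by exists (u - p).
Qed.

(** Both sides are continuous for h, so the inequality extends from the range
of G, which is dense. *)
Lemma form_le_of_green_range c : 0 <= c ->
  (forall u, Vp u -> qf h (G u) <= c * qf (ip H) (G u)) ->
  forall u, Vp u -> qf h u <= c * qf (ip H) u.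
Proof.
move=> c0 Gc u Vu; have [k k0 kP] := form_coercive h.
rewrite -subr_le0.
pose C := qf h u + c * qf (ip H) u + 1 + c / k + c * (1 / k).
have hu := v0 Vu; have iu := i0 (I : full H u).
have ck : 0 <= c / k by rewrite divr_ge0 // ltW.
have cu : 0 <= c * qf (ip H) u by rewrite mulr_ge0.
apply: (@le0_of_forall_eps _ _ C) => [|t t0].
  by rewrite /C mul1r; lra.
have t2 : 0 < Num.min (t ^+ 2) t by rewrite lt_min exprn_gt0.
have [v Vv vP] := green_range_dense Vu t2.
set y := G v in vP; set z := u - y in vP.
have Vy : Vp y by exact: GV.
have Vz : Vp z by exact: subB.
have uE : u = y + z by rewrite /z addrC subrK.
have zt : qf h z <= t by apply/ltW/(lt_le_trans vP); rewrite ge_min lexx orbT.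
have zt2 : qf h z <= t ^+ 2 by apply/ltW/(lt_le_trans vP); rewrite ge_min lexx.
have qz := v0 Vz; have iz := i0 (I : full H z).
have izk : qf (ip H) z <= qf h z / k.
  by rewrite ler_pdivlMr // mulrC kP //; exact: perp_dom Vz.
have cross b : herm Vp b -> nonneg Vp b ->
    2 * `|re (b u z)| <= t * qf b u + qf b z / t.
  move=> bH b0; have bu := b0 u Vu; have bz := b0 z Vz.
  have h1 := re_cauchy_schwarz bH b0 Vu Vz.
  have rhs0 : 0 <= t * qf b u + qf b z / t.
    by apply: addr_ge0; [apply: mulr_ge0|apply: divr_ge0] => //; exact: ltW.
  rewrite -ler_sqr ?nnegrE ?mulr_ge0 // exprMn real_normK ?num_real //.
  have h2 := sqr_ge0 (t * qf b u - qf b z / t).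
  have -> : (t * qf b u + qf b z / t) ^+ 2 =
    (t * qf b u - qf b z / t) ^+ 2 + 4 * (qf b u * qf b z) by field; rewrite gt_eqF.
  by rewrite expr2; lra.
have c1 := cross h vH v0.
have c2 := cross (ip H) (ip_herm Vp) (@ip_nonneg _ _ _ Vp).
have d1 : qf h z / t <= t by rewrite ler_pdivrMr // -expr2.
have d2 : qf (ip H) z / t <= t / k.
  rewrite ler_pdivrMr // mulrAC -expr2; apply: le_trans izk _.
  by rewrite ler_pM2r ?invr_gt0.
have e1 := ler_norm (re (h u z)); have e2 := ler_norm (- re (h u z)).
have e3 := ler_norm (re (ip H u z)); have e4 := ler_norm (- re (ip H u z)).
rewrite normrN in e2; rewrite normrN in e4.
have yE : y = u - z by rewrite uE addrK.
have := Gc v Vv; rewrite -/y {1 2}yE (qB vH) // (qB iH) //.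
have f1 : c * (2 * `|re (ip H u z)|) <= c * (t * qf (ip H) u + t / k).
  by rewrite ler_wpM2l //; lra.
have f2 : c * re (ip H u z) <= c * `|re (ip H u z)| by rewrite ler_wpM2l.
have f3 : c * - re (ip H u z) <= c * `|re (ip H u z)| by rewrite ler_wpM2l.
have f4 : c * qf (ip H) z <= c * (t / k).
  rewrite ler_wpM2l //; apply: le_trans izk _; rewrite ler_pM2r ?invr_gt0 //.
have -> : C * t = t * qf h u + c * (t * qf (ip H) u + t / k) + t + c * (t / k).
  by rewrite /C; field; rewrite gt_eqF.
lra.
Qed.

Variable L : R.
Hypothesis L0 : 0 < L.
Local Notation spec_W := (real_spectrum (range (Pperp P)) (op_W h P)).

Let shiftE k u : 1%:K *: u + (- L)%:K *: G u - k%:K *: u =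
  (1 - k)%:K *: u + (- L)%:K *: G u.
Proof. by rewrite addrAC rmorphB scalerBl. Qed.

(** 1 - L G - k is a multiple of G - 1 / t for t = L / (1 - k), and then
|k| = |L - t| / t is the relative distance from L to t. *)
Let bounded_below_shift k : k < 1 -> ~ spec_W (L / (1 - k)) ->
  bounded_below_on Vp h (fun u => 1%:K *: u + (- L)%:K *: G u - k%:K *: u).
Proof.
move=> k1; have t0 : 0 < L / (1 - k) by rewrite divr_gt0 // subr_gt0.
move=> /contrapT/(bounded_below_of_W_resolvent hP GV GP t0)[d d0 dP].
exists (L ^+ 2 * d) => [|u Vu]; first by rewrite mulr_gt0 ?exprn_gt0.
rewrite shiftE.
have -> : (1 - k)%:K *: u + (- L)%:K *: G u =
    (- L)%:K *: (G u - (L / (1 - k))^-1%:K *: u).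
  rewrite scalerBr scalerA -rmorphM addrC; congr (_ + _).
  rewrite -scaleNr -rmorphN; congr (_%:K *: _).
  by field; rewrite !gt_eqF // subr_gt0.
rewrite (qZ vH); last by apply: subB => //; exact: subZ.
rewrite sqn_of_real sqrrN -mulrA ler_pM2l ?exprn_gt0 //; exact: dP.
Qed.

Let gap_estimate c : 0 <= c <= 1 ->
  (forall k, `|k| < c -> ~ spec_W (L / (1 - k))) ->
  forall u, Vp u -> c ^+ 2 * qf h u <= qf h (u - L%:K *: G u).
Proof.
move=> /andP[c0 c1] gap u Vu.
have -> : u - L%:K *: G u = 1%:K *: u + (- L)%:K *: G u.
  by rewrite rmorph1 scale1r rmorphN scaleNr.
have [M TM] := green_shift_bound GV GP 1 (- L).
apply: (norm_ge_of_gap_on vH vp _ (green_shift_sym GV GP 1 (- L)) TM c0) => //.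
- by move=> v Vv; apply: subD; exact: subZ.
- move=> k kc; apply: bounded_below_shift; last exact: gap.
  by apply: le_lt_trans (ler_norm k) _; apply: lt_le_trans c1.
Qed.

Let spectrum_pos t : spec_W t -> 0 < t.
Proof.
move=> tW; rewrite ltNge; apply/negP => t0; apply: tW.
apply: (W_resolvent hP GV GP); exists 1 => // u Vu.
set x := 1%:K *: u + _.
have Vx : Vp x by apply: subD; exact: subZ.
have h1 : qf h u <= re (h x u).
  rewrite /x (hDl vH) ?(hZl vH) //; try exact: subZ.
  rewrite reD !reZ (green_quad GP) // mul1r lerDl mulr_ge0 ?i0 //; lra.
have [->|un] := eqVneq (qf h u) 0; first by rewrite mulr0 v0.
have qu : 0 < qf h u by rewrite lt_def un v0.
rewrite mul1r -(ler_pM2r qu).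
apply: le_trans (re_cauchy_schwarz vH v0 Vx Vu); rewrite -expr2.
by rewrite ler_sqr ?nnegrE ?(le_trans (ltW qu) h1) ?(ltW qu).
Qed.

(** The shift of 1 - L G by k = 1 - L / t is bounded below if k is small
against the lower bound of 1 - L G, and then t is not in the spectrum. *)
Let spectrum_far d t : 0 < d ->
  (forall u, Vp u -> d * qf h u <= qf h (u - L%:K *: G u)) ->
  spec_W t -> d / 4 <= (`|L - t| / t) ^+ 2.
Proof.
move=> d0 dP tW; have t0 := spectrum_pos tW.
pose k := 1 - L / t.
have -> : (`|L - t| / t) ^+ 2 = k ^+ 2.
  rewrite exprMn real_normK ?num_real // /k; field; rewrite gt_eqF //.
rewrite leNgt; apply/negP => kd; apply: tW.
apply: (W_resolvent hP GV GP).
exists (d / 4 * (t / L) ^+ 2) => [|u Vu].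
  by rewrite mulr_gt0 ?divr_gt0 ?exprn_gt0 ?divr_gt0.
have VA : Vp (u - L%:K *: G u) by apply: subB => //; exact: subZ.
have Vk : Vp (k%:K *: u) by apply: subZ.
have -> : 1%:K *: u + (- t)%:K *: G u =
    (t / L)%:K *: (u - L%:K *: G u - k%:K *: u).
  rewrite !scalerBr !scalerA -!rmorphM addrAC -scalerBl -rmorphB.
  rewrite -scaleNr -rmorphN; congr (_%:K *: _ + _%:K *: _).
    by rewrite /k; field; rewrite !gt_eqF.
  by field; rewrite !gt_eqF.
have Vs : Vp (u - L%:K *: G u - k%:K *: u) by exact: subB.
rewrite (qZ vH) // sqn_of_real [d / 4 * _]mulrC -mulrA.
rewrite ler_wpM2l ?sqr_ge0 //.
have := q_sqD vH v0 Vs Vk; rewrite subrK (qZ vH) // sqn_of_real => h1.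
have := dP u Vu.
have : k ^+ 2 * qf h u <= d / 4 * qf h u by rewrite ler_wpM2r ?v0 // ltW.
lra.
Qed.

(** The points t of the spectrum of W correspond to the points k = 1 - L / t
of the spectrum of 1 - L G, so the relative gap is the distance of the latter
from 0, at least among the k < 1. The correspondence covers all |k| below the
relative gap only if the relative gap is at most 1; if it were larger, 1 - L G
would not shrink the norm of h, which forces h <= L / 2 on the range of G. *)
Lemma relative_gap_spec : bounded_below_on Vp h (fun u => u - L%:K *: G u) ->
  ~ (forall u, Vp u -> qf h u <= L / 2 * qf (ip H) u) ->
  0 < relative_gap h P L /\
  forall u, Vp u -> relative_gap h P L ^+ 2 * qf h u <= qf h (u - L%:K *: G u).
Proof.
move=> [d d0 dP] nle.
have distE k : `|k| < 1 -> `|L - L / (1 - k)| / (L / (1 - k)) = `|k|.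
  move=> k1; have k1' : 0 < 1 - k by have := ler_norm k; lra.
  have -> : L - L / (1 - k) = L / (1 - k) * - k.
    by field; rewrite gt_eqF.
  rewrite normrM normrN gtr0_norm ?divr_gt0 // mulrAC divff ?mul1r //.
  by rewrite gt_eqF // divr_gt0.
have [t1 t1W t1lt] : exists2 t, spec_W t & `|L - t| / t < 1.
  apply: contrapT => nt; apply: nle.
  have gap k : `|k| < 1 -> ~ spec_W (L / (1 - k)).
    by move=> k1 kW; apply: nt; exists (L / (1 - k)) => //; rewrite distE.
  have est : forall u, Vp u -> 1 ^+ 2 * qf h u <= qf h (u - L%:K *: G u).
    by apply: gap_estimate => //; rewrite ler01 lexx.
  apply: form_le_of_green_range => [|u Vu]; first by apply: divr_ge0 => //; exact: ltW.
  have := est u Vu; rewrite expr1n mul1r (qB vH) ?(qZ vH) //; last exact: subZ.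
  rewrite (hreC vH) ?(hZl vH) //; last exact: subZ.
  rewrite reZ (green_quad GP) // sqn_of_real => h1.
  have h2 : 2 * qf (ip H) u <= L * qf h (G u).
    by rewrite -(ler_pM2l L0); lra.
  have h3 := re_cauchy_schwarz iH i0 (u := u) (v := G u) I I.
  rewrite -GP // -/(qf h (G u)) in h3.
  have [->|Gn] := eqVneq (qf h (G u)) 0; first by rewrite mulr_ge0 ?i0 ?divr_ge0 ?(ltW L0).
  have Gp : 0 < qf h (G u) by rewrite lt_def Gn v0.
  rewrite -(ler_pM2l Gp) -expr2; apply: le_trans h3 _.
  have h4 : 2 * qf (ip H) u * qf (ip H) (G u) <= L * qf h (G u) * qf (ip H) (G u).
    by rewrite ler_wpM2r ?i0.
  lra.
set S := [set `|L - t| / t | t in spec_W].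
have Slb : lbound S (Num.sqrt (d / 4)).
  move=> _ [t tW <-]; have t0 := spectrum_pos tW.
  have r0 : 0 <= `|L - t| / t by apply: divr_ge0 => //; exact: ltW.
  rewrite -(ger0_norm r0) -sqrtr_sqr; apply: ler_wsqrtr.
  exact: spectrum_far.
have S1 : S (`|L - t1| / t1) by exists t1.
have gE : relative_gap h P L = inf S by [].
have g_le t : spec_W t -> relative_gap h P L <= `|L - t| / t.
  by move=> tW; rewrite gE; apply: ge_inf; [exists (Num.sqrt (d / 4))|exists t].
have g0 : 0 < relative_gap h P L.
  apply: lt_le_trans (_ : Num.sqrt (d / 4) <= _).
    by rewrite sqrtr_gt0 divr_gt0.
  by rewrite gE; apply: lb_le_inf => //; exists (`|L - t1| / t1).
have g1 : relative_gap h P L <= 1 by apply: le_trans (g_le _ t1W) (ltW t1lt).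
split=> //; apply: gap_estimate => [|k kg kW]; first by rewrite (ltW g0).
have := g_le _ kW; rewrite distE; last exact: lt_le_trans g1.
by rewrite leNgt kg.
Qed.

End RelativeGap.

(** * The eigenvalue cluster *)

Section Core.
Variables (R : realType) (s : scalars) (H : hilbert R s) (h : posdef_form H).
Variables (P : {linear H -> H}) (m : nat).
Hypothesis hP : test_projection h P m.
Local Notation K := (scalar R s).
Local Notation "a %:K" := (of_real R s a) (at level 2, format "a %:K").
Local Notation re := (@real_part R s).
Local Notation fdom := (fdom h).
Local Notation Vp := (perp h (range P)).

Let iH := @ip_herm R s H (full H).
Let i0 := @ip_nonneg R s H (full H).
Let ipp := @ip_pos R s H (full H).
Let fH := form_herm h.
Let fp := @form_pos _ _ _ h.
Let f0 := pos_nonneg fH fp.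
Let vH := perp_herm h (range P).
Let vp := @perp_pos _ _ _ h (range P).
Let v0 := pos_nonneg vH vp.

Variables (Z : H -> H) (sg mu1 mum : R).
Hypotheses (ZV : forall a, fdom a -> Vp (Z a)).
Hypotheses (ZP : forall a v, fdom a -> Vp v -> h (Z a) v = h a v).
Hypotheses (sg01 : 0 <= sg < 1).
Hypothesis Zsg : forall a, range P a -> qf h (Z a) <= sg ^+ 2 * qf h a.
Hypothesis mu_le : forall a, range P a -> qf h a <= mum * qf (ip H) a.
Hypothesis mu_ge : forall a, range P a -> mu1 * qf (ip H) a <= qf h a.
Hypothesis mu10 : 0 < mu1.
Hypothesis mu1m : mu1 <= mum.

Lemma weak_eigenpair_q t u : weak_eigenpair h (fun=> True) t u -> qf h u = t * qf (ip H) u.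
Proof. by move=> [_ hu uP]; rewrite /qf uP // reZ. Qed.

Section Eigenvectors.
Variables (lam : nat -> R) (n : nat) (e : nat -> H).
Hypothesis eo : forall i j, (i < n)%N -> (j < n)%N -> ip H (e i) (e j) = (i == j)%:R.
Hypothesis eE : forall i, (i < n)%N -> weak_eigenpair h (fun=> True) (lam i.+1) (e i).

Lemma eigenvalue_pos i : (i < n)%N -> 0 < lam i.+1.
Proof.
move=> ni; have ei := eE ni; have [_ hi _] := ei.
have q1 : qf (ip H) (e i) = 1 by rewrite /qf eo // eqxx re1.
have en : e i != 0.
  by apply/eqP => e0; move: q1; rewrite e0 (q0 iH) => /eqP; rewrite eq_sym oner_eq0.
by have := fp hi en; rewrite (weak_eigenpair_q ei) q1 mulr1.
Qed.

Lemma eigenvectors_free k : (k <= n)%N -> free_family (fun i : 'I_k => e i).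
Proof.
move=> kn; apply: (ortho_normal_free iH) => // i j.
by apply: eo; apply: leq_trans kn.
Qed.

Lemma eigenvectors_low k c : (k <= n)%N ->
  (forall i, (i < k)%N -> lam i.+1 <= c) ->
  forall u, span (fun i : 'I_k => e i) u -> qf h u <= c * qf (ip H) u.
Proof.
move=> kn lc u [a _ <-]; pose f (i : 'I_k) := e i; rewrite -/f.
have fn (i : 'I_k) : (i < n)%N by apply: leq_trans kn.
have fo : ortho_normal (ip H) f by move=> i j; apply: eo.
have hf i : fdom (f i) by case: (eE (fn i)).
have hd i j : h (f i) (f j) = (lam i.+1 * (i == j)%:R)%:K.
  by have [_ _ ->] := eE (fn i); rewrite // eo // rmorphM rmorph_nat.
rewrite (q_ortho_normal iH) // (q_diag fH _ hf hd) mulr_sumr ler_sum // => i _.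
by rewrite mulrC ler_wpM2r ?sqn_ge0 // lc.
Qed.

End Eigenvectors.

Section Estimate.
Variables (lam : nat -> R) (k : nat).
(* The k eigenvalues below the cluster are followed by the m equal ones of the
   cluster, so k is q - 1 in the notation of the theorem. *)
Local Notation N := (k.+1 + m)%N.
Hypothesis m0 : (0 < m)%N.
Hypothesis hlam : lowest_eigenvalues (op_H h) lam N.
Hypotheses (lam1 : lam k < lam k.+1) (lam2 : lam k.+1 = lam (k + m)%N).
Hypothesis lam3 : lam (k + m)%N < lam N.
Hypotheses (gap1 : mum < (1 - 2 * sg) * lam N).
Hypotheses (gap2 : lam k < (1 - 2 * sg) * mu1).

Lemma cluster_ge0 : 0 <= lam k.
Proof.
have NE : N = (k + m).+1 by rewrite addSn.
have hlam' : lowest_eigenvalues (op_H h) lam (k + m).+1 by rewrite -NE.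
have lam3' : lam (k + m)%N < lam (k + m).+1 by rewrite -NE.
have [lam00 _ _ _ _] := hlam'.
have [e [eo eE _]] := ex_eigenvectors (ltn_addl k m0) hlam' lam3'.
case: (k) eo eE => [|k'] eo' eE'; first by rewrite lam00.
by apply/ltW/(eigenvalue_pos eo' eE'); rewrite ltn_addr.
Qed.

Variable G : H -> H.
Hypotheses (GV : forall f, Vp (G f)).
Hypotheses (GP : forall f v, Vp v -> h (G f) v = ip H f v).

(** Min-max first gives (1 - sg) mu1 <= lam k.+1 <= (1 + sg) mum. The first
k eigenvectors, compressed by Pperp, span a subspace on which h stays below
lam k / (1 - sg), and this is less than lam k.+1. On its complement for h - L' the form h exceeds
some L' > lam k.+1, because otherwise range P and k + 1 vectors orthogonal to it
would contradict min-max at lam N. For the second claim, an eigenvector at lam N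
has too large a quotient if h is small on the form domain of W. *)
Lemma cluster_gap :
  bounded_below_on Vp h (fun u => u - (lam k.+1)%:K *: G u) /\
  ~ (forall u, Vp u -> qf h u <= lam k.+1 / 2 * qf (ip H) u).
Proof.
have NE : N = (k + m).+1 by rewrite addSn.
have hlam' : lowest_eigenvalues (op_H h) lam (k + m).+1 by rewrite -NE.
have lam3' : lam (k + m)%N < lam (k + m).+1 by rewrite -NE.
have [lam00 lam_mono lam_less _ [d occ_d dim_d]] := hlam'.
have [e [eo eE ex]] := ex_eigenvectors (ltn_addl k m0) hlam' lam3'.
have mu1_gt0 := mu10; have mu1_mum := mu1m; have g2 := gap2.
have lam_k0 := cluster_ge0.
have [sg0 sg1] := andP sg01.
have s1 : 0 < 1 - sg by lra.
move: (lam1) (lam2) (gap1) => l1 l2 g1.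
set L := lam k.+1 in l1 l2 *; set Lp := lam N in g1.
have LpE : lam (k + m).+1 = Lp by rewrite /Lp NE.
have less i : (0 < i)%N -> (i <= (k + m).+1)%N -> ((lam i)%:E <= lambda_ess (op_H h))%E.
  by move=> i1 iN; apply/ltW/lam_less; rewrite i1.
have LBN : forall u, fdom u -> (forall i, (i < k + m)%N -> ip H u (e i) = 0) ->
    Lp * qf (ip H) u <= qf h u.
  apply: (form_ge_of_orthogonal (lam := lam)) => //.
    by rewrite -LpE less.
  by move=> t x; rewrite -LpE => tL xt xe; apply: (ex t x) => // i ik _; exact: xe.
have kn i : (i < k)%N -> (i < k + m)%N by move=> ik; rewrite ltn_addr.
have k1m : (k.+1 <= k + m)%N by rewrite -addn1 leq_add2l.
have LBk : forall u, fdom u -> (forall i, (i < k)%N -> ip H u (e i) = 0) ->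
    L * qf (ip H) u <= qf h u.
  apply: (form_ge_of_orthogonal (lam := lam)) => [|i j ik jk|i ik|t x tL xt xe].
  - by apply: less => //; rewrite ltnS leq_addr.
  - by apply: eo; exact: kn.
  - by apply: eE; exact: kn.
  apply: (ex t x) => // [|i ik it].
    by rewrite LpE; apply: lt_trans tL _; rewrite l2.
  apply: xe; rewrite ltnNge; apply/negP => ki.
  have : L <= lam i.+1 by exact: (lam_mono k.+1 i.+1 isT ki (leqW ik)).
  by rewrite it leNgt tL.
have he i : (i < k + m)%N -> fdom (e i) by move=> /eE[].
have low j : (j <= k + m)%N -> forall u, span (fun i : 'I_j => e i) u ->
    qf h u <= lam j * qf (ip H) u.
  move=> jn; apply: (eigenvectors_low eo eE jn) => i ij.
  exact: (lam_mono i.+1 j isT ij (leqW jn)).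
have s2 : 0 < 1 - 2 * sg.
  by have := le_lt_trans lam_k0 gap2; rewrite pmulr_lgt0.
have ss : (1 - 2 * sg) * mu1 <= (1 - sg) * mu1 by rewrite ler_wpM2r //; lra.
have [F1 [F1free F1V F1c]] : exists F : 'I_k -> H, [/\ free_family F,
    forall i, Vp (F i) &
    forall u, span F u -> qf h u <= lam k / (1 - sg) * qf (ip H) u].
  apply: (compress_low_subspace hP ZV ZP sg01 Zsg mu_ge) lam_k0 _ _.
  - by apply: (eigenvectors_free eo); exact: leq_addr.
  - by move=> i; apply/he/kn.
  - lra.
  - by apply: low; exact: leq_addr.
set c1 := lam k / (1 - sg) in F1c.
have c1mu : c1 < mu1 by rewrite ltr_pdivrMr // mulrC; lra.
have c10 : 0 <= c1 by rewrite divr_ge0 // ltW.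
have upper1 : L <= (1 + sg) * mum.
  have := minmax_upper hP ZV ZP sg01 Zsg mu_le F1free F1V F1c (_ : (k < m + k)%N) LBk.
  by rewrite max_l; [apply; rewrite -[X in (X < _)%N]add0n ltn_add2r|lra].
have Lp0 : 0 < Lp.
  have := lt_le_trans mu10 mu1m => mm; have := lt_trans mm g1.
  by rewrite pmulr_rgt0.
have sq1 : (1 + sg) * (1 - 2 * sg) <= 1.
  have : 0 <= sg ^+ 2 by exact: sqr_ge0.
  have -> : (1 + sg) * (1 - 2 * sg) = 1 - sg - 2 * sg ^+ 2 by ring.
  lra.
have mumLp : (1 + sg) * mum < Lp.
  have : (1 + sg) * mum < (1 + sg) * ((1 - 2 * sg) * Lp) by rewrite ltr_pM2l //; lra.
  have : (1 + sg) * (1 - 2 * sg) * Lp <= 1 * Lp by rewrite ler_wpM2r // ltW.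
  rewrite mulrA; lra.
(* Otherwise k + 1 eigenvectors could be compressed, and with range P they
   would span a space of dimension k + m + 1 on which h stays below lam N. *)
have lower1 : (1 - sg) * mu1 <= L.
  rewrite leNgt; apply/negP => Lmu.
  have L0 : 0 <= L by apply: ltW; apply: le_lt_trans l1.
  have [F2 [F2free F2V F2c]] : exists F : 'I_k.+1 -> H, [/\ free_family F,
      forall i, Vp (F i) &
      forall u, span F u -> qf h u <= L / (1 - sg) * qf (ip H) u].
    apply: (compress_low_subspace hP ZV ZP sg01 Zsg mu_ge) L0 Lmu _.
    - by apply: (eigenvectors_free eo).
    - by move=> i; apply: he; apply: leq_trans (ltn_ord i) k1m.
    - exact: low.
  have kk : (k + m < m + k.+1)%N by rewrite addnS ltnS addnC.
  have := minmax_upper hP ZV ZP sg01 Zsg mu_le F2free F2V F2c kk LBN.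
  have Lmum : L / (1 - sg) <= mum by rewrite ler_pdivrMr // mulrC; nra.
  by rewrite max_l // leNgt mumLp.
have c1L : c1 < L.
  rewrite ltr_pdivrMr //.
  have a1 : lam k * (1 - sg) < (1 - 2 * sg) * mu1 * (1 - sg) by rewrite ltr_pM2r.
  have a2 : (1 - 2 * sg) * ((1 - sg) * mu1) <= (1 - 2 * sg) * L by rewrite ler_pM2l.
  have a3 : (1 - 2 * sg) * L <= (1 - sg) ^+ 2 * L.
    rewrite ler_wpM2r //; first by apply: ltW; apply: le_lt_trans l1.
    by rewrite sqrrB; have := sqr_ge0 sg; lra.
  rewrite -(ltr_pM2r s1); have -> : L * (1 - sg) * (1 - sg) = (1 - sg) ^+ 2 * L by ring.
  apply: lt_le_trans a1 _; apply: le_trans a3; apply: le_trans a2.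
  by rewrite mulrAC -mulrA.
(* Two factors 1 + sg fit under lam N since (1 + sg)^2 (1 - 2 sg) <= 1. *)
have LLp : (1 + sg) * L < Lp.
  have b1 : (1 + sg) * L <= (1 + sg) * ((1 + sg) * mum) by rewrite ler_pM2l //; lra.
  have b2 : (1 + sg) * ((1 + sg) * mum) < (1 + sg) * ((1 + sg) * ((1 - 2 * sg) * Lp)).
    by rewrite !ltr_pM2l //; lra.
  have b3 : (1 + sg) * ((1 + sg) * (1 - 2 * sg)) * Lp <= 1 * Lp.
    rewrite ler_wpM2r //; first exact: ltW.
    have -> : (1 + sg) * ((1 + sg) * (1 - 2 * sg)) = 1 - sg ^+ 2 * (3 + 2 * sg) by ring.
    have : 0 <= sg ^+ 2 * (3 + 2 * sg) by rewrite mulr_ge0 ?sqr_ge0 //; lra.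
    lra.
  have b4 : (1 + sg) * ((1 + sg) * (1 - 2 * sg)) * Lp =
    (1 + sg) * ((1 + sg) * ((1 - 2 * sg) * Lp)) by ring.
  lra.
pose L' := (L + Lp / (1 + sg)) / 2.
have LL' : L < L'.
  have : L < Lp / (1 + sg) by rewrite ltr_pdivlMr ?[L * _]mulrC //; lra.
  by rewrite /L'; lra.
have L'Lp : (1 + sg) * L' < Lp.
  have -> : (1 + sg) * L' = ((1 + sg) * L + Lp) / 2 by rewrite /L'; field; rewrite gt_eqF //; lra.
  lra.
have maxLp : (1 + sg) * Num.max mum L' < Lp by case: (leP mum L').
split.
  apply: (bounded_below_of_split GV GP (c := (c1 + L) / 2) (L' := L')) => //; [lra|lra|].
  move=> u Vu; have c1L' : c1 < L' by lra.
  have [y [z [uyz F1y Vz zF]]] := indefinite_decomposition F1free F1V c1L' F1c Vu.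
  exists y, z; split=> //; first exact: span_sub F1y.
    have := F1c y F1y; have := i0 (I : full H y).
    have : c1 * qf (ip H) y <= (c1 + L) / 2 * qf (ip H) y.
      by rewrite ler_wpM2r ?i0 //; lra.
    lra.
  apply: (complement_above hP ZV ZP sg01 Zsg mu_le F1free F1V c1L' F1c
    (_ : (k + m <= m + k)%N) LBN maxLp Vz zF).
  by rewrite addnC.
move=> nle.
have occ1 : (0 < occurrences lam (k + m).+1 (lam (k + m).+1))%N.
  rewrite /occurrences -has_count; apply/hasP; exists (k + m).+1 => //=.
  by rewrite mem_index_iota /= ltnS.
have [x [xn /eigenspaceP xE]] : exists x, x != 0 /\ eigenspace (op_H h) (lam (k + m).+1) x.
  have [f fo Ef] := has_dim_ortho_normal dim_d.
  have d0 : (0 < d)%N by apply: leq_trans occ1 occ_d.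
  exists (f (Ordinal d0)); split; last by apply/Ef/span_gen.
  apply/eqP => f00; have := fo (Ordinal d0) (Ordinal d0).
  by rewrite f00 (h0l iH) // eqxx => /eqP; rewrite eq_sym oner_eq0.
have [_ hx _] := xE; have := weak_eigenpair_q xE; rewrite LpE => qx.
have Qx := Pperp_perp hP hx; have Px := proj_range P x.
have ix : 0 < qf (ip H) x by apply: ipp.
have := form_two_sided hP ZV ZP sg01 Zsg Px Qx.
rewrite -proj_decomp ler_norml => /andP[_ h1].
have ixE := q_ip_decomp Px Qx; rewrite -proj_decomp in ixE.
have h2 := mu_le Px; have h3 := nle _ Qx.
have h4 : L / 2 * qf (ip H) (Pperp P x) <= Num.max mum L' * qf (ip H) (Pperp P x).
  have L00 : 0 < L by exact: le_lt_trans l1.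
  rewrite ler_wpM2r ?i0 // le_max; apply/orP; right; lra.
have h5 : mum * qf (ip H) (P x) <= Num.max mum L' * qf (ip H) (P x).
  by rewrite ler_wpM2r ?i0 // le_max lexx.
have h6 : (1 + sg) * (qf h (P x) + qf h (Pperp P x)) <=
    (1 + sg) * (Num.max mum L' * qf (ip H) x).
  by rewrite ler_pM2l; [rewrite ixE; lra|lra].
have h7 : (1 + sg) * Num.max mum L' * qf (ip H) x < Lp * qf (ip H) x.
  by rewrite ltr_pM2r.
rewrite mulrA in h6.
have : Lp * qf (ip H) x <= (1 + sg) * Num.max mum L' * qf (ip H) x by lra.
by rewrite leNgt h7.
Qed.

(** Since 1 - lam k.+1 G is injective, P is so on the m eigenvectors of the
cluster, and each a in range P is P u with u an eigenvector. The component
x = u - a satisfies x - lam k.+1 G x = - Z a, which bounds x, and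
h r v = - h x (Z v) on range P, which bounds r by x. *)
Lemma cluster_residual : 0 < relative_gap h P (lam k.+1) /\
  forall a r, range P a -> range P r ->
    (forall v, range P v -> h r v = h a v - (lam k.+1)%:K * ip H a v) ->
    relative_gap h P (lam k.+1) ^+ 2 * qf h r <= sg ^+ 2 * qf h (Z a).
Proof.
have [bb nle] := cluster_gap.
have lam_k0 := cluster_ge0.
set L := lam k.+1 in bb nle *.
have L0 : 0 < L by exact: le_lt_trans lam1.
have [g0 gP] := relative_gap_spec hP GV GP L0 bb nle.
split=> // a r Pa Pr raE; set g := relative_gap h P L in g0 gP *.
have NE : N = (k + m).+1 by rewrite addSn.
have hlam' : lowest_eigenvalues (op_H h) lam (k + m).+1 by rewrite -NE.
have lam3' : lam (k + m)%N < lam (k + m).+1 by rewrite -NE.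
have [_ lam_mono _ _ _] := hlam'.
have [e [eo eE _]] := ex_eigenvectors (ltn_addl k m0) hlam' lam3'.
have kj (j : 'I_m) : (k + j < k + m)%N by rewrite ltn_add2l.
have lamj (j : 'I_m) : lam (k + j).+1 = L.
  apply/eqP; rewrite eq_le; apply/andP; split; last by exact: (lam_mono k.+1 (k + j).+1 isT (leq_addr _ _) (leqW (kj j))).
  by rewrite /L lam2; exact: (lam_mono (k + j).+1 (k + m)%N isT (kj j) (leqnSn _)).
pose E (j : 'I_m) := e (k + j)%N.
have EE c v : fdom v -> h (lincomb E c) v = L%:K * ip H (lincomb E c) v.
  move=> hv; have hE j : fdom (E j) by case: (eE _ (kj j)).
  rewrite (h_lincombl fH) // (h_lincombl iH) // mulr_sumr; apply: eq_bigr => j _.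
  by have [_ _ ->] := eE _ (kj j); rewrite // lamj mulrCA.
have hE c : fdom (lincomb E c).
  by apply: (@sub_sum _ _ fdom) => j; apply: subZ; case: (eE _ (kj j)).
have Efree : free_family E.
  apply: (ortho_normal_free iH) => // i j.
  by rewrite eo ?kj // eqn_add2l.
have [d d0 dP] := bb.
have [_ [b [bfree Pb]] _] := hP.
have PEfree : free_family (fun j => P (E j)).
  move=> c cP; apply: Efree; set u := lincomb E c.
  have Pu : P u = 0.
    by rewrite -cP /u linear_lincomb.
  have Vu : Vp u by apply/(perp_range hP); split => //; exact: hE.
  have uG : u = L%:K *: G u.
    have VG : Vp (L%:K *: G u) by exact: subZ.
    apply: (h_eq vH vp) => // v Vv.
    by rewrite (hZl vH) // GP // /u EE //; exact: perp_dom Vv.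
  apply: (pos_eq0 vp Vu); apply/eqP; rewrite eq_le v0 // andbT.
  rewrite -(pmulr_rle0 _ d0); apply: le_trans (dP _ Vu) _.
  by rewrite -uG subrr (q0 vH).
have [c _ cE] : span (fun j => P (E j)) a.
  apply: (free_family_spans (e := b)) => // [j|]; last by rewrite Pb in Pa.
  by have := proj_range P (E j); rewrite Pb.
pose u := lincomb E c.
have uP v : fdom v -> h u v = L%:K * ip H u v by exact: EE.
have hu : fdom u by exact: hE.
have Pu : P u = a.
  by rewrite -cE /u linear_lincomb.
pose x := Pperp P u; have Vx : Vp x by exact: (Pperp_perp hP).
have uE : u = a + x by rewrite -Pu; exact: proj_decomp.
have ha := range_fdom hP Pa; have hr := range_fdom hP Pr; have hx := perp_dom Vx.
have xG : x - L%:K *: G x = - Z a.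
  have VG : Vp (L%:K *: G x) by exact: subZ.
  have VZ : Vp (Z a) by exact: ZV.
  apply: (h_eq vH vp); [exact: subB|exact: subN|move=> v Vv].
  have hv := perp_dom Vv.
  rewrite (hBl vH) // (hZl vH) // GP // (hNl vH) // ZP //.
  have := uP v hv; rewrite uE (hDl fH) // (hDl iH) // (perp_orth Vv Pa) add0r => <-.
  by rewrite opprD addrCA subrr addr0.
have xb : g ^+ 2 * qf h x <= qf h (Z a).
  apply: le_trans (gP _ Vx) _; rewrite xG (qN fH) //; exact: perp_dom (ZV ha).
have rx : h r r = - h x (Z r).
  have hZr := perp_dom (ZV hr).
  rewrite raE //.
  have -> : h x (Z r) = h x r.
    by rewrite (hC fH hx hZr) ZP // -(hC fH).
  have := uP r hr; rewrite uE (hDl fH) // (hDl iH) //.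
  have -> : ip H x r = 0 by case: Vx => _; apply.
  by rewrite addr0 => <-; rewrite opprD addrA subrr sub0r.
have qr : qf h r ^+ 2 <= qf h x * (sg ^+ 2 * qf h r).
  have hZr := perp_dom (ZV hr).
  have := re_cauchy_schwarz fH f0 hx hZr.
  have -> : re (h x (Z r)) ^+ 2 = qf h r ^+ 2 by rewrite /qf rx reN sqrrN.
  move=> h1; apply: le_trans h1 _; rewrite ler_wpM2l ?f0 //; exact: Zsg.
have [->|rn] := eqVneq (qf h r) 0.
  by rewrite mulr0 mulr_ge0 ?sqr_ge0 ?f0 //; exact: perp_dom (ZV ha).
have rp : 0 < qf h r by rewrite lt_def rn f0.
have qr' : qf h r <= sg ^+ 2 * qf h x.
  rewrite -(ler_pM2r rp) -expr2; apply: le_trans qr _.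
  by rewrite le_eqVlt; apply/orP; left; apply/eqP; ring.
apply: le_trans (_ : g ^+ 2 * (sg ^+ 2 * qf h x) <= _).
  by rewrite ler_wpM2l ?sqr_ge0.
by rewrite mulrCA ler_wpM2l ?sqr_ge0.
Qed.

End Estimate.

End Core.

(** * Bounded operators and unitary invariant norms *)

Section BoundedOperators.
Variables (R : realType) (s : scalars) (H : hilbert R s).
Local Notation K := (scalar R s).
Local Notation "a %:K" := (of_real R s a) (at level 2, format "a %:K").

Let iH := @ip_herm R s H (full H).
Let i0 := @ip_nonneg R s H (full H).

Lemma bounded_op_of_bound (A : H -> H) (C : R) : 0 <= C -> linear A ->
  (forall u, qf (ip H) (A u) <= C ^+ 2 * qf (ip H) u) ->
  bounded_op A /\ opnorm A <= C.
Proof.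
move=> C0 Alin AC.
have AC' u : rnorm (A u) <= C * rnorm u.
  rewrite -ler_sqr ?nnegrE ?mulr_ge0 ?rnorm_ge0 // exprMn -!q_ip; exact: AC.
split.
  split=> // u; apply/cvgrPdist_lt => e /K_gt0[r r0 ->].
  have r1 : 0 < r / (C + 1) by apply: divr_gt0 => //; lra.
  near=> v.
  have AB : A u - A v = A (u - v).
    by have := Alin (-1) v u; rewrite !scaleN1r addrC => <-; rewrite addrC.
  rewrite AB norm_rnorm ltr_of_real; apply: le_lt_trans (AC' _) _.
  have : rnorm (u - v) < r / (C + 1).
    rewrite -(ltr_of_real s) -norm_rnorm; near: v.
    apply: (@cvgr_dist_lt _ _ _ _ _ id u) => //.
    by rewrite -(rmorph0 (of_real R s)) ltr_of_real.
  rewrite ltr_pdivlMr; last by lra.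
  have := rnorm_ge0 (u - v); lra.
apply: ge_sup.
  exists (rnorm (A 0)), 0 => //=.
  by rewrite -(ler_of_real s) -norm_rnorm normr0 rmorph1 ler01.
move=> _ [u /= u1 <-]; apply: le_trans (AC' u) _.
by rewrite ler_piMr.
Unshelve. all: by end_near.
Qed.

Lemma has_dim_of_subspan n (e : 'I_n -> H) (V : subspace H) :
  (forall u, V u -> span e u) -> exists k, has_dim [set u | V u] k.
Proof.
move=> Ve.
pose Q k := `[< exists2 g : 'I_k -> H, free_family g & forall i, V (g i) >].
have Q0 : exists k, Q k.
  exists 0%N; apply/asboolP; exists (fun=> 0); last by case.
  by move=> c _ [].
have Qn k : Q k -> (k <= n)%N.
  move=> /asboolP[g gfree gV]; rewrite leqNgt; apply/negP => nk.
  have [c [i ci] cg] := dependent_in_span nk (fun i => Ve _ (gV i)).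
  by move: ci; rewrite (gfree _ cg) eqxx.
have [k /asboolP[g gfree gV] kmax] := ex_maxnP Q0 Qn.
exists k, g; split=> //; apply/seteqP; split=> u; last by exact: (span_sub gV).
move=> /= Vu; apply: contrapT => gu.
suff : Q k.+1 by move=> /kmax; rewrite ltnn.
apply/asboolP; exists (snoc g u); last first.
  by move=> i; rewrite /snoc; case: unliftP.
move=> c; rewrite lincomb_snoc; set w := lincomb g _ => rel.
have cm : c ord_max = 0.
  apply: contrapT => /eqP cm; apply: gu.
  have -> : u = - (c ord_max)^-1 *: w.
    apply: (scalerI cm); rewrite scalerA mulrN divff // scaleN1r.
    by apply/eqP; rewrite -addr_eq0 addrC rel.
  by apply: (@subZ _ _ (span g)); exact: span_mem.
move: rel; rewrite cm scale0r addr0 => w0 i.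
by case: (unliftP ord_max i) => [j ->|->] //; exact: (gfree _ w0).
Qed.

Lemma lincomb_ip_linear n (a b : 'I_n -> H) (c : 'I_n -> K) :
  linear (fun u => lincomb b (fun i => c i * ip H u (a i))).
Proof.
move=> x u v; rewrite -lincombP; congr lincomb; apply/funext => i.
by rewrite (hLl iH) // mulrDr mulrCA.
Qed.

Section Bessel.
Variables (n : nat) (e : 'I_n -> H).
Hypothesis eo : ortho_normal (ip H) e.

Lemma bessel u : \sum_i sqn (ip H u (e i)) <= qf (ip H) u.
Proof.
pose p := lincomb e (fun i => ip H u (e i)).
have := i0 (I : full H (u - p)); rewrite (qB iH) //.
have -> : qf (ip H) p = \sum_i sqn (ip H u (e i)) by rewrite (q_ortho_normal iH).
have -> : real_part (ip H u p) = \sum_i sqn (ip H u (e i)).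
  rewrite (h_lincombr iH) // re_sum; apply: eq_bigr => i _.
  by rewrite mulrC mul_conj re_of_real.
lra.
Qed.

Lemma mx_op_diag (alpha : nat -> R) u : mx_op e (diag_seq s n alpha) u =
  lincomb e (fun i => (alpha i.+1)%:K * ip H u (e i)).
Proof.
apply: eq_bigr => i _; congr (_ *: _).
rewrite (bigD1 i) //= big1 ?addr0 => [|j /negPf ji].
  by rewrite !mxE eqxx mulr1n.
by rewrite !mxE eq_sym ji mulr0n mul0r.
Qed.

Lemma finite_rank_mx_op (alpha : nat -> R) :
  finite_rank (mx_op e (diag_seq s n alpha)).
Proof.
have DE : mx_op e (diag_seq s n alpha) =
    fun u => lincomb e (fun i => (alpha i.+1)%:K * ip H u (e i)).
  by apply/funext => u; rewrite mx_op_diag.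
have Dlin : linear (mx_op e (diag_seq s n alpha)).
  by rewrite DE; exact: lincomb_ip_linear.
split.
  pose C := \sum_(i < n) `|alpha i.+1|.
  apply: (proj1 (bounded_op_of_bound (C := C) _ Dlin _)) => [|u].
    by rewrite sumr_ge0.
  rewrite mx_op_diag (q_ortho_normal iH) //.
  apply: le_trans (_ : \sum_i C ^+ 2 * sqn (ip H u (e i)) <= _).
    apply: ler_sum => i _; rewrite sqnM sqn_of_real ler_wpM2r ?sqn_ge0 //.
    rewrite -real_normK ?num_real // ler_sqr ?nnegrE ?sumr_ge0 //.
    by rewrite /C (bigD1 i) //= lerDl sumr_ge0.
  by rewrite -mulr_sumr ler_wpM2l ?sqr_ge0 ?bessel.
have D0 : range (mx_op e (diag_seq s n alpha)) 0.
  exists 0 => //; rewrite mx_op_diag /lincomb big1 // => i _.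
  by rewrite (h0l iH) // mulr0 scale0r.
have DP a u v : range (mx_op e (diag_seq s n alpha)) u ->
    range (mx_op e (diag_seq s n alpha)) v ->
    range (mx_op e (diag_seq s n alpha)) (a *: u + v).
  by move=> [x _ <-] [y _ <-]; exists (a *: x + y); rewrite ?Dlin.
have [|k kD] := @has_dim_of_subspan n e (Subspace D0 DP).
  by move=> _ [u _ <-]; rewrite mx_op_diag; exact: span_mem.
by exists k.
Qed.

End Bessel.

Lemma ui_norm_factor (N : unitary_invariant_norm H) (A B C D : H -> H) (c : R) :
  bounded_op A -> finite_rank B -> bounded_op C -> opnorm A <= c ->
  opnorm C <= 1 -> D = A \o B \o C -> N D <= c * N B.
Proof.
move=> bA fB bC Ac C1 ->; have iB := ui_finite_rank N fB.
have iz : ui_ideal N 0.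
  by have := ui_ideal_linear (-1) iB iB; rewrite scaleN1r addNr.
have iNB : ui_ideal N (- B).
  by have := ui_ideal_linear (-1) iB iz; rewrite scaleN1r addr0.
have N0 : N 0 = 0.
  have := ui_normZ 0 iB.
  by rewrite scale0r normr0 re0 mul0r.
have NN : N (- B) = N B.
  have := ui_normZ (-1) iB; rewrite scaleN1r normrN normr1.
  by rewrite -(rmorph1 (of_real R s)) re_of_real mul1r.
(* The triangle inequality for B and - B. *)
have NB : 0 <= N B.
  by have := ui_normD iB iNB; rewrite subrr N0 NN; lra.
apply: le_trans (ui_norm_comp bA iB bC) _.
have A0 : 0 <= opnorm A.
  rewrite /opnorm.
  have [Asup|/sup_out ->//] := pselect (has_sup [set rnorm (A u) | u in [set u | rnorm u <= 1]]).
  apply: le_trans (rnorm_ge0 (A 0)) _; apply: ub_le_sup; first by case: Asup.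
  exists 0 => //=; by rewrite -(ler_of_real s) -norm_rnorm normr0 rmorph1 ler01.
apply: le_trans (_ : opnorm A * N B * 1 <= _).
  by rewrite ler_wpM2l // mulr_ge0.
by rewrite mulr1 ler_wpM2r.
Qed.

End BoundedOperators.

(** * Ritz bases and the residual *)

Section RitzBasis.
Variables (R : realType) (s : scalars) (H : hilbert R s) (h : posdef_form H).
Variables (P : {linear H -> H}) (m : nat).
Hypothesis hP : test_projection h P m.
Local Notation K := (scalar R s).
Local Notation "a %:K" := (of_real R s a) (at level 2, format "a %:K").
Local Notation conj := (scalar_conj R s).
Local Notation fdom := (fdom h).
Local Notation Vp := (perp h (range P)).

Let iH := @ip_herm R s H (full H).
Let fH := form_herm h.
Let fp := @form_pos _ _ _ h.

Variable S : operator H.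
Hypothesis hS : positive_sqrt S (op_H h).
Local Notation Xi := (rayleigh_quotient P S).

Let XiP u g : Xi (u, g) <->
  [/\ range P u, range P g & forall v, range P v -> h u v = ip H g v].
Proof. by apply: (rayleigh_quotientP hS); case: hP. Qed.

Lemma ex_ritz_basis mu : all_eigenvalues Xi mu m ->
  exists psi : 'I_m -> H, [/\ ortho_normal (ip H) psi,
    forall u, range P u <-> span psi u &
    forall i : 'I_m, weak_eigenpair h (range P) (mu i.+1) (psi i)].
Proof.
move=> [mu_mono mu_dim].
pose ES t := [set u | weak_eigenpair h (range P) t u].
have ESE t : eigenspace Xi t = ES t.
  apply/seteqP; split=> u.
    move=> /XiP[Pu _ uP]; split=> //; first exact: (range_fdom hP).
    by move=> v Pv _; rewrite uP // (hZl iH).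
  move=> [Pu hu uP]; apply/XiP; split=> // [|v Pv].
    by apply: (@subZ _ _ (range_subspace P)).
  by rewrite uP // ?(hZl iH) //; exact: (range_fdom hP).
pose L := [seq mu i | i <- iota 1 m].
have sL : size L = m by rewrite size_map size_iota.
have [t tL|t t' x y tt xt yt|e [eo eE _]] := @ex_eigenbasis _ _ H ES L.
- by rewrite -ESE -occurrences_map; exact: mu_dim.
- exact: weak_eigenpair_orthogonal tt xt yt.
rewrite sL in eo eE.
pose psi (i : 'I_m) := e i.
have psio : ortho_normal (ip H) psi by move=> i j; exact: eo.
have psiE (i : 'I_m) : weak_eigenpair h (range P) (mu i.+1) (psi i).
  by rewrite -(nth_lam mu (ltn_ord i)); exact: eE.
have Ppsi i : range P (psi i) by case: (psiE i).
exists psi; split=> // u; split=> [Pu|]; last exact: (@span_sub _ _ _ _ (range_subspace P)).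
have [_ [b [_ Pb]] _] := hP.
apply: (free_family_spans (e := b)) => [j||]; last by rewrite Pb in Pu.
- by have := Ppsi j; rewrite Pb.
- exact: (ortho_normal_free iH).
Qed.

Variables (mu : 'I_m -> R) (psi : 'I_m -> H) (L : R).
Hypothesis psio : ortho_normal (ip H) psi.
Hypothesis psiP : forall u, range P u <-> span psi u.
Hypothesis psiE : forall i, weak_eigenpair h (range P) (mu i) (psi i).

Let Ppsi i : range P (psi i). Proof. by case: (psiE i). Qed.
Let hpsi i : fdom (psi i). Proof. by case: (psiE i). Qed.

Lemma ritz_expand u : range P u -> u = lincomb psi (fun i => ip H u (psi i)).
Proof.
by move=> /psiP Pu; apply: (ortho_normal_complete iH _ (span_gen psi) psio Pu).
Qed.

Lemma ritz_form i j : h (psi i) (psi j) = (mu i * (i == j)%:R)%:K.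
Proof.
by have [_ _ ->] := psiE i; rewrite // psio rmorphM rmorph_nat.
Qed.

Lemma ritz_value_pos i : 0 < mu i.
Proof.
have psi0 : psi i != 0.
  apply/eqP => psi0; have := psio i i; rewrite psi0 (h0l iH) // eqxx => /eqP.
  by rewrite eq_sym oner_eq0.
by have := fp (hpsi i) psi0; rewrite /qf ritz_form eqxx re_of_real mulr1.
Qed.

Let mu_neq0 i : mu i != 0. Proof. by rewrite gt_eqF // ritz_value_pos. Qed.

(** The function w of the Rayleigh quotient, extended by 0 to the orthogonal
complement of range P. *)
Definition ritz_calculus (w : 'I_m -> R) (u : H) : H :=
  lincomb psi (fun i => (w i)%:K * ip H u (psi i)).

Lemma ritz_calculus_linear w : linear (ritz_calculus w).
Proof. exact: lincomb_ip_linear. Qed.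

Lemma ritz_calculus_range w u : range P (ritz_calculus w u).
Proof. by apply/psiP; exact: span_mem. Qed.

Lemma ritz_calculus_coef w u i :
  ip H (ritz_calculus w u) (psi i) = (w i)%:K * ip H u (psi i).
Proof. by rewrite (ortho_normal_coef iH). Qed.

Lemma ritz_calculusC w w' u :
  ritz_calculus w (ritz_calculus w' u) = ritz_calculus w' (ritz_calculus w u).
Proof.
apply: eq_bigr => i _; congr (_ *: _).
by rewrite !ritz_calculus_coef mulrCA.
Qed.

Lemma form_expand u v : range P u -> range P v ->
  h u v = \sum_i ip H u (psi i) * conj (ip H v (psi i)) * (mu i)%:K.
Proof.
move=> Pu Pv; rewrite {1}(ritz_expand Pu) {1}(ritz_expand Pv).
by rewrite (h_diag fH _ _ hpsi ritz_form).
Qed.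

Lemma ip_expand u v : range P u ->
  ip H u v = \sum_i ip H u (psi i) * conj (ip H v (psi i)).
Proof.
move=> Pu; rewrite {1}(ritz_expand Pu) (h_lincombl iH) //.
by apply: eq_bigr => i _; rewrite -(hC iH).
Qed.

Definition xi_sqrt := ritz_calculus (fun i => Num.sqrt (mu i)).

(** This carries bounds in the norm of h, where the coupling lives, to the
norm of the Hilbert space, where unitary invariant norms live. *)
Lemma xi_sqrt_isometry u v : range P u -> range P v ->
  ip H (xi_sqrt u) (xi_sqrt v) = h u v.
Proof.
move=> Pu Pv; rewrite ip_expand ?form_expand //; last exact: ritz_calculus_range.
apply: eq_bigr => i _; rewrite !ritz_calculus_coef rmorphM conj_of_real mulrACA.
rewrite -rmorphM -expr2 sqr_sqrtr; last exact/ltW/ritz_value_pos.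
by rewrite mulrC.
Qed.

Definition xi_residual := ritz_calculus (fun i => 1 - L / mu i).

Lemma xi_residual_form u v : range P u -> range P v ->
  h (xi_residual u) v = h u v - L%:K * ip H u v.
Proof.
move=> Pu Pv; rewrite !form_expand ?ip_expand //; last exact: ritz_calculus_range.
rewrite mulr_sumr -sumrB; apply: eq_bigr => i _; rewrite ritz_calculus_coef.
have -> : L%:K = (L / mu i)%:K * (mu i)%:K :> K by rewrite -rmorphM divfK.
by rewrite rmorphB rmorph1; ring.
Qed.

Lemma residualE u : residual P Xi L u = xi_residual u.
Proof.
have Pu := proj_range P u; rewrite /residual.
pose b := ritz_calculus (fun i => (mu i)^-1) (P u).
have Pb : range P b by exact: ritz_calculus_range.
have -> : op_apply (op_inv Xi) (P u) = b.
  apply: op_apply_eq => [|w /XiP[/= Pw _ wP]].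
    apply/XiP; split=> // v Pv; rewrite form_expand // ip_expand //.
    apply: eq_bigr => i _; rewrite ritz_calculus_coef fmorphV.
    by rewrite mulrC !mulrA divff ?mul1r // fmorph_eq0.
  have hb := range_fdom hP Pb; have hw := range_fdom hP Pw.
  have rsub : forall v, range_subspace P v -> fdom v by exact: (range_fdom hP).
  have rH : herm (range_subspace P) h := herm_sub rsub fH.
  have rp : pos (range_subspace P) h by move=> v /rsub; exact: fp.
  apply: (h_eq rH rp (u := w) (v := b) Pw Pb) => v Pv.
  rewrite wP // form_expand // ip_expand //.
  apply: eq_bigr => i _; rewrite ritz_calculus_coef fmorphV.
  by rewrite [RHS]mulrC !mulrA divff ?mul1r // fmorph_eq0.
rewrite {1}(ritz_expand Pu) /b /ritz_calculus -scaleN1r scalerA addrC -lincombP.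
congr lincomb; apply/funext => i.
rewrite (proj_sym hP) ((rangeP hP _).1 (Ppsi i)).
by rewrite rmorphB rmorph1 rmorphM fmorphV; ring.
Qed.

Section Bounds.
Variables (f : 'I_m -> H) (Z : H -> H) (x : 'I_m -> R) (eta_ : nat -> R) (c : R).
Hypothesis fP : forall u, range P u <-> span f u.
Hypothesis fo : ortho_normal h f.
Hypotheses (ZV : forall a, fdom a -> Vp (Z a)).
Hypotheses (ZP : forall a v, fdom a -> Vp v -> h (Z a) v = h a v).
Hypothesis fZ : forall i j, h (Z (f i)) (Z (f j)) = (x i * (i == j)%:R)%:K.
Hypothesis x_eta : forall i : 'I_m, 0 <= x i <= eta_ i.+1 ^+ 2.
Hypothesis c0 : 0 <= c.
Hypothesis core : forall a, range P a ->
  qf h (xi_residual a) <= c ^+ 2 * qf h (Z a).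

Let Pf i : range P (f i). Proof. exact/fP/span_gen. Qed.
Let hf i : fdom (f i). Proof. exact: (range_fdom hP (Pf i)). Qed.

Lemma q_coupling_lincomb b : qf h (Z (lincomb f b)) = \sum_i sqn (b i) * x i.
Proof. exact: (q_diag (coupling_herm ZV ZP) b hf fZ). Qed.

Let g i := xi_sqrt (f i).
Let Pg i : range P (g i). Proof. exact: ritz_calculus_range. Qed.

Lemma xi_sqrt_basis : ortho_normal (ip H) g.
Proof. by move=> i j; rewrite /g xi_sqrt_isometry. Qed.

Lemma xi_sqrt_expand u : range P u -> u = lincomb g (fun i => ip H u (g i)).
Proof.
move=> Pu; apply: (ortho_normal_complete iH (e := psi)) => //.
- by move=> i; apply/psiP.
- exact: xi_sqrt_basis.
- exact/psiP.
Qed.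

Lemma ritz_lincomb w n (e : 'I_n -> H) b :
  ritz_calculus w (lincomb e b) = lincomb (fun i => ritz_calculus w (e i)) b.
Proof.
have rl := ritz_calculus_linear w.
have r0 : ritz_calculus w 0 = 0.
  by have := rl (-1) 0 0; rewrite scaleN1r addNr scaleN1r addNr.
rewrite /lincomb; elim/big_ind2 : _ => // [_ u _ v <- <-|i _].
  by have := rl 1 u v; rewrite !scale1r.
by rewrite -[_ *: e i]addr0 rl r0 addr0.
Qed.

(** The residual factors as X diag(eta) Y. Y takes the coordinates of u in the orthonormal basis Xi^(1/2) f_i, and
diag(eta) multiplies them by eta_i. X divides them by eta_i, returns to f_i and
applies the residual and Xi^(1/2); its norm is at most c because
h[Z f_i] <= eta_i^2. *)
Lemma ui_norm_bound (N : unitary_invariant_norm H) (e : 'I_m -> H) :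
  orthonormal_family e ->
  N (residual P Xi L) <= c * N (mx_op e (diag_seq s m eta_)).
Proof.
move=> eo.
pose X w := xi_sqrt (xi_residual
  (lincomb f (fun i => (eta_ i.+1)^-1%:K * ip H w (e i)))).
pose Y u := lincomb e (fun i => 1 * ip H u (g i)).
have Xlin : linear X.
  move=> a u v; rewrite /X.
  rewrite (lincomb_ip_linear e f (fun i => (eta_ i.+1)^-1%:K)).
  by rewrite /xi_residual /xi_sqrt !ritz_calculus_linear.
have Ylin : linear Y by exact: (lincomb_ip_linear g e (fun=> 1)).
have [Xb Xc] : bounded_op X /\ opnorm X <= c.
  apply: bounded_op_of_bound => // w; rewrite /X; set a := lincomb f _.
  have Pa : range P a by apply/fP; exact: span_mem.
  rewrite /qf xi_sqrt_isometry; try exact: ritz_calculus_range.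
  rewrite -/(qf h _); apply: le_trans (core Pa) _.
  rewrite ler_wpM2l ?sqr_ge0 // q_coupling_lincomb.
  apply: le_trans (bessel eo w); apply: ler_sum => i _.
  rewrite sqnM sqn_of_real mulrAC -[leRHS]mul1r ler_wpM2r ?sqn_ge0 //.
  have /andP[xi0 xi1] := x_eta i.
  have [e0|e0] := eqVneq (eta_ i.+1) 0.
    by rewrite e0 invr0 expr0n mul0r ler01.
  rewrite exprVn mulrC ler_pdivrMr ?mul1r //.
  by rewrite lt_def sqrf_eq0 e0 sqr_ge0.
have [Yb Y1] : bounded_op Y /\ opnorm Y <= 1.
  apply: bounded_op_of_bound => // u.
  rewrite expr1n mul1r (q_ortho_normal iH) //.
  under eq_bigr => i _ do rewrite mul1r.
  by apply: bessel; exact: xi_sqrt_basis.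
have fin : finite_rank (mx_op e (diag_seq s m eta_)) by exact: finite_rank_mx_op.
apply: (@ui_norm_factor _ _ _ N X _ Y _ c Xb fin Yb Xc Y1).
apply/funext => u; rewrite residualE /= mx_op_diag /X.
have -> : xi_residual u = xi_residual (P u).
  congr lincomb; apply/funext => i; congr (_ * _).
  by rewrite (proj_sym hP) ((rangeP hP _).1 (Ppsi i)).
rewrite (xi_sqrt_expand (proj_range P u)) /xi_residual /xi_sqrt !ritz_lincomb.
apply: eq_bigr => i _.
have -> : ip H (P u) (g i) = ip H u (g i).
  by rewrite (proj_sym hP) ((rangeP hP _).1 (Pg i)).
rewrite (ortho_normal_coef iH) // /Y (ortho_normal_coef iH) // mul1r.
rewrite [ritz_calculus _ (g i)]ritz_calculusC mulrA -rmorphM.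
(* If eta_i = 0, then division by it gives 0, and the residual kills f_i. *)
have [e0|e0] := eqVneq (eta_ i.+1) 0; last by rewrite mulVf // rmorph1 mul1r.
have x0 : x i = 0.
  by have := x_eta i; rewrite e0 expr0n => /andP[h1 h2]; apply/eqP; rewrite eq_le h1 h2.
have -> : ritz_calculus (fun i => 1 - L / mu i) (f i) = 0.
  apply: (pos_eq0 fp); first exact/(range_fdom hP)/ritz_calculus_range.
  apply/eqP; rewrite eq_le; apply/andP; split.
    apply: le_trans (core (Pf i)) _.
    by rewrite /qf fZ x0 mul0r rmorph0 re0 mulr0.
  by apply: (pos_nonneg fH fp); exact/(range_fdom hP)/ritz_calculus_range.
have rl := ritz_calculus_linear (fun i => Num.sqrt (mu i)).
have -> : ritz_calculus (fun i => Num.sqrt (mu i)) 0 = 0.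
  by have := rl (-1) 0 0; rewrite scaleN1r addNr scaleN1r addNr.
by rewrite !scaler0.
Qed.

(** The left-hand side is the squared Hilbert-Schmidt norm of the residual
for the inner product h, here computed in the basis f_i instead of the Ritz
vectors. *)
Lemma hs_norm_bound : \sum_i (1 - L / mu i) ^+ 2 <=
  c ^+ 2 * \sum_(i < m) eta_ i.+1 ^+ 2.
Proof.
have -> : \sum_i (1 - L / mu i) ^+ 2 = \sum_j qf h (xi_residual (f j)).
  have qE j : qf h (xi_residual (f j)) =
      \sum_i (1 - L / mu i) ^+ 2 * sqn (ip H (psi i) (g j)).
    rewrite /qf -xi_sqrt_isometry; try exact: ritz_calculus_range.
    rewrite /xi_residual /xi_sqrt ritz_calculusC -/xi_sqrt -/(g j).
    rewrite -/(qf _ _) (q_ortho_normal iH) //; apply: eq_bigr => i _.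
    by rewrite sqnM sqn_of_real (hC iH) // sqn_conj.
  under [RHS]eq_bigr => j _ do rewrite qE.
  rewrite exchange_big /=; apply: eq_bigr => i _.
  rewrite -mulr_sumr -(q_ortho_normal iH _ _ xi_sqrt_basis) //.
  by rewrite -xi_sqrt_expand // /qf psio eqxx re1 mulr1.
rewrite mulr_sumr; apply: ler_sum => j _.
apply: le_trans (core (Pf j)) _; rewrite ler_wpM2l ?sqr_ge0 //.
by rewrite /qf fZ eqxx re_of_real mulr1; case/andP: (x_eta j).
Qed.

End Bounds.

End RitzBasis.

(** * The residual estimate *)

Theorem theorem3p3 (R : realType) (s : scalars) (H : hilbert R s)
    (hdim : infinite_dim H)
    (h : posdef_form H)
    (sqrtH : operator H) (hsqrt : positive_sqrt sqrtH (op_H h))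
    (m : nat) (hm : (0 < m)%N)
    (P : {linear H -> H}) (hP : test_projection h P m)
    (q : nat) (hq : (0 < q)%N)
    (lam : nat -> R) (hlam : lowest_eigenvalues (op_H h) lam (q + m)%N)
    (mu : nat -> R)
    (hmu : all_eigenvalues (rayleigh_quotient P sqrtH) mu m)
    (hlam1 : lam q.-1 < lam q)
    (hlam2 : lam q = lam (q + m - 1)%N)
    (hlam3 : lam (q + m - 1)%N < lam (q + m)%N)
    (heta : eta h P m m / (1 - eta h P m m) < gamma_s lam mu q m) :
  (forall (N : unitary_invariant_norm H)
      (e : 'I_m -> H) (he : orthonormal_family e),
    N (residual P (rayleigh_quotient P sqrtH) (lam q))
    <= eta h P m m / relative_gap h P (lam q) * N (mx_op e (diag_seq s m (eta h P m))))
  /\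
  Num.sqrt (\sum_(1 <= i < m.+1) (lam q - mu i) ^+ 2 / mu i ^+ 2)
  <= eta h P m m / relative_gap h P (lam q)
     * Num.sqrt (\sum_(1 <= i < m.+1) eta h P m i ^+ 2).
Proof.
case: m hm hP hlam hmu hlam2 hlam3 heta => // m' _ {}hP {}hlam {}hmu.
case: q hq hlam hlam1 => // k _ {}hlam {}hlam1; rewrite /= in hlam1.
have -> : (k.+1 + m'.+1 - 1)%N = (k + m'.+1)%N by rewrite addSn subn1.
move=> {}hlam2 {}hlam3 {}heta.
have iH := @ip_herm R s H (full H).
have i0 := @ip_nonneg R s H (full H).
have [Z [ZV ZP]] := ex_coupling h P.
have [f [x [fP fo fZ xm x01]]] := ex_coupling_basis hP ZV ZP.
have etaE := eta_last hP ZV ZP fP fo fZ xm x01.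
have etaB := eta_bounds hP ZV ZP fP fo fZ xm x01.
set sg := eta h P m'.+1 m'.+1 in etaE heta *.
have [xm0 xm1] := andP (x01 ord_max).
have sg0 : 0 <= sg by rewrite etaE sqrtr_ge0.
have sg2 : sg ^+ 2 = x ord_max by rewrite etaE sqr_sqrtr.
have sg1 : sg < 1 by rewrite -(@ltr_pXn2r _ 2) ?nnegrE // sg2 expr1n.
have sg01 : 0 <= sg < 1 by rewrite sg0.
have Zsg a : range P a -> qf h (Z a) <= sg ^+ 2 * qf h a.
  by rewrite sg2; exact: (coupling_bound hP ZV ZP fP fo fZ xm).
have [psi [psio psiP psiE]] := ex_ritz_basis hP hsqrt hmu.
have mu_mono := proj1 hmu.
pose mu' (i : 'I_m'.+1) := mu i.+1.
have mu0 i : 0 < mu' i by exact: (ritz_value_pos psio psiE).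
have muE a : range P a ->
    qf h a = \sum_i sqn (ip H a (psi i)) * mu' i /\
    qf (ip H) a = \sum_i sqn (ip H a (psi i)).
  move=> Pa; split.
    rewrite /qf (form_expand psio psiP psiE Pa Pa) re_sum; apply: eq_bigr => i _.
    by rewrite mul_conj -rmorphM re_of_real.
  rewrite /qf (ip_expand psio psiP _ Pa) re_sum; apply: eq_bigr => i _.
  by rewrite mul_conj re_of_real.
have mu_le a : range P a -> qf h a <= mu m'.+1 * qf (ip H) a.
  move=> /muE[-> ->]; rewrite mulr_sumr; apply: ler_sum => i _.
  by rewrite mulrC ler_wpM2r ?sqn_ge0 //; apply: mu_mono.
have mu_ge a : range P a -> mu 1%N * qf (ip H) a <= qf h a.
  move=> /muE[-> ->]; rewrite mulr_sumr; apply: ler_sum => i _.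
  by rewrite [leRHS]mulrC ler_wpM2r ?sqn_ge0 //; apply: mu_mono.
have mu10 : 0 < mu 1%N by exact: (mu0 ord0).
have mu1m : mu 1%N <= mu m'.+1 by apply: mu_mono.
have lamk := cluster_ge0 (ltn0Sn m') hlam hlam3.
have Lp0 : 0 < lam (k.+1 + m'.+1)%N.
  by apply: le_lt_trans hlam3; rewrite -hlam2; apply/ltW/(le_lt_trans lamk).
move: heta; rewrite /gamma_s /= lt_min => /andP[heta1 heta2].
(* In this form sg / (1 - sg) < (b - a) / (b + a) reads a < (1 - 2 sg) b. *)
have gap1 : mu m'.+1 < (1 - 2 * sg) * lam (k.+1 + m'.+1)%N.
  move: heta1; have s1 : 0 < 1 - sg by lra.
  have l1 : 0 < lam (k.+1 + m'.+1)%N + mu m'.+1 by lra.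
  rewrite ltr_pdivrMr // mulrAC ltr_pdivlMr //; lra.
have gap2 : lam k < (1 - 2 * sg) * mu 1%N.
  move: heta2; have s1 : 0 < 1 - sg by lra.
  have l1 : 0 < mu 1%N + lam k by lra.
  rewrite ltr_pdivrMr // mulrAC ltr_pdivlMr //; lra.
have [G [GV GP]] := ex_green h (range P).
have [g0 core] := cluster_residual hP ZV ZP sg01 Zsg mu_le mu_ge mu10 mu1m
  (ltn0Sn m') hlam hlam1 hlam2 hlam3 gap1 gap2 GV GP.
set g := relative_gap h P (lam k.+1) in g0 core *.
have c0 : 0 <= sg / g by apply: divr_ge0 => //; exact: ltW.
have core' a : range P a ->
    qf h (xi_residual mu' psi (lam k.+1) a) <= (sg / g) ^+ 2 * qf h (Z a).
  move=> Pa; have Pr := ritz_calculus_range psiP (fun i => 1 - lam k.+1 / mu' i) a.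
  have := core a _ Pa Pr (fun v Pv => xi_residual_form (lam k.+1) psio psiP psiE Pa Pv) => h1.
  by rewrite exprMn exprVn mulrAC ler_pdivlMr ?exprn_gt0 // mulrC.
have x_eta (i : 'I_m'.+1) : 0 <= x i <= eta h P m'.+1 i.+1 ^+ 2.
  have [xi0 _] := andP (x01 i); have [e1 _] := andP (etaB i).
  rewrite xi0 -[x i]sqr_sqrtr // ler_sqr ?nnegrE ?sqrtr_ge0 //.
split=> [N e he|].
  exact: (ui_norm_bound hP hsqrt psio psiP psiE fP fo ZV ZP fZ x_eta c0 core' N he).
rewrite -[sg / g]ger0_norm // -sqrtr_sqr -sqrtrM ?sqr_ge0 //; apply: ler_wsqrtr.
rewrite !big_add1 /= !big_mkord.
have := hs_norm_bound psio psiP psiE fP fo fZ x_eta core'.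
apply: le_trans; rewrite le_eqVlt; apply/orP; left; apply/eqP.
apply: eq_bigr => i _; have := mu0 i; rewrite /mu' => mi.
by field; rewrite gt_eqF.
Qed.
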